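(* Let $n\ge 2$ and $d\ge 2$ be integers, and let $0<\alpha,\gamma<1$ be fixed real numbers. Then there exists a non-trivial polynomial $G\in\mathbb Q[X_1,\ldots,X_n]$ such that $G(2^{m_1},\ldots,2^{m_n})=0$ for all but finitely many elements $(2^{m_1},\ldots,2^{m_n})$ of the set $$\mathcal S=\Big\{(2^{m_1},\ldots,2^{m_n})\in\mathbb Z^n : 0<m_1<\cdots<m_n,\ \big(m_{n-1}\le\alpha m_n \text{ or } m_1\ge\gamma m_n\big),\ 1+2^{m_1}+\cdots+2^{m_n}=z^d \text{ for some } z\in\mathbb Z\Big\}.$$
   Context: The $m_i$ are integers. *)

(* Defs.v *)
From mathcomp Require Import all_boot all_order all_algebra.
From mathcomp Require Import classical_sets cardinality reals.
From mathcomp Require Import mpoly.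

Set Implicit Arguments.
Unset Strict Implicit.
Unset Printing Implicit Defensive.

Import Order.TTheory GRing.Theory Num.Theory.
Local Open Scope classical_set_scope.
Local Open Scope ring_scope.

(* The tuple m lists (m_1, ..., m_n), so m_1, m_(n-1) and m_n are m`_0,
   m`_n.-2 and m`_n.-1 (this reading needs 2 <= n).  [path <%R 0 m] says
   0 < m_1 < ... < m_n; in particular every exponent is positive, so the
   integer power 2 ^ k, which is not the true inverse power in the ring int
   when k < 0, is only ever used where it has its usual meaning. *)
Definition perfect_power_points (n d : nat) (R : realType) (alpha gamma : R) :
    set (n.-tuple int) :=
  [set x | exists m : n.-tuple int,
    [/\ x = [tuple (2 : int) ^ tnth m i | i < n],
        path <%R 0 m,
        (m`_n.-2)%:~R <= alpha * (m`_n.-1)%:~R \/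
          gamma * (m`_n.-1)%:~R <= (m`_0)%:~R
      & exists z : int, 1 + \sum_(i < n) (2 : int) ^ tnth m i = z ^+ d]].
Arguments perfect_power_points n d {R} alpha gamma.

(* Main.v *)
(** Let [p = d] if [d] is odd and [p = 2] otherwise, so that [1 + x_1 + ... + x_n = z^p].

    If [m_1 >= gamma m_n], then [p^(2K) z] agrees up to sign, modulo a high power of [2], with [p^(2K)]
    times the [K]-th truncation of [(1 + X)^(1/p)] at [X = x_1 + ... + x_n], a sum of boundedly many terms
    [C 2^e].  The exponents [e] leave a gap somewhere above [m_n]; since [z] is small, [p^(2K) z] equals
    the partial sum of the terms below the gap, and its [p]-th power is a polynomial relation of one of
    finitely many shapes.

    If [m_(n-1) <= alpha m_n], the method of Thue applies to two solutions of very different sizes; no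
    Subspace theorem is needed.  By Dirichlet's theorem the ratios of the first solution are
    [2^(-sigma_i) = 2^(-b_i) (2^-s)^(c_i)] with small [b_i], so the first solution yields a good point of
    the curve [w^p = f(Y)], where [f = 1 + sum_i 2^(-b_i) Y^(c_i)] has controlled height.  For the
    second solution, multiplication by its [p]-th root is almost a linear map on the span of boundedly
    many powers of [2], which is what replaces the single approximation of Thue's argument.  Siegel's
    lemma provides the auxiliary polynomials, a Wronskian bounds their order of vanishing, and the two
    solutions contradict each other unless [f] is a constant times a [p]-th power.  In that exceptional
    case the coefficients of [(1 + sum_i 2^(-sigma_i) Y^(c_i))^(1/p)] vanish beyond a bounded degree,
    which is again a polynomial relation of one of finitely many shapes. *)

Require Import Defs.
From mathcomp Require Import all_boot all_order all_algebra.
From mathcomp Require Import zify ring lra.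
From mathcomp Require Import perm.
From mathcomp Require boolp.

Set Implicit Arguments.
Unset Strict Implicit.
Unset Printing Implicit Defensive.

Import Order.TTheory GRing.Theory Num.Theory.
Local Open Scope ring_scope.

Implicit Types (P Q : {poly rat}) (r y c : rat).

(** * Weighted norms and integral polynomials *)

(** With [w] the root of the second solution divided by [2^q], the auxiliary quantity has
    denominator about [2^(T + q)] and size about [2^-(T + m)]. The gain is [m] and the cost is
    [q <= m / p <= m / 2], so a contradiction only needs all other heights, orders of vanishing and
    denominators to be small fractions of [m]. The obstacle is a pair of exponents of the span at a
    moderate distance: too close for their coefficients to be told apart, too far to be merged at
    the price of a small denominator. The exponents are therefore clustered at a scale [k] such that
    no difference lies between [m / N k.+1] and [m / N k]. This scale depends on the second
    solution, whereas the curve comes from the first one and must be fine enough for the scale.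
    Hence each of the finitely many scales has its own first solution: either all large solutions
    satisfy the relation, or one exception is fixed and excludes all much larger solutions of that
    scale. The threshold obtained in this way is not effective. *)

Definition nrm (r : rat) (P : {poly rat}) : rat := \sum_(i < size P) `|P`_i| * r ^+ i.

Lemma nrm_wide n r P : (size P <= n)%N -> nrm r P = \sum_(i < n) `|P`_i| * r ^+ i.
Proof.
move=> le_Pn; rewrite /nrm (big_ord_widen n (fun i => `|P`_i| * r ^+ i)) //.
rewrite big_mkcond; apply: eq_bigr => i _; case: ifP => // /negbT.
by rewrite -leqNgt => ge_iP; rewrite nth_default // normr0 mul0r.
Qed.

Lemma nrm_ge0 r P : 0 <= r -> 0 <= nrm r P.
Proof. by move=> r0; apply: sumr_ge0 => i _; rewrite mulr_ge0 // exprn_ge0. Qed.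

Lemma nrmD r P Q : 0 <= r -> nrm r (P + Q) <= nrm r P + nrm r Q.
Proof.
move=> r0; pose n := maxn (size P) (size Q).
rewrite (@nrm_wide n _ (P + Q)) ?size_polyD // (@nrm_wide n _ P) ?leq_maxl //.
rewrite (@nrm_wide n _ Q) ?leq_maxr // -big_split; apply: ler_sum => i _ /=.
by rewrite coefD -mulrDl ler_wpM2r ?exprn_ge0 // ler_normD.
Qed.

Lemma nrmC r c : nrm r c%:P = `|c|.
Proof.
by rewrite (@nrm_wide 1) ?size_polyC_leq1 // big_ord1 coefC eqxx expr0 mulr1.
Qed.

Lemma nrm0 r : nrm r 0 = 0.
Proof. by rewrite -[0 : {poly _}]/(0%:P) nrmC normr0. Qed.

Lemma nrmN r P : nrm r (- P) = nrm r P.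
Proof. by rewrite /nrm size_polyN; apply: eq_bigr => i _; rewrite coefN normrN. Qed.

Lemma nrmB r P Q : 0 <= r -> nrm r (P - Q) <= nrm r P + nrm r Q.
Proof. by move=> r0; rewrite -(nrmN r Q) nrmD. Qed.

Lemma nrmZ r c P : nrm r (c *: P) = `|c| * nrm r P.
Proof.
rewrite (@nrm_wide (size P)) ?size_scale_leq // mulr_sumr.
by apply: eq_bigr => i _; rewrite coefZ normrM mulrA.
Qed.

Lemma nrmMX r P : nrm r (P * 'X) = nrm r P * r.
Proof.
rewrite (@nrm_wide (size P).+1); last first.
  by have [->|nz] := eqVneq P 0; rewrite ?mul0r ?size_poly0 // size_mulX.
rewrite big_ord_recl coefMX eqxx normr0 mul0r add0r mulr_suml.
by apply: eq_bigr => i _; rewrite coefMX /= exprSr mulrA.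
Qed.

Lemma nrm_sum r (I : Type) (s : seq I) (p : pred I) (F : I -> {poly rat}) : 0 <= r ->
  nrm r (\sum_(i <- s | p i) F i) <= \sum_(i <- s | p i) nrm r (F i).
Proof.
move=> r0; elim/big_ind2: _ => [|x1 x2 y1 y2 h1 h2|i _] //; first by rewrite nrm0.
by apply: le_trans (nrmD _ _ r0) _; apply: lerD.
Qed.

Lemma nrmM r P Q : 0 <= r -> nrm r (P * Q) <= nrm r P * nrm r Q.
Proof.
move=> r0; elim/poly_ind: P => [|P c IH]; first by rewrite mul0r nrm0 mul0r.
have -> : nrm r (P * 'X + c%:P) = nrm r P * r + `|c|.
  rewrite (@nrm_wide (size P).+1); last first.
    by rewrite size_MXaddC; case: ifP.
  rewrite big_ord_recl coefD coefMX eqxx coefC eqxx add0r expr0 mulr1 addrC.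
  congr (_ + _); rewrite mulr_suml; apply: eq_bigr => i _.
  by rewrite coefD coefMX coefC /= addr0 exprSr mulrA.
rewrite mulrDl mulrDl mul_polyC mulrAC.
apply: le_trans (nrmD _ _ r0) _; rewrite nrmZ nrmMX lerD2r mulrAC.
by rewrite ler_wpM2r.
Qed.

Lemma nrmX r P n : 0 <= r -> nrm r (P ^+ n) <= nrm r P ^+ n.
Proof.
move=> r0; elim: n => [|n IH]; first by rewrite !expr0 -[1]/(1%:P) nrmC normr1.
rewrite !exprS; apply: le_trans (nrmM _ _ r0) _.
by rewrite ler_wpM2l ?nrm_ge0.
Qed.

Lemma nrm_mono r1 r2 P : 0 <= r1 -> r1 <= r2 -> nrm r1 P <= nrm r2 P.
Proof.
move=> r0 r12; apply: ler_sum => i _; rewrite ler_wpM2l //.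
by rewrite lerXn2r // nnegrE // (le_trans r0).
Qed.

Lemma nrm_comp r P Q : 0 <= r -> nrm r (P \Po Q) <= nrm (nrm r Q) P.
Proof.
move=> r0; rewrite comp_polyE; apply: le_trans (nrm_sum _ _ _ r0) _.
apply: ler_sum => i _; rewrite nrmZ ler_wpM2l //; exact: nrmX.
Qed.

Lemma nrm_coef r P i : 0 <= r -> `|P`_i| * r ^+ i <= nrm r P.
Proof.
move=> r0; have [lt_iP|] := ltnP i (size P); last first.
  by move=> ?; rewrite nth_default // normr0 mul0r nrm_ge0.
rewrite /nrm (bigD1 (Ordinal lt_iP)) //= lerDl sumr_ge0 // => j _.
by rewrite mulr_ge0 // exprn_ge0.
Qed.

Lemma nrm_shift r y P : 0 <= r -> 0 <= y -> nrm r (P \Po ('X + y%:P)) <= nrm (r + y) P.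
Proof.
move=> r0 y0; apply: le_trans (nrm_comp _ _ r0) _; apply: nrm_mono; first exact: nrm_ge0.
apply: le_trans (nrmD _ _ r0) _; rewrite nrmC ger0_norm // lerD2r.
by rewrite -['X]mul1r nrmMX -[1]/(1%:P) nrmC normr1 mul1r.
Qed.

(** The analogue of the Schwarz lemma for this norm: a zero of order [k] at the origin pays off each
    time the radius shrinks. All smallness estimates below come from it. *)
Lemma nrm_shrink r1 r2 P k : 0 <= r1 -> 0 < r2 -> r1 <= r2 ->
  (forall i, (i < k)%N -> P`_i = 0) -> nrm r1 P <= (r1 / r2) ^+ k * nrm r2 P.
Proof.
move=> r10 r20 r12 vP; rewrite /nrm mulr_sumr; apply: ler_sum => i _.
have [/vP->|le_ki] := ltnP i k; first by rewrite normr0 !mul0r mulr0.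
rewrite mulrCA ler_wpM2l //.
have -> : r1 ^+ i = (r1 / r2) ^+ i * r2 ^+ i by rewrite -exprMn divfK // gt_eqF.
rewrite ler_wpM2r ?exprn_ge0 ?(ltW r20) //.
apply: ler_wiXn2l => //; first by rewrite divr_ge0 // ltW.
by rewrite ler_pdivrMr // mul1r.
Qed.

Lemma horner_nrm y P : 0 <= y -> `|P.[y]| <= nrm y P.
Proof.
move=> y0; rewrite horner_coef; apply: le_trans (ler_norm_sum _ _ _) _.
by apply: ler_sum => i _; rewrite normrM normrX (ger0_norm y0).
Qed.

Definition pint (P : {poly rat}) := forall i, P`_i \is a Num.int.

Lemma pint0 : pint 0.
Proof. by move=> i; rewrite coef0. Qed.
Lemma pintC c : c \is a Num.int -> pint c%:P.
Proof. by move=> hc i; rewrite coefC; case: ifP. Qed.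
Lemma pint1 : pint 1.
Proof. exact: pintC. Qed.
Lemma pintD P Q : pint P -> pint Q -> pint (P + Q).
Proof. by move=> hP hQ i; rewrite coefD rpredD. Qed.
Lemma pintN P : pint P -> pint (- P).
Proof. by move=> hP i; rewrite coefN rpredN. Qed.
Lemma pintB P Q : pint P -> pint Q -> pint (P - Q).
Proof. by move=> hP hQ; apply: pintD => //; apply: pintN. Qed.
Lemma pintM P Q : pint P -> pint Q -> pint (P * Q).
Proof. by move=> hP hQ i; rewrite coefM rpred_sum // => j _; rewrite rpredM. Qed.
Lemma pintZ c P : c \is a Num.int -> pint P -> pint (c *: P).
Proof. by move=> hc hP i; rewrite coefZ rpredM. Qed.
Lemma pintX P n : pint P -> pint (P ^+ n).
Proof.
by move=> hP; elim: n => [|n IH]; [exact: pint1 | rewrite exprS; apply: pintM].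
Qed.
Lemma pint_sum (I : Type) (s : seq I) (p : pred I) (F : I -> {poly rat}) :
  (forall i, p i -> pint (F i)) -> pint (\sum_(i <- s | p i) F i).
Proof. by move=> hF j; rewrite coef_sum rpred_sum // => i /hF. Qed.
Lemma pintXn n : pint 'X^n.
Proof. by move=> i; rewrite coefXn rpred_nat. Qed.
Lemma pint_deriv P : pint P -> pint P^`().
Proof. by move=> hP i; rewrite coef_deriv rpredMn. Qed.

(** * Truncations of the binomial series *)

Lemma coef_lowM P Q k : (forall i, (i < k)%N -> P`_i = 0) -> (P * Q)`_k = P`_k * Q`_0.
Proof.
move=> vP; rewrite coefM big_ord_recr /= subnn big1 ?add0r // => i _.
by rewrite vP ?mul0r.
Qed.

Lemma coef0X P k : (P ^+ k)`_0 = P`_0 ^+ k.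
Proof. by rewrite -!horner_coef0 horner_exp. Qed.

(** As [P - Q] starts in degree [k], its cofactor in [P ^+ p - Q ^+ p] contributes only its constant
    coefficient, a sum of [p] ones. *)
Lemma coef_expB p k P Q : P`_0 = 1 -> Q`_0 = 1 ->
  (forall i, (i < k)%N -> P`_i = Q`_i) ->
  (P ^+ p)`_k - (Q ^+ p)`_k = p%:R * (P`_k - Q`_k).
Proof.
move=> P0 Q0 eqPQ; rewrite -coefB subrXX coef_lowM => [|i lt_ik]; last first.
  by rewrite coefB eqPQ ?subrr.
rewrite coefB mulrC; congr (_ * _); rewrite coef_sum.
transitivity (\sum_(i < p) (1 : rat)); last by rewrite sumr_const card_ord.
by apply: eq_bigr => i _; rewrite coef0M !coef0X P0 Q0 !expr1n mulr1.
Qed.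

Lemma root_uniq p k P Q : (0 < p)%N -> P`_0 = 1 -> Q`_0 = 1 ->
  (forall i, (i <= k)%N -> (P ^+ p)`_i = (Q ^+ p)`_i) ->
  forall i, (i <= k)%N -> P`_i = Q`_i.
Proof.
move=> p0 P0 Q0 eqp; elim/ltn_ind => i IH le_ik.
have eqi j : (j < i)%N -> P`_j = Q`_j by move=> lt; apply: IH => //; lia.
have := coef_expB p P0 Q0 eqi; rewrite eqp // subrr => /esym/eqP.
by rewrite mulf_eq0 pnatr_eq0 (gtn_eqF p0) /= subr_eq0 => /eqP.
Qed.

Definition bcoef (p k : nat) : rat := \prod_(i < k) ((p%:R^-1 - i%:R) / i.+1%:R).
Definition binp (p M : nat) : {poly rat} := \poly_(k < M.+1) bcoef p k.

Lemma bcoef0 p : bcoef p 0 = 1.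
Proof. by rewrite /bcoef big_ord0. Qed.

Lemma bcoefS p k : bcoef p k.+1 = bcoef p k * ((p%:R^-1 - k%:R) / k.+1%:R).
Proof. by rewrite /bcoef big_ord_recr. Qed.

Lemma bcoef_le1 p k : (0 < p)%N -> `|bcoef p k| <= 1.
Proof.
move=> p0; elim: k => [|k IH]; first by rewrite bcoef0 normr1.
rewrite bcoefS normrM; apply: mulr_ile1 => //.
have pi0 : 0 <= (p%:R^-1 : rat) by rewrite invr_ge0 ler0n.
have pi1 : (p%:R^-1 : rat) <= 1 by rewrite invf_le1 ?ltr0n // ler1n.
rewrite normrM normfV (ger0_norm (ler0n _ k.+1)) ler_pdivrMr ?ltr0n // mul1r.
have := ler0n rat k; move: pi0 pi1; rewrite -natr1; set a := (_^-1); set b := k%:R => *.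
by rewrite ler_norml; apply/andP; split; lra.
Qed.

Lemma bcoef_neq0 p k : (1 < p)%N -> bcoef p k != 0.
Proof.
move=> p1; elim: k => [|k IH]; first by rewrite bcoef0 oner_eq0.
rewrite bcoefS mulf_neq0 // mulf_neq0 ?invr_eq0 ?pnatr_eq0 //.
have p0 : (p%:R : rat) != 0 by rewrite pnatr_eq0; lia.
rewrite subr_eq0; apply/eqP => eq1.
have : (1 : rat) = (k * p)%:R by rewrite natrM -eq1 mulVf.
by move/eqP; rewrite -[1]/(1%:R) eqr_nat => /eqP; case: k {IH eq1} => [|k]; nia.
Qed.

Lemma coef_binp p M k : (binp p M)`_k = if (k <= M)%N then bcoef p k else 0.
Proof. by rewrite coef_poly ltnS. Qed.

Lemma size_binp p M : (size (binp p M) <= M.+1)%N.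
Proof. exact: size_poly. Qed.

(** The binomial series solves [p (1 + X) B' = B]; truncation breaks the coefficient recursion in
    degree [M] only. *)
Lemma binp_ode p M : (0 < p)%N ->
  exists c, p%:R *: ((1 + 'X) * (binp p M)^`()) - binp p M = c *: 'X^M.
Proof.
move=> p0; exists (p%:R * (bcoef p M *+ M) - bcoef p M).
have pn0 : (p%:R : rat) != 0 by rewrite pnatr_eq0; lia.
apply/polyP => k; rewrite coefB coefZ mulrDl mul1r coefD coefXM !coef_deriv.
rewrite !coef_binp coefZ coefXn.
case: (ltngtP k M) => [lt_kM|gt_kM|->] /=.
- rewrite mulr0 bcoefS.
  have -> : (if k == 0 then 0 else
    (if (k.-1.+1 <= M)%N then bcoef p k.-1.+1 else 0) *+ k.-1.+1) = bcoef p k *+ k.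
    by case: k lt_kM => [|k] lt //=; rewrite (ltnW lt).
  rewrite -(mulr_natr (_ * _)) -(mulr_natr (bcoef p k) k).
  have k1 : (k.+1%:R : rat) != 0 by rewrite pnatr_eq0.
  by rewrite -natr1 in k1 *; field; rewrite k1 pn0.
- case: k gt_kM => // k gt_kM /=.
  have -> : (k < M)%N = false by lia.
  by rewrite !mul0rn !addr0 !mulr0.
- rewrite mul0rn add0r mulr1; congr (_ * _ - _).
  by case: M => [|M] //=; rewrite leqnn.
Qed.

Lemma binp0 p M : (binp p M)`_0 = 1.
Proof. by rewrite coef_binp bcoef0. Qed.

(** The [p]-th power inherits a differential equation from [binp_ode]. Its recursion carries the
    factor [1 - j], which kills the coefficients after degree 1. *)
Lemma coef_binpX p M k : (0 < p)%N -> (0 < M)%N -> (k <= M)%N ->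
  (binp p M ^+ p)`_k = (1 + 'X : {poly rat})`_k.
Proof.
move=> p0 M0; have [c ode] := binp_ode M p0.
set B := binp p M in ode *; set G := B ^+ p.
have G0 : G`_0 = 1 by rewrite coef0X binp0 expr1n.
have odeG : (1 + 'X) * G^`() - G = c *: 'X^M * B ^+ p.-1.
  have G' : G^`() = p%:R *: (B^`() * B ^+ p.-1) by rewrite deriv_exp scaler_nat.
  have GB : G = B * B ^+ p.-1 by rewrite -exprS prednK.
  rewrite -ode mulrBl -GB G' -scalerAl; congr (_ - _).
  by rewrite -scalerAr mulrA.
have rec j : (j < M)%N -> G`_j.+1 * j.+1%:R = G`_j * (1 - j%:R).
  move=> lt_jM; have := congr1 (fun P : {poly rat} => P`_j) odeG => /=.
  rewrite coefB mulrDl mul1r coefD coefXM !coef_deriv -scalerAl coefZ coefXnM lt_jM mulr0.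
  have -> : (if j == 0 then 0 else G`_j.-1.+1 *+ j.-1.+1) = G`_j *+ j by case: j {lt_jM}.
  rewrite -(mulr_natr G`_j.+1) -(mulr_natr G`_j) => e; have {e} : G`_j.+1 * j.+1%:R = G`_j - G`_j * j%:R by lra.
  by move=> ->; ring.
elim: k => [_|k IH lt_kM]; first by rewrite G0 coefD coefC coefX /= addr0.
have /eqP := rec k lt_kM; rewrite IH ?(ltnW lt_kM) // !coefD !coefC !coefX.
case: k {IH} lt_kM => [|[|k]] lt_kM /=.
- by move/eqP; lra.
- by move/eqP; lra.
by rewrite !addr0 mul0r mulf_eq0 pnatr_eq0 orbF => /eqP.
Qed.

Lemma nrm_binp p M r : (0 < p)%N -> 0 <= r -> r <= 2^-1 -> nrm r (binp p M) <= 2.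
Proof.
move=> p0 r0 r2; rewrite (nrm_wide _ (size_binp p M)).
have key n : \sum_(i < n) (2^-1 : rat) ^+ i <= 2 - 2 * 2^-1 ^+ n.
  elim: n => [|n IH]; first by rewrite big_ord0 expr0; lra.
  by rewrite big_ord_recr /= exprS; set a := _ ^+ n in IH *; lra.
apply: le_trans (_ : \sum_(i < M.+1) (2^-1 : rat) ^+ i <= _); last first.
  by apply: le_trans (key _) _; rewrite gerBl mulr_ge0 // exprn_ge0.
apply: ler_sum => i _; rewrite -[leRHS]mul1r ler_pM ?exprn_ge0 //.
  by rewrite coef_binp; case: ifP; rewrite ?normr0 ?bcoef_le1.
by rewrite lerXn2r // ?nnegrE ?invr_ge0.
Qed.

(** Beyond degree [M] the remainder has the coefficients of [binp p M ^+ p], whose norm at radius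
    1/2 is at most [2 ^+ p]; [nrm_shrink] starts from that radius. *)
Lemma nrm_binpX_rem p M r : (0 < p)%N -> (0 < M)%N -> 0 <= r -> r <= 2^-1 ->
  nrm r (binp p M ^+ p - (1 + 'X)) <= (2 * r) ^+ M.+1 * 2 ^+ p.
Proof.
move=> p0 M0 r0 r2; set P := _ - _.
have vP i : (i < M.+1)%N -> P`_i = 0 by move=> ?; rewrite coefB coef_binpX ?subrr.
apply: le_trans (nrm_shrink r0 (_ : 0 < 2^-1) r2 vP) _ => //.
rewrite invrK [r * 2]mulrC ler_wpM2l ?exprn_ge0 ?mulr_ge0 //.
have hi : 0 <= (2^-1 : rat) by rewrite invr_ge0.
apply: (@le_trans _ _ (nrm 2^-1 (binp p M ^+ p))); last first.
  apply: le_trans (nrmX _ _ hi) _; rewrite lerXn2r ?nnegrE ?nrm_ge0 //.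
  exact: nrm_binp.
pose n := maxn (size P) (size (binp p M ^+ p)).
rewrite (@nrm_wide n _ P) ?leq_maxl // (@nrm_wide n _ (_ ^+ p)) ?leq_maxr //.
apply: ler_sum => i _; rewrite ler_wpM2r ?exprn_ge0 //.
have [le_iM|gt_iM] := ltnP i M.+1; first by rewrite vP ?normr0.
rewrite /P coefB coefD coefC coefX.
have -> : (i == 0 :> nat)%N = false by lia.
have -> : (i == 1 :> nat)%N = false by lia.
by rewrite /= ?addr0 ?subr0.
Qed.

(* The coefficients of [(1 + p^2 X)^(1/p)] beyond the constant one are integers divisible by [p]:
   comparing the coefficients of [X^k] in its [p]-th power determines the [k]-th one from the previous ones. *)
Lemma bcoef_int p k : (0 < p)%N -> (p%:R ^+ (2 * k) * bcoef p k) \is a Num.int.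
Proof.
move=> p0; have pn0 : (p%:R : rat) != 0 by rewrite pnatr_eq0; lia.
have pZ : (p%:R : rat) \is a Num.int by rewrite rpred_nat.
suff [->|[b bint ->]] : k = 0%N \/ exists2 b, b \is a Num.int & p%:R ^+ (2 * k) * bcoef p k = p%:R * b.
- by rewrite bcoef0 muln0 expr0 mulr1.
- by rewrite rpredM.
elim/ltn_ind: k => k IH; case: (posnP k) => k0; [by left | right].
pose a j := p%:R^-1 * (p%:R ^+ (2 * j) * bcoef p j).
have aint j : (0 < j < k)%N -> a j \is a Num.int.
  by case/andP=> j0 /IH[ej|[b bint eb]]; [lia | rewrite /a eb mulKf].
pose S : {poly rat} := \poly_(j < k) (if j == 0%N then 0 else a j).
have Sint : pint S.
  move=> j; rewrite coef_poly; case: ifP => // lt_jk.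
  by case: ifP => [//|/negbT j0]; rewrite aint // lt0n j0.
pose T := 1 + p%:R *: S; pose B' := binp p k \Po (p%:R ^+ 2 *: 'X).
have eB' j : B'`_j = p%:R ^+ (2 * j) * (binp p k)`_j.
  have -> : B' = \poly_(i < k.+1) (p%:R ^+ (2 * i) * (binp p k)`_i).
    rewrite /B' comp_polyE poly_def (big_ord_widen k.+1 (fun i => (binp p k)`_i *: (p%:R ^+ 2 *: 'X) ^+ i)) ?size_binp //.
    rewrite big_mkcond; apply: eq_bigr => i _; rewrite exprZn scalerA -exprM mulrC.
    by case: ifP => // /negbT; rewrite -leqNgt => h; rewrite nth_default // mulr0 scale0r.
  rewrite coef_poly; case: ifP => // /negbT h; rewrite nth_default ?mulr0 //.
  by apply: leq_trans (size_binp _ _) _; rewrite leqNgt.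
have B'0 : B'`_0 = 1 by rewrite eB' binp0 muln0 expr0 mulr1.
have T0 : T`_0 = 1 by rewrite coefD coefC coefZ coef_poly k0 /= mulr0 addr0.
have eqBT j : (j < k)%N -> B'`_j = T`_j.
  move=> lt_jk; case: (posnP j) => [->|j0]; first by rewrite B'0 T0.
  rewrite coefD coefC coefZ coef_poly lt_jk (gtn_eqF j0) add0r eB' coef_binp (ltnW lt_jk).
  by rewrite /a mulVKf.
(* [S] has no coefficient in degree [k], so this makes the [k]-th coefficient of [T ^+ p] a multiple
   of [p ^ 2]; one factor [p] survives the division in [coef_expB]. *)
have [Q Qint eT] : exists2 Q, pint Q & T ^+ p = 1 + p%:R ^+ 2 *: S + p%:R ^+ 2 *: Q.
  have ext n : exists2 Q, pint Q & T ^+ n = 1 + (p%:R * n%:R) *: S + p%:R ^+ 2 *: Q.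
    elim: n => [|n [Q Qint eQ]].
      exists 0; first exact: pint0.
      by rewrite mulr0 scale0r scaler0 !addr0 expr0.
    exists (n%:R *: S ^+ 2 + Q + p%:R *: (S * Q)).
      by do ![apply: pintD | apply: pintZ | apply: pintX | apply: pintM | rewrite rpred_nat].
    by rewrite exprS eQ /T -natr1 -!mul_polyC !(polyCM, polyC_exp, polyCD); ring.
  by have [Q Qint eQ] := ext p; exists Q => //; rewrite eQ expr2.
have Bk : (B' ^+ p)`_k = p%:R ^+ 2 *+ (k == 1%N).
  have -> : B' ^+ p = (binp p k ^+ p) \Po (p%:R ^+ 2 *: 'X) by rewrite rmorphXn.
  have agree : forall i, (i < k.+1)%N -> (binp p k ^+ p - (1 + 'X))`_i = 0.
    by move=> i lt_i; rewrite coefB coef_binpX ?subrr.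
  set D := _ - _ in agree; have -> : binp p k ^+ p = D + (1 + 'X) by rewrite /D subrK.
  rewrite comp_polyD coefD; have -> : (D \Po (p%:R ^+ 2 *: 'X))`_k = 0.
    rewrite comp_polyE coef_sum big1 // => i _; rewrite coefZ exprZn coefZ coefXn.
    case: eqP => [<-|]; last by rewrite !mulr0.
    by rewrite agree ?mul0r.
  rewrite add0r comp_polyD comp_polyX -polyC1 comp_polyC coefD coefC coefZ coefX.
  by rewrite (gtn_eqF k0) add0r; case: eqP; rewrite ?mulr1 ?mulr0.
have := coef_expB p B'0 T0 eqBT.
have Sk : S`_k = 0 by rewrite coef_poly ltnn.
have -> : T`_k = 0 by rewrite coefD coefC coefZ (gtn_eqF k0) Sk mulr0 addr0.
have -> : (T ^+ p)`_k = p%:R ^+ 2 * Q`_k.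
  by rewrite eT !coefD coefC !coefZ (gtn_eqF k0) Sk mulr0 !add0r.
rewrite Bk subr0 eB' coef_binp leqnn => e.
exists ((k == 1%N)%:R - Q`_k); first by rewrite rpredB ?rpred_nat // Qint.
apply: (mulfI pn0); rewrite -e -(mulr_natr (_ ^+ 2)); ring.
Qed.

(** * Wronskians *)

Definition vanish (m : nat) P := forall i, (i < m)%N -> P`_i = 0.

Lemma vanish0 m : vanish m 0.
Proof. by move=> i _; rewrite coef0. Qed.
Lemma vanishD m P Q : vanish m P -> vanish m Q -> vanish m (P + Q).
Proof. by move=> hP hQ i lt; rewrite coefD hP ?hQ ?addr0. Qed.
Lemma vanishN m P : vanish m P -> vanish m (- P).
Proof. by move=> hP i lt; rewrite coefN hP ?oppr0. Qed.
Lemma vanishM m P Q : vanish m P -> vanish m (P * Q).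
Proof.
move=> hP i lt; rewrite coefM big1 // => j _; rewrite hP ?mul0r //.
by apply: leq_ltn_trans lt; rewrite -ltnS.
Qed.
Lemma vanishMl m P Q : vanish m P -> vanish m (Q * P).
Proof. by rewrite mulrC; apply: vanishM. Qed.
Lemma vanishZ m c P : vanish m P -> vanish m (c *: P).
Proof. by rewrite -mul_polyC; apply: vanishMl. Qed.
Lemma vanish_sum m (I : Type) (s : seq I) (p : pred I) (F : I -> {poly rat}) :
  (forall i, p i -> vanish m (F i)) -> vanish m (\sum_(i <- s | p i) F i).
Proof. by move=> hF; elim/big_ind: _ => //; [exact: vanish0 | move=> *; apply: vanishD]. Qed.
Lemma vanish_deriv m P : vanish m P -> vanish m.-1 P^`().
Proof. by move=> hP i lt; rewrite coef_deriv hP ?mul0rn //; lia. Qed.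
Lemma vanish_le m n P : (m <= n)%N -> vanish n P -> vanish m P.
Proof. by move=> le hP i lt; apply: hP; apply: leq_trans lt le. Qed.
Lemma vanishMM m n P Q : vanish m P -> vanish n Q -> vanish (m + n) (P * Q).
Proof.
move=> hP hQ i lt; rewrite coefM big1 // => j _.
have [lt_jm|ge_jm] := ltnP j m; first by rewrite hP ?mul0r.
by rewrite hQ ?mulr0 //; have := ltn_ord j; lia.
Qed.
Lemma vanishX m P k : vanish m P -> vanish (k * m) (P ^+ k).
Proof.
by move=> hP; elim: k => [|k IH] //; rewrite exprS mulSn; apply: vanishMM.
Qed.
Lemma vanish_unit m P Q : Q`_0 != 0 -> vanish m (P * Q) -> vanish m P.
Proof.
move=> Q0 hPQ; elim/ltn_ind => i IH lt; have := hPQ i lt.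
rewrite coef_lowM => [/eqP|j ltj]; last by apply: IH => //; lia.
by rewrite mulf_eq0 (negPf Q0) orbF => /eqP.
Qed.

(** The derivative of [Q / P] vanishes. Leading coefficients force equal sizes ([same]); after
    subtracting the multiple of [P] that cancels the leading term, a solution of smaller size
    remains, which must be zero. *)
Lemma deriv_cross_prop P Q : P != 0 -> P * Q^`() = P^`() * Q -> exists c, Q = c *: P.
Proof.
move=> P0.
have same (Z : {poly rat}) : Z != 0 -> P * Z^`() = P^`() * Z -> size Z = size P.
  move=> Z0 e; have := congr1 (fun U : {poly rat} => U`_((size P).-1 + (size Z).-1).-1) e.
  have sP : (0 < size P)%N by rewrite size_poly_gt0.
  have sZ : (0 < size Z)%N by rewrite size_poly_gt0.
  have top (U T : {poly rat}) : U != 0 -> T != 0 -> (U * T^`())`_((size U).-1 + (size T).-1).-1 =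
      lead_coef U * lead_coef T * (size T).-1%:R.
    move=> U0 T0; have sU : (0 < size U)%N by rewrite size_poly_gt0.
    have sT : (0 < size T)%N by rewrite size_poly_gt0.
    have [e1|gt1] := eqVneq (size T) 1%N.
      have -> : T^`() = 0 by apply/polyP => i; rewrite coef_deriv coef0 nth_default ?mul0rn // e1.
      by rewrite mulr0 coef0 e1 mulr0.
    have lt1 : (1 < size T)%N by rewrite ltn_neqAle eq_sym gt1.
    have aux1 a b : (1 < b -> a.-1 < (a.-1 + b.-1).-1.+1)%N by lia.
    rewrite coefM (bigD1 (inord (size U).-1)) //= inordK; last exact: aux1.
    rewrite big1 => [|j nj].
      rewrite addr0 coef_deriv -(mulr_natr T`__) mulrA.
      have aux a b : (0 < b)%N -> ((a + b).-1 - a).+1 = b by lia.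
      by rewrite aux // -ltnS prednK.
    have [lt|gt] := ltnP j (size U).-1.
      rewrite coef_deriv [T`_ _]nth_default ?mul0rn ?mulr0 //.
      have aux a b i : (i < a.-1 -> 1 < b -> b <= ((a.-1 + b.-1).-1 - i).+1)%N by lia.
      exact: aux.
    rewrite nth_default ?mul0r //.
    have : (j : nat) <> (size U).-1.
      move=> ej; case/eqP: nj; apply/val_inj; rewrite /= inordK //; exact: aux1.
    have aux a i : (a.-1 <= i -> 0 < a -> i <> a.-1 -> a <= i)%N by lia.
    exact: aux.
  rewrite top // [P^`() * Z]mulrC addnC top // [lead_coef Z * _]mulrC => /eqP.
  rewrite -subr_eq0 -mulrBr !mulf_eq0 !lead_coef_eq0 (negPf P0) (negPf Z0) /=.
  have aux a b : (0 < a -> 0 < b -> a.-1 = b.-1 -> a = b)%N by lia.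
  by rewrite subr_eq0 eqr_nat => /eqP; apply: aux.
move=> e; have [->|Q0] := eqVneq Q 0; first by exists 0; rewrite scale0r.
exists (lead_coef Q / lead_coef P); apply/eqP; rewrite -subr_eq0; apply/eqP.
set c := _ / _; set Z := Q - _.
have eZ : P * Z^`() = P^`() * Z.
  by rewrite derivB derivZ mulrBr e mulrBr -!mul_polyC; ring.
have [//|Z0] := eqVneq Z 0.
have sZ := same Z Z0 eZ; have sQ := same Q Q0 e.
have : lead_coef Z = 0.
  rewrite lead_coefE sZ coefB coefZ -lead_coefE -sQ -lead_coefE divfK ?subrr //.
  by rewrite lead_coef_eq0.
by move/eqP; rewrite lead_coef_eq0 (negPf Z0).
Qed.

Section Wronskian.
Variables (f : {poly rat}) (p : nat).
Hypothesis p0 : (0 < p)%N.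

(* On [G f^(j/p)] the derivation [p f d/dY] acts as [delta j] on the factor [G]. *)
Definition delta (j : bool) (G : {poly rat}) : {poly rat} :=
  p%:R *: (f * G^`()) + (if j then f^`() * G else 0).

Lemma deltaE j G : delta j G = p%:R%:P * (f * G^`()) + (if j then f^`() * G else 0).
Proof. by rewrite /delta mul_polyC. Qed.

(** The functions [G k * f^(j k / p)] are linearly independent over the constants, since [f^(1/p)]
    is no rational function up to a constant. The classical argument is carried out with polynomials
    only, [delta] acting as the derivation. *)
Lemma wronskian_neq0 t (G : 'I_t -> {poly rat}) (j : 'I_t -> bool) :
  (forall z g, f <> z *: g ^+ p) ->
  (forall c : 'I_t -> rat, (forall b, \sum_(k | j k == b) c k *: G k = 0) ->
     forall k, c k = 0) ->
  \det (\matrix_(k < t, v < t) iter v (delta (j k)) (G k)) != 0.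
Proof.
move=> npow indep.
have f0 : f != 0 by apply/eqP => e; apply: (npow 0 0); rewrite e scale0r.
have pn0 : (p%:R : rat) != 0 by rewrite pnatr_eq0; lia.
have pC0 : (p%:R : rat)%:P != 0 by rewrite polyC_eq0.
(* The equation says that [b ^+ p / (f * a ^+ p)] has derivative zero; then [a] divides [b], and [f]
   is a constant times a [p]-th power. *)
have pow a b : a != 0 -> b != 0 ->
    p%:R%:P * f * (a * b^`() - b * a^`()) = f^`() * a * b -> False.
  move=> a0 b0 e; have e1 : (f * a ^+ p) * (b ^+ p)^`() = (f * a ^+ p)^`() * b ^+ p.
    have dX (u : {poly rat}) : (u ^+ p)^`() = p%:R%:P * (u^`() * u ^+ p.-1).
      by rewrite deriv_exp mul_polyC scaler_nat.
    rewrite derivM !dX.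
    have -> : a ^+ p = a * a ^+ p.-1 by rewrite -exprS prednK.
    have -> : b ^+ p = b * b ^+ p.-1 by rewrite -exprS prednK.
    have := congr1 (fun U => U * (a ^+ p.-1 * b ^+ p.-1)) e.
    set x := a ^+ _; set z := b ^+ _ => e2; apply/eqP; rewrite -subr_eq0; apply/eqP.
    move/eqP: e2; rewrite -subr_eq0 => /eqP e2; rewrite -[RHS]e2; ring.
  have [|c ec] := deriv_cross_prop _ e1; first by rewrite mulf_neq0 // expf_neq0.
  have c0 : c != 0.
    by apply/eqP => c0; move/eqP: ec; rewrite c0 scale0r expf_eq0 (negPf b0) andbF.
  have : a ^+ p %| b ^+ p by rewrite ec dvdpZr // dvdp_mull.
  rewrite dvdp_pexp2r // => /dvdpP[g eb].
  apply: (npow c^-1 g); apply: (mulIf (_ : a ^+ p != 0)); first by rewrite expf_neq0.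
  by rewrite -scalerAl -exprMn -eb ec scalerA mulVf // scale1r.
(* Induction on the support of [c]: differentiating the relations and eliminating the index [k]
   gives relations with smaller support, valid for one [v] less. *)
have claim N : forall c : 'I_t -> {poly rat}, (#|[pred k | c k != 0%R]| <= N)%N ->
    (forall v, (v < N)%N -> \sum_k c k * iter v (delta (j k)) (G k) = 0) ->
    forall k, c k = 0.
  elim: N => [|N IH] c supp rel k.
    move: supp; rewrite leqn0 => /eqP/card0_eq/(_ k).
    by rewrite inE => /negbFE/eqP.
  apply/eqP/negPn/negP => ck.
  (* [F i] is made for the product rule [F i c * w + c * delta (j i) w = D (c * w)]. *)
  pose D a := p%:R%:P * f * a^`(); pose F i a := D a - (if j i then f^`() * a else 0).
  pose c' i := c k * F i (c i) - c i * F k (c k).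
  have c'0 : forall i, c' i = 0.
    apply: IH => [|v ltv].
      rewrite -ltnS; apply: leq_trans supp; apply: proper_card.
      apply/properP; split; last by exists k; rewrite !inE // /c' mulrC subrr eqxx.
      apply/fintype.subsetP => i; rewrite !inE; apply: contra => /eqP ci.
      by rewrite /c' /F /D ci deriv0 !mulr0 mul0r; case: ifP; rewrite ?mulr0 !subr0 mulr0.
    have r1 := rel v (ltnW ltv); have r2 := rel v.+1 ltv.
    have r3 : \sum_i F i (c i) * iter v (delta (j i)) (G i) = 0.
      have e : \sum_i F i (c i) * iter v (delta (j i)) (G i) +
          \sum_i c i * iter v.+1 (delta (j i)) (G i) =
          D (\sum_i c i * iter v (delta (j i)) (G i)).
        rewrite /D raddf_sum mulr_sumr -big_split; apply: eq_bigr => i _ /=.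
        by rewrite /F /D derivM deltaE; case: (j i); ring.
      by move: e; rewrite r1 r2 addr0 /D deriv0 mulr0.
    transitivity (c k * (\sum_i F i (c i) * iter v (delta (j i)) (G i)) -
       F k (c k) * (\sum_i c i * iter v (delta (j i)) (G i))); last first.
      by rewrite r1 r3 !mulr0 subrr.
    rewrite !mulr_sumr -sumrB; apply: eq_bigr => i _; rewrite /c'; ring.
  have prop i : exists2 a : rat, c i = a *: c k & (j i != j k -> a = 0).
    have [ci|ci] := eqVneq (c i) 0; first by exists 0; rewrite ?scale0r.
    have := c'0 i; rewrite /c' /F; case: (eqVneq (j i) (j k)) => [->|nj] e.
      have [|a ea] := @deriv_cross_prop (c k) (c i) ck; last by exists a.
      apply: (mulfI (_ : p%:R%:P * f != 0)); first by rewrite mulf_neq0.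
      apply/eqP; rewrite -subr_eq0; apply/eqP; rewrite -[RHS]e /D.
      case: (j k); ring.
    exfalso; case: (j i) (j k) nj e => [] [] //= _ e.
      apply: (pow (c k) (c i)) => //; apply/eqP; rewrite -subr_eq0; apply/eqP.
      by rewrite -[RHS]e /D; ring.
    apply: (pow (c i) (c k)) => //; apply/eqP; rewrite -subr_eq0; apply/eqP.
    by rewrite -[RHS]oppr0 -[in RHS]e /D; ring.
  have [a ea a0] := fin_all_exists2 prop.
  have rel0 := rel 0%N isT.
  have : forall i, a i = 0.
    apply: indep => b; case: (eqVneq b (j k)) => [->|nb]; last first.
      by rewrite big1 // => i /eqP ei; rewrite a0 ?scale0r // ei.
    apply: (mulfI ck); rewrite mulr0 -[RHS]rel0 mulr_sumr.
    rewrite [RHS](bigID (fun i => j i == j k)) /= [X in _ + X]big1 ?addr0.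
      by apply: eq_bigr => i _; rewrite (ea i) -!mul_polyC; ring.
    by move=> i ni; rewrite (ea i) a0 // scale0r mul0r.
  by move/(_ k) => ak; move: ck; rewrite (ea k) ak scale0r eqxx.
apply/det0P => -[v v0 vM]; case/eqP: v0; apply/rowP => k; rewrite mxE.
apply: (claim t (fun k => v 0 k)); first by rewrite (leq_trans (max_card _)) ?card_ord.
move=> i lti; have := congr1 (fun A : 'rV[{poly rat}]_t => A 0 (Ordinal lti)) vM.
by rewrite !mxE /= => e; rewrite -[RHS]e; apply: eq_bigr => k' _; rewrite mxE.
Qed.

End Wronskian.

Section WronskianOrder.
Variables (f : {poly rat}) (p : nat) (y w : rat) (u : {poly rat}) (t : nat).
Variables (G : 'I_t -> {poly rat}) (j : 'I_t -> bool) (lam : 'I_t -> rat).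
Let sh P := P \Po ('X + y%:P).
Let D := delta f p.
Let W := \det (\matrix_(k < t, v < t) iter v (D (j k)) (G k)).

Let shD P Q : sh (P + Q) = sh P + sh Q. Proof. exact: comp_polyD. Qed.
Let shM P Q : sh (P * Q) = sh P * sh Q. Proof. exact: comp_polyM. Qed.
Let sh_deriv P : (sh P)^`() = sh P^`().
Proof. by rewrite deriv_comp derivD derivX derivC addr0 mulr1. Qed.

(** Each application of the derivation to the sum costs one order of vanishing; the defect of [u] in
    its differential equation has order [M] and does no harm. The results form the row of the
    [lam k *: uk k] times the shifted Wronskian matrix. The adjugate turns this into [sh W] times an
    entry with nonzero constant coefficient. *)
Lemma wronskian_vanish V M :
  u`_0 != 0 -> w != 0 -> (exists k, lam k != 0) -> (V <= M)%N ->
  vanish M (p%:R *: (sh f * u^`()) - sh f^`() * u) ->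
  vanish V (\sum_k lam k *: (sh (G k) * (if j k then u else w%:P))) ->
  vanish (V - t) (sh W).
Proof.
move=> u0 w0 [k0 lk0] leVM ode vS.
pose uk k : {poly rat} := if j k then u else w%:P.
pose T v := \sum_k lam k *: (sh (iter v (D (j k)) (G k)) * uk k).
have vT v : vanish (V - v) (T v).
  elim: v => [|v IH]; first by rewrite subn0.
  set R := p%:R *: _ - _ in ode.
  have -> : T v.+1 = p%:R *: (sh f * (T v)^`()) -
      \sum_(k | j k) (lam k *: sh (iter v (D (j k)) (G k))) * R.
    rewrite raddf_sum mulr_sumr scaler_sumr (bigID j) /= [T v.+1](bigID j) /=.
    rewrite [X in _ = X - _]addrC -addrA [RHS]addrC; congr (_ + _).
      rewrite -sumrB; apply: eq_bigr => k jk; rewrite /D deltaE /uk jk shD !shM /R.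
      rewrite -[sh p%:R%:P]/(p%:R%:P \Po _) comp_polyC derivZ derivM sh_deriv -!mul_polyC.
      ring.
    apply: eq_bigr => k jk; rewrite /D deltaE /uk (negPf jk) addr0 !shM.
    rewrite -[sh p%:R%:P]/(p%:R%:P \Po _) comp_polyC derivZ derivM sh_deriv derivC -!mul_polyC.
    ring.
  apply: vanishD.
    apply/vanishZ/vanishMl; rewrite subnS; exact: vanish_deriv.
  apply/vanishN/vanish_sum => k _; apply/vanishMl; apply: vanish_le ode; lia.
pose A := \matrix_(k < t, v < t) sh (iter v (D (j k)) (G k)).
have detA : \det A = sh W.
  rewrite /W -[sh _]/(comp_poly _ _) -det_map_mx; congr (\det _).
  by apply/matrixP => k v; rewrite !mxE.
pose x : 'rV_t := \row_k (lam k *: uk k).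
have xA : x *m A = \row_v T v.
  apply/rowP => v; rewrite !mxE; apply: eq_bigr => k _.
  by rewrite !mxE -scalerAl mulrC.
have e : (\row_v T v) *m \adj A = (sh W) *: x.
  by rewrite -xA -mulmxA mul_mx_adj detA mul_mx_scalar.
apply: (@vanish_unit _ _ (lam k0 *: uk k0)).
  rewrite coefZ mulf_neq0 // /uk; case: (j k0) => //; rewrite coefC //.
have := congr1 (fun B : 'rV_t => B 0 k0) e; rewrite !mxE => <-.
apply: vanish_sum => v _; rewrite !mxE; apply: vanishM; apply: vanish_le (vT v).
by have := ltn_ord v; lia.
Qed.

End WronskianOrder.

(** * Height of the Wronskian against its order of vanishing *)

Lemma nrm_prod r (I : Type) (s : seq I) (F : I -> {poly rat}) : 0 <= r ->
  nrm r (\prod_(i <- s) F i) <= \prod_(i <- s) nrm r (F i).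
Proof.
move=> r0; elim: s => [|i s IH]; first by rewrite !big_nil -polyC1 nrmC normr1.
rewrite !big_cons; apply: le_trans (nrmM _ _ r0) _.
by rewrite ler_wpM2l ?nrm_ge0.
Qed.

Lemma nrm_det n (A : 'M[{poly rat}]_n) H : (forall i k, nrm 1 (A i k) <= H) ->
  nrm 1 (\det A) <= (n`!)%:R * H ^+ n.
Proof.
move=> hA; apply: le_trans (nrm_sum _ _ _ ler01) _.
have -> : (n`!)%:R * H ^+ n = \sum_(s : 'S_n) H ^+ n.
  by rewrite sumr_const card_Sn mulr_natl.
apply: ler_sum => s _; apply: le_trans (nrmM _ _ ler01) _.
have -> : nrm 1 ((-1) ^+ s : {poly rat}) = 1.
  by case: (odd_perm s); rewrite ?expr1 ?expr0 ?nrmN -polyC1 nrmC normr1.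
rewrite mul1r; apply: le_trans (nrm_prod _ _ ler01) _.
have -> : H ^+ n = \prod_(i < n) H by rewrite prodr_const card_ord.
by apply: ler_prod => i _; rewrite nrm_ge0 ?hA.
Qed.

Lemma size_deriv_leq d P : (size P <= d.+1)%N -> (size P^`() <= d)%N.
Proof.
have [->|nz] := eqVneq P 0; first by rewrite deriv0 size_poly0.
move=> h; have := lt_size_deriv nz; lia.
Qed.

Lemma nrm_deriv d P : (size P <= d.+1)%N -> nrm 1 P^`() <= d%:R * nrm 1 P.
Proof.
move=> h; rewrite (nrm_wide _ (size_deriv_leq h)) (nrm_wide _ h) big_ord_recl mulrDr.
rewrite mulr_sumr -[leLHS]add0r lerD ?mulr_ge0 //; apply: ler_sum => i _.
rewrite coef_deriv normrMn !expr1n !mulr1 -(mulr_natl `|P`_i.+1|).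
by apply: ler_wpM2r => //; rewrite ler_nat.
Qed.

Lemma nrm_delta (f : {poly rat}) p a d (j : bool) P : (size f <= a.+1)%N -> (size P <= d.+1)%N ->
  (size (delta f p j P) <= (d + a).+1)%N /\
  nrm 1 (delta f p j P) <= (p * d + a)%:R * nrm 1 f * nrm 1 P.
Proof.
move=> sf sP; have sf' := size_deriv_leq sf; have sP' := size_deriv_leq sP; split.
  apply: leq_trans (size_polyD _ _) _; rewrite geq_max; apply/andP; split.
    apply: leq_trans (size_scale_leq _ _) _; apply: leq_trans (size_polyMleq _ _) _.
    by move: sf sP'; case: (size f) => [|?]; lia.
  case: j; last by rewrite size_poly0.
  by apply: leq_trans (size_polyMleq _ _) _; lia.
apply: le_trans (nrmD _ _ ler01) _; rewrite natrD mulrDl mulrDl; apply: lerD.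
  rewrite nrmZ ger0_norm ?ler0n // natrM -!mulrA ler_wpM2l ?ler0n //.
  apply: le_trans (nrmM _ _ ler01) _; rewrite mulrCA ler_wpM2l ?nrm_ge0 //.
  exact: nrm_deriv.
case: j; last by rewrite nrm0 !mulr_ge0 ?nrm_ge0.
apply: le_trans (nrmM _ _ ler01) _; rewrite ler_wpM2r ?nrm_ge0 //.
exact: nrm_deriv.
Qed.

Lemma nrm_iter_delta (f : {poly rat}) p a d v t (j : bool) P : (size f <= a.+1)%N -> (size P <= d.+1)%N ->
  (v <= t)%N -> 1 <= (p * (d + t * a) + a)%:R * nrm 1 f ->
  (size (iter v (delta f p j) P) <= (d + v * a).+1)%N /\
  nrm 1 (iter v (delta f p j) P) <= ((p * (d + t * a) + a)%:R * nrm 1 f) ^+ v * nrm 1 P.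
Proof.
move=> sf sP + ge1; elim: v => [|v IH] lt; first by rewrite expr0 mul1r mul0n addn0.
have [s1 n1] := IH (ltnW lt); have [s2 n2] := nrm_delta p j sf s1.
split; first by rewrite iterS (leq_trans s2) // mulSn; lia.
rewrite iterS exprS -mulrA; apply: le_trans n2 _.
rewrite ler_pM ?mulr_ge0 ?nrm_ge0 // ler_wpM2r ?nrm_ge0 // ler_nat leq_add2r.
by rewrite leq_mul2l leq_add2l leq_mul2r (ltnW lt) !orbT.
Qed.

Lemma nrm_wronskian (f : {poly rat}) p a d t (G : 'I_t -> {poly rat}) (j : 'I_t -> bool) H :
  (size f <= a.+1)%N -> (forall k, size (G k) <= d.+1)%N ->
  (forall k, nrm 1 (G k) <= H) ->
  1 <= (p * (d + t * a) + a)%:R * nrm 1 f ->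
  nrm 1 (\det (\matrix_(k < t, v < t) iter v (delta f p (j k)) (G k)))
    <= (t`!)%:R * (((p * (d + t * a) + a)%:R * nrm 1 f) ^+ t * H) ^+ t.
Proof.
move=> sf sG nG ge1; apply: nrm_det => k v; rewrite mxE.
have [_ h] := nrm_iter_delta (j k) sf (sG k) (ltnW (ltn_ord v)) ge1.
apply: le_trans h _; rewrite ler_pM ?nrm_ge0 ?exprn_ge0 ?mulr_ge0 ?nrm_ge0 //.
by rewrite ler_weXn2l // ltnW.
Qed.

Lemma pint_delta f p (j : bool) P : pint f -> pint P -> pint (delta f p j P).
Proof.
move=> hf hP; apply: pintD.
  apply: pintZ; first by rewrite rpred_nat.
  by apply: pintM => //; apply: pint_deriv.
by case: j; [apply: pintM => //; apply: pint_deriv | exact: pint0].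
Qed.

Lemma pint_det n (A : 'M[{poly rat}]_n) : (forall i k, pint (A i k)) -> pint (\det A).
Proof.
move=> hA; apply: pint_sum => s _; apply: pintM.
  by apply: pintX; apply: pintN; exact: pint1.
by elim/big_ind: _ => //; [exact: pint1 | exact: pintM].
Qed.

(* [1 - N X] is invertible in Z[[X]], so dividing by it keeps integrality. *)
Lemma pint_div (N : nat) P Q : pint P -> P = (1 - N%:R *: 'X) * Q -> pint Q.
Proof.
move=> hP e i; elim: i => [|i IH].
  have := hP 0%N; rewrite e mulrBl mul1r -scalerAl coefB coefZ coefXM mulr0.
  by rewrite subr0.
have := hP i.+1; rewrite e mulrBl mul1r -scalerAl coefB coefZ coefXM /= => h.
rewrite -[Q`_i.+1](subrK (N%:R * Q`_i)) rpredD //.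
by rewrite rpredM // rpred_nat.
Qed.

(** A zero of order [V] at [1 / N] splits off the factor [(1 - N X)^V] with an integral cofactor
    ([pint_div]), so [N^V] divides the leading coefficient. *)
Lemma vanish_height (N V : nat) P : (0 < N)%N -> pint P -> P != 0 ->
  vanish V (P \Po ('X + N%:R^-1%:P)) -> N%:R ^+ V <= nrm 1 P.
Proof.
move=> N0 hP P0 vP; have Nn0 : (N%:R : rat) != 0 by rewrite pnatr_eq0; lia.
have [Q eQ] : exists Q, P = (1 - N%:R *: 'X) ^+ V * Q.
  have [Q' eQ'] : exists Q', P \Po ('X + N%:R^-1%:P) = 'X^V * Q'.
    set P1 := _ \Po _ in vP *; exists (\poly_(i < size P1) P1`_(i + V)); apply/polyP => i.
    rewrite coefXnM; case: ltnP => [/vP //|le].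
    rewrite coef_poly subnK //; case: ltnP => // h; rewrite nth_default //.
    by apply: leq_trans h _; lia.
  exists ((- N%:R^-1) ^+ V *: (Q' \Po ('X - N%:R^-1%:P))).
  rewrite -scalerAr scalerAl -exprZn.
  have -> : - N%:R^-1 *: (1 - N%:R *: 'X) = 'X - (N%:R^-1%:P : {poly rat}).
    rewrite scalerBr scalerA mulNr mulVf // scaleN1r opprK addrC.
    by congr (_ + _); rewrite scaleNr -mul_polyC mulr1.
  have := congr1 (fun R => R \Po ('X - N%:R^-1%:P)) eQ'.
  rewrite -comp_polyA comp_polyD comp_polyX comp_polyC subrK comp_polyXr => ->.
  by rewrite comp_polyM comp_Xn_poly.
have hQ : pint Q.
  elim: V P hP {P0 vP} eQ => [|V IH] P hP; first by rewrite expr0 mul1r => <-.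
  rewrite exprS -mulrA => e; exact: IH (pint_div hP e) erefl.
have Q0 : Q != 0 by apply: contraNneq P0 => Q0; rewrite eQ Q0 mulr0.
have lead : lead_coef (1 - N%:R *: 'X : {poly rat}) = - N%:R.
  rewrite lead_coefDr ?lead_coefN ?lead_coefZ ?lead_coefX ?mulr1 //.
  by rewrite size_polyN size_scale // size_polyX size_poly1.
have : `|lead_coef P| <= nrm 1 P.
  by have := nrm_coef P (size P).-1 ler01; rewrite expr1n mulr1.
apply: le_trans; rewrite eQ lead_coefM lead_coef_exp lead normrM normrX normrN normr_nat.
rewrite ler_peMr ?exprn_ge0 ?ler0n //; apply: norm_intr_ge1; last by rewrite lead_coef_eq0.
by rewrite lead_coefE.
Qed.

(** The auxiliary polynomials may be dependent, while [wronskian_neq0] needs independence within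
    each class of [j]. Dependent members are dropped one at a time, their weights being moved to the
    others without changing the two partial sums. *)
Lemma independent_subfamily (T : finType) (G : T -> {poly rat}) (j : T -> bool)
    (lam : T -> rat) :
  exists (t : nat) (g : 'I_t -> T) (mu : 'I_t -> rat),
  [/\ (t <= #|T|)%N,
      forall c : 'I_t -> rat,
        (forall b, \sum_(k | j (g k) == b) c k *: G (g k) = 0) -> forall k, c k = 0 &
      forall b, \sum_(k | j k == b) lam k *: G k
              = \sum_(k | j (g k) == b) mu k *: G (g k)].
Proof.
pose rep (I : {set T}) mu := (forall k, k \notin I -> mu k = 0) /\
   forall b, \sum_(k | j k == b) lam k *: G k = \sum_(k | j k == b) mu k *: G k.
have claim N (I : {set T}) mu : (#|I| <= N)%N -> rep I mu -> exists (I' : {set T}) mu', rep I' mu' /\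
   forall c : T -> rat, (forall k, k \notin I' -> c k = 0) ->
    (forall b, \sum_(k | j k == b) c k *: G k = 0) -> forall k, c k = 0.
  elim: N I mu => [|N IH] I mu leI repI.
    exists I, mu; split=> // c supp _ k; apply: supp.
    by move: leI; rewrite leqn0 cards_eq0 => /eqP->; rewrite inE.
  pose bad (c : T -> rat) k0 := [/\ forall k, k \notin I -> c k = 0,
    (forall b, \sum_(k | j k == b) c k *: G k = 0) & c k0 != 0].
  have [[c [k0 [supp rel ck0]]]|nobad] := boolp.pselect (exists (c : T -> rat) k0, bad c k0); last first.
    exists I, mu; split=> // c supp rel k; apply/eqP/negPn/negP => ck.
    by apply: nobad; exists c, k.
  have k0I : k0 \in I by apply: contraNT ck0 => /supp->.
  apply: (IH (I :\ k0) (fun k => mu k - mu k0 / c k0 * c k)).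
    by rewrite (cardsD1 k0) k0I in leI.
  have [supp_mu e] := repI; split=> [k|b].
    rewrite !inE negb_and negbK => /orP[/eqP->|nk]; first by rewrite divfK ?subrr.
    by rewrite (supp_mu k nk) (supp k nk) mulr0 subrr.
  rewrite e; apply/eqP; rewrite -subr_eq0 -sumrB.
  rewrite (eq_bigr (fun k => (mu k0 / c k0) *: (c k *: G k))) => [|k _].
    by rewrite -scaler_sumr rel scaler0.
  by rewrite -scalerBl scalerA opprB addrC subrK.
have [I [mu [[supp e] indep]]] := claim #|[set: T]| [set: T] lam (leqnn _)
  (conj (fun k (h : k \notin [set: T]) => False_ind _ (negP h (in_setT k))) (fun b => erefl)).
exists #|I|, (fun k => enum_val k), (fun k => mu (enum_val k)); split.
- exact: max_card.
- move=> c rel k.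
  pose c' x := \sum_(i | enum_val i == x) c i.
  have ec i : c' (enum_val i) = c i.
    by rewrite /c' (big_pred1 i) // => i'; rewrite /= (inj_eq enum_val_inj).
  rewrite -ec; apply: indep => [x nx|b].
    rewrite /c' big1 // => i /eqP ei; case/negP: nx; rewrite -ei; exact: enum_valP.
  rewrite (bigID (mem I)) /= [X in _ + X]big1 ?addr0; last first.
    move=> x /andP[_ nx]; rewrite /c' big1 ?scale0r // => i /eqP ei.
    by case/negP: nx; rewrite -ei; exact: enum_valP.
  rewrite -[RHS](rel b) (eq_bigl (fun x => (x \in I) && (j x == b))) => [|x]; last exact: andbC.
  rewrite (big_enum_val_cond (fun x => j x == b) (fun x => c' x *: G x)).
  by apply: eq_bigr => i _; rewrite ec.
move=> b; rewrite e (bigID (mem I)) /= [X in _ + X]big1 ?addr0; last first.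
  by move=> x /andP[_ nx]; rewrite supp ?scale0r.
rewrite (eq_bigl (fun x => (x \in I) && (j x == b))) => [|x]; last exact: andbC.
exact: (big_enum_val_cond (fun x => j x == b) (fun x => mu x *: G x)).
Qed.

(** * Siegel's lemma and choice of scales *)

(** Box principle. The exponent 4 belongs to the ratio 4/5 of equations to unknowns: with [U = #|P|]
    and [B = (U X)^4] one has [(U X B + 1)^4 <= B (B + 1)^4 < (B + 1)^5]. *)
Lemma siegel (I J : finType) (P : pred I) (Q : pred J) (a : J -> I -> int) (X : nat) :
  (0 < #|P|)%N -> (0 < X)%N -> (5 * #|Q| <= 4 * #|P|)%N -> (forall j i, `|a j i|%N <= X)%N ->
  exists x : I -> int, [/\ exists i, x i != 0, forall i, ~~ P i -> x i = 0,
    forall i, (`|x i| <= (#|P| * X) ^ 4)%N &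
    forall j, Q j -> \sum_(i | P i) a j i * x i = 0].
Proof.
move=> P0 X0 QP aX; set B := (_ ^ 4)%N; set U := #|P|.
pose TI := {i | P i}; pose TJ := {j | Q j}.
(* A negative entry counts [B - b] instead of [b]. This shifts every value by a constant and keeps
   all of them natural numbers at most [U * X * B]. *)
pose term j i (b : nat) := (if (0 <= a j i)%R then `|a j i| * b else `|a j i| * (B - b))%N.
have term_le j i (b : 'I_B.+1) : (term j i b <= X * B)%N.
  by rewrite /term; case: ifP => _; apply: leq_mul => //; [rewrite -ltnS | apply: leq_subr].
pose val (g : {ffun TI -> 'I_B.+1}) (j : J) := (\sum_(i : TI) term j (sval i) (g i))%N.
have val_lt g j : (val g j < (U * X * B).+1)%N.
  rewrite ltnS; apply: leq_trans (_ : \sum_(i : TI) X * B <= _)%N.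
    by apply: leq_sum => i _; apply: term_le.
  by rewrite sum_nat_const card_sig mulnA.
pose F g : {ffun TJ -> 'I_(U * X * B).+1} := [ffun j : TJ => Ordinal (val_lt g (sval j))].
have /injectivePn[g1 [g2 ne12 eqF]] : ~~ injectiveb F.
  apply/negP => /injectiveP/leq_card; rewrite !card_ffun !card_sig !card_ord.
  apply/negP; rewrite -ltnNge -(ltn_exp2r _ _ (isT : (0 < 5)%N)) -!expnM.
  have UX0 : (0 < U * X)%N by rewrite muln_gt0 P0.
  apply: (@leq_ltn_trans ((U * X * B).+1 ^ (4 * U)))%N.
    have B0 : (0 < U * X * B)%N by rewrite muln_gt0 UX0 expn_gt0 UX0.
    by rewrite leq_exp2l ?ltnS // mulnC.
  rewrite [(_ * 5)%N]mulnC !expnM ltn_exp2r //.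
  apply: (@leq_ltn_trans (((U * X) * B.+1) ^ 4))%N.
    by rewrite leq_exp2r // mulnS; lia.
  by rewrite expnMn -/B [(B.+1 ^ 5)%N]expnS ltn_mul2r expn_gt0 ltnS leqnn.
pose x i : int := if insub i is Some ti then (g1 ti : nat)%:Z - (g2 ti : nat)%:Z else 0.
have xE (ti : TI) : x (sval ti) = (g1 ti : nat)%:Z - (g2 ti : nat)%:Z by rewrite /x valK.
exists x; split.
- have [i ni] : exists i, g1 i != g2 i.
    apply/existsP; rewrite -negb_forall; apply: contra ne12 => /forallP h.
    by apply/eqP/ffunP => i; apply/eqP.
  by exists (sval i); rewrite xE subr_eq0 eqz_nat.
- by move=> i nPi; rewrite /x insubN.
- move=> i; rewrite /x; case: insubP => [ti _ _|//].
  by have := ltn_ord (g1 ti); have := ltn_ord (g2 ti); lia.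
move=> j Qj; have := congr1 (fun G : {ffun TJ -> 'I_(U * X * B).+1} => (G (Sub j Qj) : nat)%:Z) eqF.
rewrite !ffunE /= /val !(big_morph Posz PoszD (erefl _)) => /eqP.
rewrite -subr_eq0 -sumrB => /eqP e.
rewrite -[RHS]e (eq_bigl (fun i => (i \in P) && true)) => [|i]; last by rewrite andbT.
rewrite (reindex_omap sval (insub : I -> option TI)) => [|i Pi]; last first.
  by rewrite andbT in Pi; rewrite insubT.
apply: eq_big => [ti|ti _].
  by rewrite valK eqxx (valP ti : sval ti \in P).
rewrite xE /term; case: ifP => h.
  by rewrite !PoszM mulrBr gez0_abs.
have := ltn_ord (g1 ti); have := ltn_ord (g2 ti); rewrite !ltnS => h1 h2.
rewrite !PoszM -!subzn // ltz0_abs; last by rewrite ltNge h.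
ring.
Qed.

Lemma dirichlet_arith (a1 a2 b1 b2 z t1 t2 m : nat) : (a1 <= a2)%N -> b1 = (z + t1)%N ->
  b2 = (z + t2)%N -> (t1 < m)%N -> (t2 < m)%N -> (a1 + b1 <= a2 + b2)%N ->
  (a2 + b2 - (a1 + b1) <= a2 - a1 + m)%N /\ (a2 - a1 <= a2 + b2 - (a1 + b1) + m)%N.
Proof. by move=> /subnKC <-; rewrite addKn => -> -> *; split; lia. Qed.

(** Box principle for the fractional parts of the [j * s i / m], sorted into [H] intervals: two of
    the [H ^ n + 1] values of [j] agree for all [i], and [C] is their difference. *)
Lemma dirichlet n (s : 'I_n -> nat) (m H : nat) : (0 < H)%N -> (0 < m)%N ->
  exists C (c : 'I_n -> nat), (0 < C <= H ^ n)%N /\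
   forall i, (H * (C * s i) <= H * (c i * m) + m)%N /\ (H * (c i * m) <= H * (C * s i) + m)%N.
Proof.
move=> H0 m0.
have blt (j : 'I_(H ^ n).+1) i : (H * ((j * s i) %% m) %/ m < H)%N.
  by rewrite ltn_divLR // ltn_pmul2l // ltn_pmod.
pose F (j : 'I_(H ^ n).+1) := [ffun i => Ordinal (blt j i)].
have /injectivePn[j1 [j2 ne12 eqF]] : ~~ injectiveb F.
  by apply/negP => /injectiveP/leq_card; rewrite card_ffun !card_ord ltnn.
wlog lt12 : j1 j2 ne12 eqF / (j1 < j2)%N.
  move=> hw; case: (ltngtP j1 j2) => h; [exact: (hw j1 j2)| |].
    by apply: (hw j2 j1) => //; rewrite eq_sym.
  by case/eqP: ne12; apply: val_inj.
exists (j2 - j1)%N, (fun i => (j2 * s i) %/ m - (j1 * s i) %/ m)%N; split.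
  by have := ltn_ord j2; lia.
move=> i; have := congr1 (fun G : {ffun 'I_n -> 'I_H} => (G i : nat)) eqF; rewrite !ffunE /=.
have e1 := divn_eq (j1 * s i) m; have e2 := divn_eq (j2 * s i) m.
set a1 := ((_ * _) %/ m)%N in e1 *; set a2 := ((j2 * _) %/ m)%N in e2 *.
set r1 := ((_ * _) %% m)%N in e1 *; set r2 := ((j2 * _) %% m)%N in e2 * => eF.
have le_a : (a1 <= a2)%N by apply: leq_div2r; rewrite leq_mul2r (ltnW lt12) orbT.
have d1 := divn_eq (H * r1) m; have d2 := divn_eq (H * r2) m.
have l1 : (H * r1 %% m < m)%N by rewrite ltn_pmod.
have l2 : (H * r2 %% m < m)%N by rewrite ltn_pmod.
rewrite eF in d1; set q := (H * r2 %/ m)%N in d1 d2.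
have le12 : (j1 * s i <= j2 * s i)%N by rewrite leq_mul2r (ltnW lt12) orbT.
have le12' : (a1 * m <= a2 * m)%N by rewrite leq_mul2r le_a orbT.
rewrite !mulnBl !mulnBr e1 e2 !mulnDr.
set x1 := (H * (a1 * m))%N; set x2 := (H * (a2 * m))%N.
have lex : (x1 <= x2)%N by rewrite /x1 /x2 leq_mul2l le12' orbT.
have : (H * (j1 * s i) <= H * (j2 * s i))%N by rewrite leq_mul2l le12 orbT.
rewrite e1 e2 !mulnDr -/x1 -/x2.
exact: dirichlet_arith lex d1 d2 l1 l2.
Qed.

(* By Dirichlet's theorem each [2^-(s i)] is the [c i]-th power of the same [2^-e], up to a small power of [2]. *)
Lemma common_exponent_scale n (D Zc : nat) : (0 < D)%N -> (0 < Zc)%N ->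
  exists Cm : nat, forall S0 : nat, exists M : nat, forall (m : nat) (s : 'I_n -> nat),
    (M <= m)%N -> (forall i, s i <= m <= D * s i)%N ->
  exists C (c : 'I_n -> nat) (e kap : nat),
   [/\ (0 < C <= Cm)%N, forall i, (0 < c i <= C)%N,
      forall i, (s i <= c i * e <= s i + kap * c i)%N,
      (Zc * (C + 5) * kap <= e)%N & (S0 <= e)%N /\ (C * e <= 2 * m)%N].
Proof.
(* Below, [kap] is about [4 D m / (H C^2)] and [e] about [m / C]; the factor 48 is what
   [Zc (C + 5) kap <= e] takes, by [C + 5 <= 6 C] and with a factor 2 to spare. *)
move=> D0 Zc0; pose H := (48 * Zc * D)%N; exists (H ^ n)%N => S0.
pose Cm := (H ^ n)%N.
exists (100 * Zc * (Cm + 5) * (Cm + 5) + Cm * (S0 + 10) + 1)%N => m s Mm sm.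
have m0 : (0 < m)%N by lia.
have H0 : (0 < H)%N by rewrite !muln_gt0 Zc0 D0.
have [C [c [/andP[C0 CH] hc]]] := dirichlet s H0 m0.
have H2D : (2 * D <= H)%N by rewrite /H; nia.
have H2 : (2 <= H)%N by lia.
have cC i : (c i <= C)%N.
  have [_ h] := hc i; have /andP[h1 _] := sm i.
  have : (H * (c i * m) <= (H * C + 1) * m)%N by nia.
  by rewrite mulnA leq_pmul2r //; nia.
have c2D i : (C <= 2 * D * c i)%N.
  have [h _] := hc i; have /andP[_ h1] := sm i.
  have : (H * C * m <= (D * H * c i + D) * m)%N by nia.
  by rewrite leq_pmul2r // => h2; nia.
(* [s0] is the natural common exponent [m / C]. The excess [e1] makes [c i * e1] at least the
   approximation error [m / (H C)], so [c i * e] does not fall below [s i]; [kap = 2 * e1] bounds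
   the overshoot per unit of [c i]. *)
pose e1 := (2 + (2 * D * m) %/ (H * C * C))%N; pose s0 := (m %/ C)%N.
have HCC : (0 < H * C * C)%N by rewrite !muln_gt0 Zc0 D0 C0.
have e1P : (2 * D * m < (e1 - 1) * (H * C * C))%N.
  by have := ltn_ceil (2 * D * m) HCC; rewrite /e1 -addn1; set q := (_ %/ _)%N => ?; rewrite (_ : (2 + q - 1 = q + 1)%N) //; lia.
have e1P' : ((e1 - 2) * (H * C * C) <= 2 * D * m)%N.
  by have := leq_trunc_div (2 * D * m) (H * C * C); rewrite /e1 addKn.
have s0P : (C * s0 <= m < C * s0 + C)%N.
  have := divn_eq m C; have : (m %% C < C)%N by rewrite ltn_pmod.
  by rewrite -/s0; lia.
have e1ge : (2 <= e1)%N by rewrite leq_addr.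
exists C, c, (s0 + e1)%N, (2 * e1)%N; split=> //.
- by rewrite C0.
- by move=> i; rewrite cC andbT lt0n; apply: contraTneq C0 => ci; have := c2D i; rewrite ci muln0; lia.
- move=> i; have [h1 h2] := hc i; have h3 := c2D i; have /andP[s1 s2] := s0P.
  have key : (m <= H * C * (c i * (e1 - 1)))%N.
    have : (2 * D * m <= 2 * D * (H * C * (c i * (e1 - 1))))%N.
      apply: leq_trans (ltnW e1P) _.
      have := leq_mul (leqnn ((e1 - 1) * H * C)) h3; lia.
    by rewrite leq_pmul2l // muln_gt0 D0.
  have HC0 : (0 < H * C)%N by rewrite !muln_gt0 Zc0 D0 C0.
  have ee : (e1 = (e1 - 1).+1)%N by lia.
  set E := (e1 - 1)%N in key ee; rewrite ee; apply/andP; split.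
    rewrite -(leq_pmul2l HC0).
    have : (H * (c i * m) <= H * (c i * (C * s0 + C)))%N by rewrite !leq_mul // ltnW.
    lia.
  rewrite -(leq_pmul2l HC0).
  have : (H * (c i * (C * s0)) <= H * (c i * m))%N by rewrite !leq_mul.
  lia.
- have /andP[s1 s2] := s0P.
  have E2 : ((e1 - 2) * (24 * Zc * C * C) <= m)%N.
    have : (2 * D * ((e1 - 2) * (24 * Zc * C * C)) <= 2 * D * m)%N.
      by apply: leq_trans e1P'; rewrite /H; lia.
    by rewrite leq_pmul2l // muln_gt0 D0.
  set E := (e1 - 2)%N in E2; have -> : e1 = (E + 2)%N by rewrite subnK.
  rewrite -(leq_pmul2l C0).
  have b1 : (Zc * (C + 5) * (2 * E) * C <= 12 * Zc * C * C * E)%N.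
    have : (C + 5 <= 6 * C)%N by lia.
    move=> h; have := leq_mul h (leqnn (Zc * 2 * E * C)); lia.
  have b2 : (C * (Zc * (C + 5) * 4) <= 4 * Zc * (Cm + 5) * (Cm + 5))%N.
    have : (C * (C + 5) <= (Cm + 5) * (Cm + 5))%N by apply: leq_mul; lia.
    by move=> h; have := leq_mul (leqnn (4 * Zc)) h; lia.
  have b3 : (C <= Cm)%N by [].
  have b4 : (100 * Zc * (Cm + 5) * (Cm + 5) = 25 * (4 * Zc * (Cm + 5) * (Cm + 5)))%N by lia.
  have b5 : (C <= 4 * Zc * (Cm + 5) * (Cm + 5))%N.
    apply: leq_trans b3 _; apply: leq_trans (leq_addr 5 Cm) _.
    by rewrite leq_pmull // !muln_gt0 Zc0 addn_gt0 orbT.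
  set Y := (4 * Zc * _ * _)%N in b2 b4 b5; rewrite b4 in Mm.
  set U1 := (Zc * (C + 5) * (2 * E) * C)%N in b1; set U2 := (12 * _ * _ * _ * _)%N in b1.
  have eU : (24 * Zc * C * C * E = 2 * U2)%N by rewrite /U2; lia.
  have -> : (C * (Zc * (C + 5) * (2 * (E + 2))) = U1 + C * (Zc * (C + 5) * 4))%N.
    by rewrite /U1; lia.
  rewrite mulnC in E2; rewrite eU in E2; set V := (C * (_ * 4))%N in b2 *.
  have -> : (C * (s0 + (E + 2)) = C * s0 + C * E + 2 * C)%N by lia.
  clear -b1 b2 b5 E2 Mm s1 s2; lia.
have /andP[s1 s2] := s0P; split.
  apply: leq_trans (leq_addr _ _); rewrite -(leq_pmul2l C0).
  have b1 : (C * S0 <= Cm * S0)%N by rewrite leq_mul2r CH orbT.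
  have b2 : (Cm * S0 + Cm * 10 = Cm * (S0 + 10))%N by rewrite mulnDr.
  have b3 : (C <= Cm)%N by [].
  clear -b1 b2 b3 Mm s2; lia.
- have E2 : ((e1 - 2) * (24 * Zc * C * C) <= m)%N.
    have : (2 * D * ((e1 - 2) * (24 * Zc * C * C)) <= 2 * D * m)%N.
      by apply: leq_trans e1P'; rewrite /H; lia.
    by rewrite leq_pmul2l // muln_gt0 D0.
  set E := (e1 - 2)%N in E2; have -> : e1 = (E + 2)%N by rewrite subnK.
  have b1 : (C * E * 2 <= E * (24 * Zc * C * C))%N.
    have : (2 <= 24 * Zc * C)%N.
      by rewrite -mulnA (@leq_trans 24) // leq_pmulr // muln_gt0 Zc0.
    move=> h; have := leq_mul (leqnn (E * C)) h; clear; lia.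
  have -> : (C * (s0 + (E + 2)) = C * s0 + C * E + 2 * C)%N by clear; lia.
  have b2 : (Cm * 10 <= Cm * (S0 + 10))%N by rewrite leq_mul2l leq_addl orbT.
  have b3 : (C <= Cm)%N by [].
  clear -b1 b2 b3 E2 Mm s1; lia.
Qed.

Lemma exp_gt_linear a b : exists v, (a * (v + b) < 2 ^ v)%N.
Proof.
have sq v : (7 <= v)%N -> (2 * v * v < 2 ^ v)%N.
  elim: v => // v IH; rewrite leq_eqVlt => /orP[/eqP<- //|]; rewrite ltnS => h.
  have := IH h; rewrite expnS; set z := (2 ^ v)%N => hz; clear -hz h; nia.
exists (a + b + 7)%N; apply: leq_ltn_trans (sq _ (leq_addl _ _)).
by rewrite [(a * _)%N]mulnC; apply: leq_mul; lia.
Qed.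

(** Chooses [K] such that growth by a factor 3/2 in each of [K] steps would exceed the polynomial
    bound in [slow_growth_scale]. *)
Lemma exp_gt_poly n D : exists K, (2 ^ K * (K.+1 * (K.+1 * D).+1 ^ n) < 3 ^ K)%N.
Proof.
have [v hv] := exp_gt_linear n.+1 (D + 3); pose J := (2 ^ v)%N.
have J0 : (0 < J)%N by rewrite expn_gt0.
have D2 : (D < 2 ^ D)%N by exact: ltn_expl.
have e : (2 ^ (v + (D + 3)) = J * (2 ^ D * 8))%N by rewrite !expnD.
have h1 : ((2 * J).+1 <= 2 ^ (v + (D + 3)))%N.
  by rewrite e; set z := (2 ^ D)%N in D2 *; clear -D2 J0; nia.
have h2 : (((2 * J).+1 * D).+1 <= 2 ^ (v + (D + 3)))%N.
  by rewrite e; set z := (2 ^ D)%N in D2 *; clear -D2 J0; nia.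
exists (2 * J)%N; rewrite !expnM; apply: (@leq_trans (8 ^ J)); last by rewrite leq_exp2r.
rewrite (_ : 8 = 2 ^ 2 * 2)%N // expnMn ltn_mul2l expn_gt0 /=.
apply: (@leq_ltn_trans ((2 ^ (v + (D + 3))) ^ n.+1)).
  rewrite expnS leq_mul //; case: (n) => [//|n']; by rewrite leq_exp2r.
by rewrite -expnM ltn_exp2l // mulnC.
Qed.

Section Reps.
Variables (n D K m : nat) (s : 'I_n -> nat) (N : nat -> nat).
Hypothesis m0 : (0 < m)%N.
Hypothesis sm : forall i, (m <= D * s i)%N.
Hypothesis N0 : (0 < N 0)%N.
Hypothesis N2 : forall k, (2 * N k <= N k.+1)%N.
Let A1 := (K.+1 * D)%N.
Let FT := {ffun 'I_n -> 'I_A1.+1}.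
Let val (a : FT) := (\sum_i a i * s i)%N.

Let Nmono k k' : (k <= k')%N -> (N k <= N k')%N.
Proof. by move/subnKC<-; elim: (k' - k)%N => [|x IH]; rewrite ?addn0 // addnS; have := N2 (k + x); lia. Qed.

Let good k := forall a b : FT, (N k * (val b - val a) <= m)%N -> (N k.+1 * (val b - val a) <= m)%N.

(** A pair is bad for at most one scale, because [N k * (val b - val a)] is nondecreasing in [k],
    and there is one more scale than there are pairs. *)
Lemma good_scale : exists2 k, (k <= (A1.+1 ^ n) ^ 2)%N & good k.
Proof.
pose Q := (A1.+1 ^ n ^ 2)%N.
pose bad (k : nat) (pr : FT * FT) := ((N k * (val pr.2 - val pr.1) <= m) && (m < N k.+1 * (val pr.2 - val pr.1)))%N.
have [[k hk]|nb] := boolp.pselect (exists k : 'I_((A1.+1 ^ n) ^ 2).+1, forall pr, ~~ bad k pr).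
  exists k; first by rewrite -ltnS.
  by move=> a b h; have := hk (a, b); rewrite /bad h /= -leqNgt.
have ex (k : 'I_((A1.+1 ^ n) ^ 2).+1) : exists pr, bad k pr.
  apply/existsP; case: (boolP [exists pr, bad k pr]) => // /existsPn h.
  by case: nb; exists k.
have [F hF] := fin_all_exists ex.
have /leq_card : injective F.
  move=> k1 k2 e; have := hF k1; have := hF k2; rewrite e /bad => /andP[h1 h2] /andP[h3 h4].
  apply: val_inj; case: (ltngtP k1 k2) => // lt /=; exfalso.
    have := leq_mul (Nmono lt) (leqnn (val (F k2).2 - val (F k2).1)); lia.
  have := leq_mul (Nmono lt) (leqnn (val (F k2).2 - val (F k2).1)); lia.
by rewrite card_ord card_prod card_ffun !card_ord -mulnn ltnn.
Qed.

(* At some scale [k] the sums [\sum_i a_i s_i] form clusters of width at most [m / N k.+1], more than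
   [m / N k] apart; [e] lists the least elements of the clusters. *)
Lemma separated_representatives : exists2 k, (k <= (A1.+1 ^ n) ^ 2)%N & exists l (e : 'I_l -> nat),
  [/\ (l <= A1.+1 ^ n)%N, exists i, e i = 0%N,
     forall i j, (e i < e j)%N -> (m < N k * (e j - e i))%N,
     forall i j, e i = e j -> i = j &
     forall i a, (e i < K.+1 * m)%N ->
       exists j, (e j <= e i + s a)%N /\ (N k.+1 * (e i + s a - e j) <= m)%N].
Proof.
have [k lek gk] := good_scale; exists k => //.
pose V := undup [seq val a | a <- enum FT].
have VP x : reflect (exists a, x = val a) (x \in V).
  rewrite mem_undup; apply: (iffP mapP) => [[a _ ->]|[a ->]]; first by exists a.
  by exists a; rewrite ?mem_enum.
pose isrep x := all (fun z => (z < x)%N ==> (m < N k.+1 * (x - z))%N) V.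
pose rs := [seq x <- V | isrep x].
have rsP x : x \in rs -> x \in V by rewrite mem_filter => /andP[].
(* The least element close to [x] is a representative: a smaller neighbour of it would lie within
   [m / N k] of [x], hence within [m / N k.+1] because the scale is good, against minimality. *)
have cls x : x \in V -> exists2 z, z \in rs & (z <= x)%N /\ (N k.+1 * (x - z) <= m)%N.
  move=> xV; pose P z := (z \in V) && ((z <= x)%N && (N k.+1 * (x - z) <= m)%N).
  have exP : exists z, P z by exists x; rewrite /P xV leqnn subnn muln0.
  case: (ex_minnP exP) => z /and3P[zV zx hz] minz; exists z => //.
  rewrite mem_filter zV andbT; apply/allP => z' z'V; apply/implyP => lt.
  rewrite ltnNge; apply/negP => hz'.
  have /VP[a ea] := z'V; have /VP[b eb] := xV.
  have : (N k.+1 * (x - z') <= m)%N.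
    rewrite ea eb; apply: gk; rewrite -ea -eb.
    have h := leq_mul (N2 k) (leqnn (x - z')).
    have e : (x - z' = (x - z) + (z - z'))%N by lia.
    by rewrite e mulnDr in h *; rewrite mulnDr in h; lia.
  by move=> h; have := minz z'; rewrite /P z'V h (ltnW (leq_trans lt zx)) => /(_ isT); lia.
have urs : uniq rs by rewrite filter_uniq // undup_uniq.
exists (size rs), (fun i => nth 0%N rs i); split.
- apply: leq_trans (_ : size V <= _)%N; first by rewrite size_filter count_size.
  by apply: leq_trans (size_undup _) _; rewrite size_map -cardE card_ffun !card_ord.
- have : 0%N \in rs.
    rewrite mem_filter; apply/andP; split; first by apply/allP => z _; rewrite ltn0.
    by apply/VP; exists [ffun _ => ord0]; rewrite /val big1 // => i _; rewrite ffunE mul0n.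
  by move=> h0; have hi := h0; rewrite -index_mem in hi; exists (Ordinal hi); rewrite /= nth_index.
- move=> i j lt; have := mem_nth 0%N (ltn_ord j); rewrite mem_filter => /andP[/allP hj /VP[b eb]].
  have iV := rsP _ (mem_nth 0%N (ltn_ord i)); have := hj _ iV; rewrite lt /= => h.
  rewrite ltnNge; apply/negP => h2; have /VP[a ea] := iV.
  by move: h; rewrite ea eb ltnNge gk // -ea -eb.
- by move=> i j /eqP; rewrite nth_uniq // => /eqP/val_inj.
move=> i a lt; have /VP[b eb] := rsP _ (mem_nth 0%N (ltn_ord i)).
(* Below [K.+1 * m] no coefficient reaches the cap [A1], as [m <= D * s x]; adding one more [s a]
   therefore stays inside the family. *)
have b_lt x : (b x < A1)%N.
  rewrite -(ltn_pmul2r m0); rewrite eb in lt.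
  have h1 : (b x * s x <= val b)%N by rewrite /val (bigD1 x) //= leq_addr.
  have h2 := leq_mul (leqnn (b x)) (sm x).
  have h3 : (D * (b x * s x) <= D * val b)%N by rewrite leq_mul2l h1 orbT.
  apply: leq_ltn_trans h2 _; rewrite mulnCA; apply: leq_ltn_trans h3 _.
  rewrite /A1 -mulnA [(K.+1 * _)%N]mulnCA ltn_pmul2l //.
  by move: (sm x) m0; case: (D) => //; lia.
have xV : (nth 0%N rs i + s a)%N \in V.
  have b1_lt x : (b x + (x == a) < A1.+1)%N by have := b_lt x; case: (x == a); lia.
  apply/VP; exists [ffun x => Ordinal (b1_lt x)]; rewrite eb /val.
  under [RHS]eq_bigr do rewrite ffunE /= mulnDl.
  rewrite big_split /=; congr (_ + _)%N; rewrite (bigD1 a) //= eqxx mul1n big1 ?addn0 //.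
  by move=> x /negPf->.
have [z zr [h1 h2]] := cls _ xV.
have hz := zr; rewrite -index_mem in hz; exists (Ordinal hz).
by rewrite /= nth_index.
Qed.

End Reps.

(* With [T = k m] and [T' = (k + 1) m] this lets the unknowns outnumber the equations in [auxiliary_pair]. *)
Lemma slow_growth_scale (l m K B : nat) (e : 'I_l -> nat) : (0 < m)%N -> (l <= B)%N -> (exists i, e i = 0%N) ->
  (2 ^ K * (K.+1 * B) < 3 ^ K)%N ->
  exists2 k, (0 < k <= K)%N &
    (2 * \sum_i (k.+1 * m - e i) <= 3 * \sum_i (k * m - e i))%N.
Proof.
move=> m0 lB [i0 ei0] hK; pose Psi k := (\sum_i (k * m - e i))%N.
have [[k hk]|nb] := boolp.pselect (exists k : 'I_K, (2 * Psi k.+2 <= 3 * Psi k.+1)%N).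
  by exists k.+1 => //=.
exfalso; have step k : (k <= K)%N -> (3 ^ k * Psi 1%N <= 2 ^ k * Psi k.+1)%N.
  elim: k => [|k IH] lt; first by rewrite !expn0.
  have h : (3 * Psi k.+1 <= 2 * Psi k.+2)%N.
    by rewrite leqNgt; apply/negP => h; apply: nb; exists (Ordinal lt); apply: ltnW.
  have := IH (ltnW lt); rewrite !expnS => h2.
  have h3 := leq_mul (leqnn (2 ^ k)) h; move: h2 h3.
  by set x := (3 ^ k)%N; set z := (2 ^ k)%N; clear; lia.
have h1 : (m <= Psi 1%N)%N by rewrite /Psi (bigD1 i0) //= ei0 mul1n subn0 leq_addr.
have h2 : (Psi K.+1 <= B * (K.+1 * m))%N.
  apply: leq_trans (_ : \sum_(i < l) (K.+1 * m) <= _)%N.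
    by apply: leq_sum => i _; apply: leq_subr.
  by rewrite sum_nat_const card_ord leq_mul2r lB orbT.
have := step K (leqnn K); apply/negP; rewrite -ltnNge.
apply: leq_ltn_trans (leq_mul (leqnn _) h2) _.
apply: leq_trans (_ : 3 ^ K * m <= _)%N; last by rewrite leq_mul2l h1 orbT.
have -> : (2 ^ K * (B * (K.+1 * m)) = 2 ^ K * (K.+1 * B) * m)%N by lia.
by rewrite ltn_pmul2r.
Qed.

(** * The approximate action of the second root *)

Notation hf := (2^-1 : rat).

Lemma hf_itv : (0 <= hf) && (hf <= 1).
Proof. by []. Qed.
Lemma hf_ge0 k : 0 <= hf ^+ k.
Proof. by rewrite exprn_ge0 // invr_ge0. Qed.
Lemma hf_gt0 k : 0 < hf ^+ k.
Proof. by rewrite exprn_gt0 // invr_gt0. Qed.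
Lemma hf_le1 k : hf ^+ k <= 1.
Proof. by have /andP[h0 h1] := hf_itv; apply: exprn_ile1. Qed.
Lemma hf_mono a b : (a <= b)%N -> hf ^+ b <= hf ^+ a.
Proof. by have /andP[h0 h1] := hf_itv => h; apply: ler_wiXn2l. Qed.
Lemma hf2 a : 2 ^+ a * hf ^+ a = 1.
Proof. by rewrite -exprMn divff // expr1n. Qed.
Lemma hf2_int a b : (b <= a)%N -> 2 ^+ a * hf ^+ b \is a Num.int.
Proof. by move=> /subnK<-; rewrite exprD -mulrA hf2 mulr1 rpredX. Qed.

(* [EE] is multiplication by [\sum_a 2^-(s a)] on the span of the [2^-(e i)], modulo [2^-T']; the matrix
   [ga] below is the truncated [p]-th root of [1 + EE]. *)
Section ClusterMatrix.
Variables (n l p A m N' T' : nat) (s : 'I_n -> nat) (e : 'I_l -> nat).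
Let close j x := ((e j <= x) && (N' * (x - e j) <= m))%N.
Hypothesis p0 : (0 < p)%N.
Hypothesis N0 : (0 < N')%N.
Hypothesis uniq_close : forall i j x, close i x -> close j x -> i = j.
Hypothesis closure : forall i a, (e i < T')%N -> exists j, close j (e i + s a).

Let EE : 'M[rat]_l := \matrix_(i, j) \sum_a
  (if close j (e i + s a) && (e j < T')%N then hf ^+ (e i + s a - e j) else 0).
Let pw k := iter k (mulmx EE) 1%:M.
Let v i := hf ^+ e i.
Let eps : rat := \sum_a hf ^+ s a.

(** Each exponent [e i + s a] is close to at most one [e j], so a row collects at most [n] powers of
    2, none above 1. *)
Let row_sum i : \sum_j `|EE i j| <= n%:R.
Proof.
apply: le_trans (_ : \sum_j \sum_a (if close j (e i + s a) then 1 else 0 : rat) <= _).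
  apply: ler_sum => j _; rewrite mxE; apply: le_trans (ler_norm_sum _ _ _) _.
  apply: ler_sum => a _; case: (close _ _) => /=; last by rewrite normr0.
  by case: ifP => _; rewrite ?normr0 // ger0_norm ?hf_ge0 ?hf_le1.
rewrite exchange_big /=; apply: le_trans (_ : \sum_(a < n) (1 : rat) <= _).
  apply: ler_sum => a _; rewrite -big_mkcond /=.
  case: (pickP (fun j => close j (e i + s a))) => [j hj|nj]; last by rewrite big_pred0.
  rewrite (big_pred1 j) // => j' /=; apply/idP/eqP => [h|->//].
  exact: uniq_close h hj.
by rewrite sumr_const card_ord.
Qed.

Let pw_sum k i : \sum_j `|pw k i j| <= n%:R ^+ k.
Proof.
elim: k i => [|k IH] i.
  rewrite expr0 (bigD1 i) //= big1 ?addr0 => [|j nj]; rewrite /pw /= mxE ?eqxx ?normr1 //.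
  by rewrite eq_sym (negPf nj) normr0.
rewrite /pw iterS -/(pw k).
apply: le_trans (_ : \sum_j \sum_j' `|EE i j'| * `|pw k j' j| <= _).
  apply: ler_sum => j _; rewrite mxE; apply: le_trans (ler_norm_sum _ _ _) _.
  by apply: ler_sum => j' _; rewrite normrM.
rewrite exchange_big /=; apply: le_trans (_ : \sum_j' `|EE i j'| * n%:R ^+ k <= _).
  by apply: ler_sum => j' _; rewrite -mulr_sumr ler_wpM2l.
by rewrite -mulr_suml exprS ler_wpM2r // exprn_ge0 ?ler0n.
Qed.

(** An entry of [EE] is a sum of [2^-x] with [x] a displacement inside a cluster, hence at most
    [m / N']. *)
Let pw_int k i j : 2 ^+ (k * (m %/ N')) * pw k i j \is a Num.int.
Proof.
elim: k i j => [|k IH] i j; first by rewrite mul0n expr0 mul1r /pw /= mxE rpred_nat.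
rewrite /pw iterS -/(pw k) mxE mulr_sumr rpred_sum // => j' _.
rewrite mulSn exprD mulrACA rpredM // mxE mulr_sumr rpred_sum // => a _.
case: ifP => [/andP[/andP[_ h] _]|_]; last by rewrite mulr0.
by apply: hf2_int; rewrite leq_divRL // mulnC.
Qed.

Let pw0 k i j : (e i < T')%N -> (T' <= e j)%N -> pw k i j = 0.
Proof.
elim: k i => [|k IH] i hi hj.
  by rewrite /pw /= mxE; case: eqP => // eij; move: hi; rewrite eij ltnNge hj.
rewrite /pw iterS -/(pw k) mxE big1 // => j' _; have [h|h] := ltnP (e j') T'.
  by rewrite IH ?mulr0.
rewrite mxE big1 ?mul0r // => a _; case: ifP => // /andP[_]; by rewrite ltnNge h.
Qed.

Let pw_err k i : (e i < T')%N ->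
  `|\sum_j pw k i j * v j - eps ^+ k * v i| <= (k * n ^ k)%:R * hf ^+ T'.
Proof.
have eps0 : 0 <= eps by apply: sumr_ge0 => a _; exact: hf_ge0.
have epsn : eps <= n%:R.
  apply: le_trans (_ : \sum_(a < n) (1 : rat) <= _); last by rewrite sumr_const card_ord.
  by apply: ler_sum => a _; exact: hf_le1.
have err1 i' : (e i' < T')%N -> `|\sum_j EE i' j * v j - eps * v i'| <= n%:R * hf ^+ T'.
  move=> hi; under eq_bigr do rewrite mxE mulr_suml.
  rewrite exchange_big /= /eps mulr_suml -sumrB; apply: le_trans (ler_norm_sum _ _ _) _.
  have -> : n%:R * hf ^+ T' = \sum_(a < n) hf ^+ T' by rewrite sumr_const card_ord mulr_natl.
  apply: ler_sum => a _; have [j hj] := closure a hi.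
  rewrite (bigD1 j) //= hj big1 ?addr0 => [|j' nj]; last first.
    case: ifP => [/andP[h _]|_]; last by rewrite mul0r.
    by case/eqP: nj; apply: uniq_close h hj.
  have /andP[h1 _] := hj; rewrite /v -exprD [(s a + _)%N]addnC /=; case: ltnP => h.
    by rewrite -exprD subnK // subrr normr0 hf_ge0.
  by rewrite mul0r sub0r normrN ger0_norm ?hf_ge0 // hf_mono // (leq_trans h).
elim: k i => [|k IH] i hi.
  rewrite (bigD1 i) //= big1 ?addr0 => [|j nj]; rewrite /pw /= mxE ?eqxx.
    by rewrite !mul1r subrr normr0 mul0r.
  by rewrite eq_sym (negPf nj) mul0r.
have -> : \sum_j pw k.+1 i j * v j - eps ^+ k.+1 * v i =
    \sum_j EE i j * (\sum_j' pw k j j' * v j' - eps ^+ k * v j) +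
    eps ^+ k * (\sum_j EE i j * v j - eps * v i).
  have -> : \sum_j pw k.+1 i j * v j = \sum_j EE i j * (\sum_j' pw k j j' * v j').
    rewrite /pw iterS -/(pw k); under eq_bigr do rewrite mxE mulr_suml.
    rewrite exchange_big /=; apply: eq_bigr => j _; rewrite mulr_sumr.
    by apply: eq_bigr => j' _; rewrite mulrA.
  have -> : \sum_j EE i j * (\sum_j' pw k j j' * v j' - eps ^+ k * v j) =
      \sum_j EE i j * (\sum_j' pw k j j' * v j') - eps ^+ k * (\sum_j EE i j * v j).
    by rewrite mulr_sumr -sumrB; apply: eq_bigr => j _; ring.
  rewrite exprSr; ring.
apply: le_trans (ler_normD _ _) _.
have -> : (k.+1 * n ^ k.+1)%:R * hf ^+ T' = n%:R * ((k * n ^ k)%:R * hf ^+ T') +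
    n%:R ^+ k * (n%:R * hf ^+ T').
  rewrite mulSn natrD !natrM !natrX exprS; ring.
apply: lerD; last first.
  rewrite normrM normrX (ger0_norm eps0); apply: ler_pM; rewrite ?exprn_ge0 ?normr_ge0 ?err1 //.
  by rewrite lerXn2r // nnegrE (le_trans eps0).
apply: le_trans (ler_norm_sum _ _ _) _.
apply: le_trans (_ : \sum_j `|EE i j| * ((k * n ^ k)%:R * hf ^+ T') <= _); last first.
  by rewrite -mulr_suml ler_wpM2r ?mulr_ge0 ?hf_ge0.
apply: ler_sum => j _; rewrite normrM; have [h|h] := ltnP (e j) T'.
  by rewrite ler_wpM2l // IH.
have -> : EE i j = 0.
  by rewrite mxE big1 // => a _; case: ifP => // /andP[_]; rewrite ltnNge h.
by rewrite normr0 !mul0r.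
Qed.

(** The binomial series in the matrix [EE], cut at degree [A]. The power of 2 in its denominator is
    only [2^(A m / N')], which is what the clustering gains. *)
Lemma cluster_matrix : exists ga : 'M[rat]_l,
  [/\ forall i j, p%:R ^+ (2 * A) * 2 ^+ (A * (m %/ N')) * ga i j \is a Num.int,
      forall i j, `|ga i j| <= (A.+1 * n.+1 ^ A)%:R &
      forall i, (e i < T')%N ->
        `|(binp p A).[eps] * v i - \sum_(j | (e j < T')%N) ga i j * v j|
           <= (A.+1 * (A * n.+1 ^ A))%:R * hf ^+ T'].
Proof.
exists (\matrix_(i, j) \sum_(k < A.+1) bcoef p k * pw k i j); split.
- move=> i j; rewrite mxE mulr_sumr rpred_sum // => k _; rewrite mulrACA rpredM //.
    have -> : (2 * A = 2 * (A - k) + 2 * k)%N by rewrite -mulnDr subnK // -ltnS.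
    by rewrite exprD -mulrA rpredM ?rpredX ?rpred_nat // bcoef_int.
  have -> : (A * (m %/ N') = (A - k) * (m %/ N') + k * (m %/ N'))%N.
    by rewrite -mulnDl subnK // -ltnS.
  by rewrite exprD -mulrA rpredM ?rpredX.
- move=> i j; rewrite mxE; apply: le_trans (ler_norm_sum _ _ _) _.
  rewrite mulnC natrM mulr_natr -[X in _ *+ X](card_ord A.+1) -sumr_const.
  apply: ler_sum => k _; rewrite normrM -[leRHS]mul1r ler_pM ?bcoef_le1 //.
  apply: le_trans (_ : n%:R ^+ k <= _).
    by apply: le_trans (pw_sum k i); rewrite (bigD1 j) //= lerDl sumr_ge0.
  rewrite -natrX ler_nat; apply: leq_trans (_ : n.+1 ^ k <= _)%N.
    by case: (nat_of_ord k) => // k'; rewrite leq_exp2r.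
  by rewrite leq_pexp2l // -ltnS.
move=> i hi.
have -> : (binp p A).[eps] * v i - \sum_(j | (e j < T')%N)
    (\matrix_(i, j) \sum_(k < A.+1) bcoef p k * pw k i j) i j * v j =
   - \sum_(k < A.+1) bcoef p k * (\sum_j pw k i j * v j - eps ^+ k * v i).
  under [X in _ = - X]eq_bigr do rewrite mulrBr.
  rewrite sumrB opprB; congr (_ - _).
    rewrite (horner_coef_wide _ (size_binp p A)) mulr_suml; apply: eq_bigr => k _.
    by rewrite coef_binp -ltnS ltn_ord mulrA.
  under eq_bigr do rewrite mxE mulr_suml.
  rewrite exchange_big /=; apply: eq_bigr => k _; rewrite mulr_sumr.
  rewrite [RHS](bigID (fun j => (e j < T')%N)) /= [X in _ = _ + X]big1 ?addr0.
    by apply: eq_bigr => j _; rewrite mulrA.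
  by move=> j; rewrite -leqNgt => h; rewrite pw0 // mul0r mulr0.
rewrite normrN; apply: le_trans (ler_norm_sum _ _ _) _.
have -> : (A.+1 * (A * n.+1 ^ A))%:R * hf ^+ T' =
    \sum_(k < A.+1) (A * n.+1 ^ A)%:R * hf ^+ T'.
  by rewrite sumr_const card_ord natrM -mulrA mulr_natl.
apply: ler_sum => k _; rewrite normrM -[leRHS]mul1r ler_pM ?bcoef_le1 //.
apply: le_trans (pw_err k hi) _; apply: ler_wpM2r; first exact: hf_ge0.
rewrite ler_nat; apply: leq_mul; first by rewrite -ltnS.
apply: leq_trans (_ : n.+1 ^ k <= _)%N.
  by case: (nat_of_ord k) => // k'; rewrite leq_exp2r.
by rewrite leq_pexp2l // -ltnS.
Qed.

End ClusterMatrix.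

(** * Expansions of the root of the curve at the origin and at [2^-s] *)

Lemma nrm_binpB1 p M x : (0 < p)%N -> 0 <= x -> x <= 2^-1 -> nrm x (binp p M - 1) <= 2 * x.
Proof.
move=> p0 x0 x2; set P := _ - 1.
have vP : vanish 1 P by move=> i; rewrite ltnS leqn0 => /eqP->; rewrite coefB binp0 coefC subrr.
apply: le_trans (nrm_shrink x0 (_ : 0 < 2^-1) x2 vP) _ => //.
rewrite expr1 invrK [x * 2]mulrC -[leRHS]mulr1; apply: ler_wpM2l; first by rewrite mulr_ge0.
have := nrm_binp M p0 (_ : 0 <= 2^-1) (lexx _) => /(_ isT).
rewrite (nrm_wide _ (size_binp p M)) big_ord_recl binp0 normr1 expr0 mulr1 => h.
have sP : (size P <= M.+1)%N.
  by apply: leq_trans (size_polyD _ _) _; rewrite geq_max size_binp size_polyN size_poly1.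
rewrite (nrm_wide _ sP) big_ord_recl (vP 0%N) // normr0 mul0r add0r.
apply: le_trans (_ : \sum_(i < M) `|(binp p M)`_(lift ord0 i)| * hf ^+ lift ord0 i <= _); last by lra.
by apply: ler_sum => i _; rewrite coefB coefC subr0.
Qed.

Lemma nrm_binp1 p M x : (0 < p)%N -> 0 <= x -> x <= 2^-1 -> nrm x (binp p M) <= 1 + 2 * x.
Proof.
move=> p0 x0 x2; rewrite -[binp p M](subrK 1) addrC; apply: le_trans (nrmD _ _ x0) _.
by rewrite -[X in nrm x X]polyC1 nrmC normr1 lerD2l nrm_binpB1.
Qed.

(** Bernoulli's inequality in the form [(1 + d)^n (1 - n d) <= 1]. *)
Lemma expr_le_32 p (d : rat) : 0 <= d -> p%:R * d <= 3^-1 -> (1 + d) ^+ p <= 3 / 2.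
Proof.
move=> d0 pd; have key n : (n <= p)%N -> (1 + d) ^+ n * (1 - n%:R * d) <= 1.
  elim: n => [|n IH] lt; first by rewrite expr0 mul0r subr0 mulr1.
  have := IH (ltnW lt); rewrite exprSr -mulrA -natr1.
  apply: le_trans; apply: ler_wpM2l; first by rewrite exprn_ge0 // addr_ge0.
  have n0 := ler0n rat n; have := mulr_ge0 n0 d0; have := mulr_ge0 (mulr_ge0 n0 d0) d0.
  have := mulr_ge0 d0 d0; nra.
have := key p (leqnn p); have : 0 <= (1 + d) ^+ p by rewrite exprn_ge0 // addr_ge0.
set X := _ ^+ p; nra.
Qed.

(** In [U ^+ p - K ^+ p = (U - K) Q] the constant coefficient [q >= 1] of [Q] dominates: the norm of
    [Q] is at most [3 q / 2], so the rest of [Q] has norm at most [q / 2] and is absorbed on the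
    left. *)
Lemma nrm_root_diff p y (d : rat) (U K : {poly rat}) : (0 < p)%N -> 0 <= y -> 0 <= d -> p%:R * d <= 3^-1 ->
  1 <= U`_0 -> 0 <= K`_0 -> nrm y U <= U`_0 * (1 + d) -> nrm y K <= K`_0 * (1 + d) ->
  nrm y (U - K) <= 2 * nrm y (U ^+ p - K ^+ p).
Proof.
move=> p0 y0 d0 pd U1 K0 nU nK; have U0 : 0 <= U`_0 by lra.
pose Q := \sum_(i < p) U ^+ (p.-1 - i) * K ^+ i.
pose q := \sum_(i < p) U`_0 ^+ (p.-1 - i) * K`_0 ^+ i.
have Q0 : Q`_0 = q.
  by rewrite coef_sum; apply: eq_bigr => i _; rewrite coef0M !coef0X.
have q1 : 1 <= q.
  rewrite /q; case: (p) p0 => // p' _; rewrite big_ord_recl expr0 mulr1 subn0 -[1]addr0.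
  rewrite lerD ?exprn_ege1 // sumr_ge0 // => i _; rewrite mulr_ge0 // exprn_ge0 //.
have nQ : nrm y Q <= q * (3 / 2).
  apply: le_trans (nrm_sum _ _ _ y0) _; rewrite mulr_suml; apply: ler_sum => i _.
  have le_ip : (i <= p.-1)%N by rewrite -ltnS prednK.
  apply: le_trans (nrmM _ _ y0) _.
  apply: le_trans (_ : (U`_0 * (1 + d)) ^+ (p.-1 - i) * (K`_0 * (1 + d)) ^+ i <= _).
    apply: ler_pM; rewrite ?nrm_ge0 //; (apply: le_trans (nrmX _ _ y0) _);
    by rewrite lerXn2r // nnegrE ?nrm_ge0 ?mulr_ge0 //; lra.
  rewrite !exprMn mulrACA -exprD subnK // ler_wpM2l ?mulr_ge0 ?exprn_ge0 //.
  apply: le_trans (expr_le_32 d0 pd); rewrite ler_weXn2l ?leq_pred //; lra.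
have eQ : q *: (U - K) = (U ^+ p - K ^+ p) - (U - K) * (Q - q%:P).
  have -> : U ^+ p - K ^+ p = (U - K) * Q.
    rewrite subrXX /Q; congr (_ * _).
  rewrite -mul_polyC; ring.
have tQ : nrm y (Q - q%:P) <= q * 2^-1.
  pose n := maxn (size Q) (size (Q - q%:P)).
  have n0 : n = n.-1.+1.
    rewrite prednK // /n leq_max lt0n size_poly_eq0; apply/orP; left.
    by apply/eqP => Qz; move: q1; rewrite -Q0 Qz coef0 ler10.
  have := nQ; rewrite (@nrm_wide n _ Q) ?leq_maxl // (@nrm_wide n _ (Q - _)) ?leq_maxr //.
  rewrite n0 !big_ord_recl coefB coefC Q0 subrr normr0 mul0r add0r expr0 mulr1.
  rewrite (ger0_norm (le_trans ler01 q1)) => h.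
  apply: le_trans (_ : \sum_(i < n.-1) `|Q`_(lift ord0 i)| * y ^+ lift ord0 i <= _); last by lra.
  by apply: ler_sum => i _; rewrite coefB coefC subr0.
have := nrmB (U ^+ p - K ^+ p) ((U - K) * (Q - q%:P)) y0; rewrite -eQ nrmZ ger0_norm; last by lra.
have h1 := nrmM (U - K) (Q - q%:P) y0; have h2 := nrm_ge0 (U - K) y0.
have h3 := nrm_ge0 (U ^+ p - K ^+ p) y0.
set a := nrm y (U - K) in h1 h2 *; set b := nrm y (U ^+ p - _) in h3 *.
set cc := nrm y (_ * _) in h1 *; set dd := nrm y (Q - _) in h1 tQ.
have h4 : a * dd <= a * (q * 2^-1) by rewrite ler_wpM2l.
move=> h5; have h6 : a * q <= 2 * b by nra.
by apply: le_trans h6; rewrite ler_peMr.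
Qed.

Section Curve.
Variables (f : {poly rat}) (p kap s : nat).
Hypothesis f0 : f`_0 = 1.
Hypothesis fk : forall c : nat, `|f`_c| <= 2 ^+ (kap * c).
Hypothesis sk : (kap + p + 9 <= s)%N.
Let rho := hf ^+ (kap + 2).
Let y := hf ^+ s.
Let sg := hf ^+ (p + 6).

Lemma nrm_f1 : nrm rho (f - 1) <= 2^-1.
Proof.
have h (n : nat) : \sum_(i < n) (4^-1 : rat) ^+ i.+1 <= 2^-1.
  have : \sum_(i < n) (4^-1 : rat) ^+ i.+1 <= 2^-1 - 2^-1 * (4^-1) ^+ n.
    elim: n => [|n IH]; first by rewrite big_ord0 expr0 mulr1 subrr.
    have z0 : 0 <= (4^-1 : rat) ^+ n by rewrite exprn_ge0.
    by rewrite big_ord_recr /= exprS; set z := _ ^+ n in z0 IH *; lra.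
  have : 0 <= (4^-1 : rat) ^+ n by rewrite exprn_ge0.
  lra.
pose n := (size (f - 1)).-1.
have sn : (size (f - 1)%R <= n.+1)%N by rewrite /n; case: (size _).
rewrite (nrm_wide _ sn) big_ord_recl coefB f0 coefC subrr normr0 mul0r add0r.
apply: le_trans (h n); apply: ler_sum => i _.
rewrite coefB coefC subr0; apply: le_trans (_ : 2 ^+ (kap * i.+1) * rho ^+ i.+1 <= _).
  by rewrite ler_wpM2r ?exprn_ge0 ?hf_ge0 // fk.
rewrite /rho -exprM mulnDl exprD mulrA hf2 mul1r exprM.
by rewrite (_ : hf ^+ 2 = 4^-1).
Qed.

Lemma rho_ge0 : 0 <= rho. Proof. exact: hf_ge0. Qed.
Lemma y2E : 2 * y / rho = 2 ^+ (kap + 3) * y.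
Proof.
rewrite (_ : rho^-1 = 2 ^+ (kap + 2)); last by rewrite /rho exprVn invrK.
by rewrite (_ : (kap + 3 = (kap + 2).+1)%N) ?exprS; [ring | lia].
Qed.
Lemma y2_small : 2 * y / rho <= sg.
Proof.
rewrite y2E; apply: le_trans (_ : 2 ^+ (kap + 3) * hf ^+ (kap + 3 + (p + 6)) <= _).
  by rewrite ler_wpM2l ?exprn_ge0 // hf_mono //; lia.
by rewrite (exprD hf (kap + 3)) mulrA hf2 mul1r.
Qed.
Lemma y2_ge0 : 0 <= 2 * y. Proof. by rewrite mulr_ge0 ?hf_ge0. Qed.
Lemma y2_rho : 2 * y <= rho.
Proof.
have := y2_small; rewrite ler_pdivrMr ?hf_gt0 // => h; apply: le_trans h _.
by rewrite ler_piMl ?hf_ge0 ?hf_le1.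
Qed.

(** Shrinking the radius from [rho] to [2 * y] gains [2^(kap + 3 - s)]. The bound [sk] makes this at
    most [2^-(p + 6)], small enough for [p] times [8 * sg] to satisfy [nrm_root_diff]. *)
Lemma nrm_f1y : nrm (2 * y) (f - 1) <= sg.
Proof.
have vP : vanish 1 (f - 1) by move=> i; rewrite ltnS leqn0 => /eqP->; rewrite coefB f0 coefC subrr.
apply: le_trans (nrm_shrink y2_ge0 (hf_gt0 _ : 0 < rho) y2_rho vP) _.
rewrite expr1; apply: le_trans (_ : sg * 1 <= _); last by rewrite mulr1.
rewrite ler_pM ?y2_small ?(le_trans nrm_f1) ?nrm_ge0 ?rho_ge0 ?divr_ge0 ?y2_ge0 ?hf_ge0 //.
Qed.
End Curve.

Lemma shift_int (s T : nat) P : pint P -> (forall i, P`_i != 0 -> (i * s <= T)%N) ->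
  pint (2 ^+ T *: (P \Po ('X + (hf ^+ s)%:P))).
Proof.
move=> hP sP; rewrite comp_polyE scaler_sumr; apply: pint_sum => i _.
have [->|nz] := eqVneq P`_i 0; first by rewrite scale0r scaler0; exact: pint0.
have le := sP i nz; have -> : (T = (T - i * s) + i * s)%N by rewrite subnK.
rewrite exprD -scalerA [2 ^+ (i * s) *: _]scalerA mulrC -scalerA.
apply: pintZ; first exact: rpredX.
apply: pintZ => //; rewrite mulnC exprM -exprZn; apply: pintX.
rewrite scalerDr scale_polyC hf2; apply: pintD; last exact: pint1.
by apply: pintZ; [exact: rpredX | rewrite -['X]expr1; exact: pintXn].
Qed.

Lemma comp1 Q : (1 : {poly rat}) \Po Q = 1.
Proof. by rewrite -polyC1 comp_polyC. Qed.

Lemma hf6 : hf ^+ 6 = 64^-1.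
Proof. by rewrite exprVn -natrX. Qed.
Lemma sg_small p : hf ^+ (p + 6) <= 64^-1.
Proof. by rewrite -hf6; apply: hf_mono; rewrite leq_addl. Qed.
Lemma psg p : p%:R * hf ^+ (p + 6) <= 64^-1.
Proof.
rewrite exprD mulrA hf6; apply: ler_piMl; first by rewrite invr_ge0 ler0n.
apply: (@le_trans _ _ (2 ^+ p * hf ^+ p)); last by rewrite hf2.
apply: ler_wpM2r; first exact: hf_ge0.
by rewrite -natrX ler_nat; apply: ltnW; apply: ltn_expl.
Qed.

Section Roots.
Variables (f : {poly rat}) (p a kap s M r : nat) (w1 th : rat) (q1 : nat).
Hypothesis p0 : (0 < p)%N.
Hypothesis M0 : (0 < M)%N.
Hypothesis fint : pint f.
Hypothesis f0 : f`_0 = 1.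
Hypothesis fk : forall c : nat, `|f`_c| <= 2 ^+ (kap * c).
Hypothesis sf : (size f <= a.+1)%N.
Hypothesis sk : (kap + p + 9 <= s)%N.
Let rho := hf ^+ (kap + 2).
Let y := hf ^+ s.
Let sg := hf ^+ (p + 6).
Let sh P := P \Po ('X + y%:P).
Let phi := f.[y].
Hypothesis phi1 : 1 <= phi.
Hypothesis w10 : 0 < w1.
Hypothesis w1p : w1 ^+ p = 2 ^+ r * phi.
Hypothesis w1q : 2 ^+ q1 * w1 \is a Num.int.
Hypothesis th0 : 0 < th.
Let eta := `|2 ^+ r - th ^+ p|.
Hypothesis eta1 : eta <= 1.

(** [hpol] expands the [p]-th root of [f] at the origin, [upol] that of [2^r f] at [y], normalised
    by its value [w1] there. [kpol] is [hpol] recentred at [y] and scaled by [th], a rational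
    stand-in for [2^(r/p)]. Relations are imposed at the origin but used at [y], so the two must be
    compared. *)
Definition hpol := binp p M \Po (f - 1).
Definition gpol := phi^-1 *: (sh f - phi%:P).
Definition upol := w1 *: (binp p M \Po gpol).
Definition kpol := th *: sh hpol.

Let sg0 : 0 <= sg. Proof. exact: hf_ge0. Qed.
Let y0 : 0 <= y. Proof. exact: hf_ge0. Qed.
Let nf1y : nrm (2 * y) (f - 1) <= sg. Proof. exact: nrm_f1y. Qed.
Let f1_0 : (f - 1)`_0 = 0. Proof. by rewrite coefB f0 coefC subrr. Qed.
Let v_f1 : vanish 1 (f - 1). Proof. by move=> i; rewrite ltnS leqn0 => /eqP->. Qed.
Let sh0 P : (sh P)`_0 = P.[y].
Proof. by rewrite -horner_coef0 horner_comp hornerD hornerX hornerC add0r. Qed.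
Let nrm_sh P : nrm y (sh P) <= nrm (2 * y) P.
Proof. by apply: le_trans (nrm_shift _ y0 y0) _; rewrite mulr_natl mulr2n. Qed.
Let pn0 : (p%:R : rat) != 0. Proof. by rewrite pnatr_eq0; lia. Qed.

Let comp_coef (Q : {poly rat}) v : vanish 1 Q -> (v <= M)%N ->
  (binp p M \Po Q)`_v = \sum_(k < v.+1) bcoef p k * (Q ^+ k)`_v.
Proof.
move=> vQ le; have -> : binp p M \Po Q = \sum_(k < M.+1) (bcoef p k) *: Q ^+ k.
  rewrite comp_polyE (big_ord_widen M.+1 (fun i => (binp p M)`_i *: Q ^+ i)) ?size_binp //.
  rewrite big_mkcond; apply: eq_bigr => i _; rewrite -[bcoef p i]/(if true then _ else 0).
  case: ifP => h; first by rewrite coef_binp -ltnS ltn_ord.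
  rewrite -[bcoef p i]/(if true then _ else 0) -(ltn_ord i) -coef_binp.
  by rewrite [_`_i]nth_default ?scale0r // leqNgt h.
rewrite coef_sum (bigID (fun k : 'I_M.+1 => (k < v.+1)%N)) /= [X in _ + X]big1 ?addr0 => [|k].
  rewrite (big_ord_widen M.+1 (fun k => bcoef p k * (Q ^+ k)`_v)) //.
  by apply: eq_bigr => k _; rewrite coefZ.
by rewrite -ltnNge => h; rewrite coefZ (@vanishX 1 Q k vQ) ?mulr0 // muln1.
Qed.

Lemma hpol_int b : (b <= M)%N -> p%:R ^+ (2 * b) * hpol`_b \is a Num.int.
Proof.
move=> le; rewrite /hpol comp_coef // mulr_sumr rpred_sum // => k _.
have -> : (2 * b = 2 * (b - k) + 2 * k)%N by rewrite -mulnDr subnK // -ltnS.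
rewrite exprD -!mulrA rpredM ?rpredX ?rpred_nat // mulrA rpredM ?bcoef_int //.
by apply: pintX; apply: pintB; [exact: fint | exact: pint1].
Qed.

Lemma nrm_hpol : nrm rho hpol <= 2.
Proof.
apply: le_trans (nrm_comp _ _ (hf_ge0 _)) _; apply: nrm_binp => //; first by rewrite nrm_ge0 ?hf_ge0.
exact: nrm_f1.
Qed.

Lemma hpol_bound b : `|hpol`_b| <= 2 ^+ ((kap + 2) * b).+1.
Proof.
have := le_trans (nrm_coef hpol b (hf_ge0 (kap + 2))) nrm_hpol.
rewrite -exprM -(ler_pM2l (_ : 0 < 2 ^+ ((kap + 2) * b))) ?exprn_gt0 //.
by rewrite mulrCA hf2 mulr1 -exprSr.
Qed.

Let two_sg : 2 * sg <= 2^-1. Proof. have := sg_small p; rewrite -/sg; lra. Qed.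
Let sg_half : sg <= 2^-1. Proof. have := sg_small p; rewrite -/sg; lra. Qed.
Let nf0 : 0 <= nrm (2 * y) (f - 1). Proof. by rewrite nrm_ge0 // mulr_ge0. Qed.

Let hpolB1 : nrm (2 * y) (hpol - 1) <= 2 * sg.
Proof.
have -> : hpol - 1 = (binp p M - 1) \Po (f - 1) by rewrite comp_polyB comp1.
apply: le_trans (nrm_comp _ _ (mulr_ge0 _ y0)) _ => //.
apply: le_trans (nrm_mono _ nf0 nf1y) _; exact: nrm_binpB1.
Qed.

Let phi2 : phi <= 2.
Proof.
have e : phi = 1 + (f - 1).[y] by rewrite hornerD hornerN hornerC addrC subrK.
have h1 := horner_nrm (f - 1) y0.
have h2 : nrm y (f - 1) <= nrm (2 * y) (f - 1) by apply: nrm_mono => //; have := y0; lra.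
have h3 := ler_norm (f - 1).[y]; have := sg_small p; rewrite -/sg; have := nf1y; lra.
Qed.
Lemma phi_le2 : phi <= 2. Proof. exact: phi2. Qed.
Let phi0 : 0 < phi. Proof. exact: lt_le_trans phi1. Qed.

Lemma gpol0 : gpol`_0 = 0.
Proof. by rewrite coefZ coefB sh0 coefC subrr mulr0. Qed.
Let v_g : vanish 1 gpol. Proof. by move=> i; rewrite ltnS leqn0 => /eqP->; exact: gpol0. Qed.

Let nrm_g : nrm y gpol <= 2 * sg.
Proof.
rewrite nrmZ gtr0_norm ?invr_gt0 // ler_pdivrMl //.
have -> : sh f - phi%:P = sh (f - 1) - ((f - 1).[y])%:P.
  rewrite /sh comp_polyB comp1 hornerD hornerN hornerC.
  by rewrite polyCB -/phi polyC1; ring.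
apply: le_trans (nrmB _ _ y0) _; rewrite nrmC.
have h1 := nrm_sh (f - 1); have h2 := horner_nrm (f - 1) y0.
have h3 : nrm y (f - 1) <= nrm (2 * y) (f - 1) by apply: nrm_mono => //; have := y0; lra.
have h4 := nf1y; apply: le_trans (_ : 2 * sg <= _); first lra.
by rewrite ler_peMl // mulr_ge0.
Qed.
Let ng0 : 0 <= nrm y gpol. Proof. exact: nrm_ge0. Qed.

Lemma upol0 : upol`_0 = w1.
Proof.
by rewrite coefZ -horner_coef0 horner_comp horner_coef0 gpol0 horner_coef0 binp0 mulr1.
Qed.

(** By [binp_ode] the truncated root fails [p f u' = f' u] only by a multiple of [gpol ^+ M], and
    [gpol] has no constant coefficient. *)
Lemma upol_ode : vanish M (p%:R *: (sh f * upol^`()) - sh f^`() * upol).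
Proof.
have [c ode] := binp_ode M p0.
have odeg := congr1 (fun P => P \Po gpol) ode.
rewrite /= comp_polyB !comp_polyZ comp_polyM comp_polyD comp_polyX comp1 in odeg.
rewrite comp_Xn_poly in odeg.
have e1 : 1 + gpol = phi^-1 *: sh f.
  rewrite /gpol scalerBr -[phi^-1 *: phi%:P]mul_polyC -polyCM mulVf ?gt_eqF // polyC1; ring.
have g' : gpol^`() = phi^-1 *: sh f^`().
  by rewrite derivZ derivB derivC subr0 /sh deriv_comp derivD derivX derivC addr0 mulr1.
have -> : p%:R *: (sh f * upol^`()) - sh f^`() * upol = (w1 * c) *: (sh f^`() * gpol ^+ M).
  rewrite /upol derivZ deriv_comp g'.
  have -> : (w1 * c) *: (sh f^`() * gpol ^+ M) = w1 *: (sh f^`() * (c *: gpol ^+ M)).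
    by rewrite -scalerAr scalerA.
  rewrite -odeg e1 -!mul_polyC; ring.
by apply/vanishZ/vanishMl; have := @vanishX 1 gpol M v_g; rewrite muln1.
Qed.

(** Every factor [gpol] brings a division by [phi] and, through the shift, a denominator dividing
    [2^(s a)]; the power of [p] is for the binomial coefficients and [2^q1] for [w1]. *)
Lemma upol_int v : (v <= M)%N ->
  2 ^+ q1 * (p%:R ^+ (2 * v) * ((2 ^+ (s * a) * phi) ^+ v * upol`_v)) \is a Num.int.
Proof.
move=> le; rewrite /upol coefZ comp_coef //; set Z := \sum_(_ < _) _.
have -> : 2 ^+ q1 * (p%:R ^+ (2 * v) * ((2 ^+ (s * a) * phi) ^+ v * (w1 * Z))) =
  (2 ^+ q1 * w1) * (p%:R ^+ (2 * v) * (2 ^+ (s * a) * phi) ^+ v * Z) by ring.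
apply: rpredM; first exact: w1q.
rewrite mulr_sumr; apply: rpred_sum => k _.
have lek : (k <= v)%N by rewrite -ltnS.
have Rf : pint (2 ^+ (s * a) *: sh f).
  apply: shift_int => // i nz; rewrite mulnC leq_mul2l; apply/orP; right.
  by rewrite -ltnS; apply: leq_trans sf; rewrite ltnNge; apply: contra nz => h; rewrite nth_default.
have Rphi : 2 ^+ (s * a) * phi \is a Num.int by have := Rf 0%N; rewrite coefZ sh0.
set R := 2 ^+ (s * a) in Rf Rphi *.
have -> : (gpol ^+ k)`_v = phi ^- k * ((sh f - phi%:P) ^+ k)`_v.
  by rewrite /gpol exprZn coefZ exprVn.
have -> : p%:R ^+ (2 * v) * (R * phi) ^+ v * (bcoef p k * (phi ^- k * ((sh f - phi%:P) ^+ k)`_v)) =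
   (p%:R ^+ (2 * (v - k)) * (p%:R ^+ (2 * k) * bcoef p k)) *
   ((R * phi) ^+ (v - k) * (R ^+ k * ((sh f - phi%:P) ^+ k)`_v)).
  have e1 : p%:R ^+ (2 * v) = p%:R ^+ (2 * (v - k)) * p%:R ^+ (2 * k) :> rat.
    by rewrite -exprD -mulnDr subnK.
  have e2 : (R * phi) ^+ v = (R * phi) ^+ (v - k) * (R ^+ k * phi ^+ k).
    by rewrite -exprMn -exprD subnK.
  rewrite e1 e2.
  have : phi ^+ k * phi ^- k = 1 by rewrite divff // expf_neq0 // gt_eqF.
  set X := phi ^+ k; set Y := phi ^- k => XY.
  transitivity ((p%:R ^+ (2 * (v - k)) * (p%:R ^+ (2 * k) * bcoef p k)) *
   ((R * phi) ^+ (v - k) * (R ^+ k * ((sh f - phi%:P) ^+ k)`_v)) * (X * Y)); first by ring.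
  by rewrite XY mulr1.
apply: rpredM.
  by apply: rpredM; [rewrite rpredX ?rpred_nat | exact: bcoef_int].
apply: rpredM; first exact: rpredX.
have -> : R ^+ k * ((sh f - phi%:P) ^+ k)`_v = ((R *: sh f - (R * phi)%:P) ^+ k)`_v.
  rewrite polyCM -coefZ -exprZn scalerBr -[R *: phi%:P]mul_polyC; by [].
by apply: pintX; apply: pintB => //; apply: pintC.
Qed.

(** Both polynomials are approximate [p]-th roots of [2^r] times the shifted [f] with dominant
    constant coefficient, so by [nrm_root_diff] it suffices to compare their [p]-th powers. *)
Lemma root_close : nrm y (upol - kpol) <= 4 * eta + hf ^+ M.+1 * 2 ^+ (p + r + 3).
Proof.
have nu : nrm y upol <= upol`_0 * (1 + 8 * sg).
  rewrite upol0 nrmZ gtr0_norm // ler_pM2l //; apply: le_trans (nrm_comp _ _ y0) _.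
  apply: le_trans (nrm_mono _ ng0 nrm_g) _; apply: le_trans (nrm_binp1 _ p0 _ two_sg) _.
    by rewrite mulr_ge0.
  have := sg0; lra.
have h1 : `|hpol.[y] - 1| <= 2 * sg.
  have -> : hpol.[y] - 1 = (hpol - 1).[y] by rewrite hornerD hornerN hornerC.
  apply: le_trans (horner_nrm _ y0) _; apply: le_trans hpolB1; apply: nrm_mono => //.
  by have := y0; lra.
have k0 : kpol`_0 = th * hpol.[y] by rewrite coefZ sh0.
have hy : 1 - 2 * sg <= hpol.[y] by move: h1; rewrite ler_norml => /andP[]; lra.
have nk : nrm y kpol <= kpol`_0 * (1 + 8 * sg).
  rewrite k0 nrmZ gtr0_norm // -mulrA ler_pM2l //; apply: le_trans (nrm_sh _) _.
  apply: (@le_trans _ _ (1 + 2 * sg)).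
    rewrite -[hpol](subrK 1) addrC; apply: le_trans (nrmD _ _ (mulr_ge0 _ y0)) _ => //.
    by rewrite -[X in nrm _ X + _]polyC1 nrmC normr1 lerD2l hpolB1.
  apply: (@le_trans _ _ ((1 - 2 * sg) * (1 + 8 * sg))); first by have := sg0; have := sg_small p; rewrite -/sg; nra.
  by apply: ler_wpM2r; [rewrite addr_ge0 ?ler01 ?mulr_ge0 ?sg0 ?ler0n | exact: hy].
have w1_1 : 1 <= w1.
  rewrite -(ler_pXn2r p0) ?nnegrE ?ler01 ?(ltW w10) // expr1n w1p.
  by apply: mulr_ege1; [apply: exprn_ege1; rewrite ler1n | exact: phi1].
have pd : p%:R * (8 * sg) <= 3^-1 by have := psg p; rewrite -/sg; lra.
have u1 : 1 <= upol`_0 by rewrite upol0.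
have kk0 : 0 <= kpol`_0 by rewrite k0 mulr_ge0 ?(ltW th0) //; have := sg_small p; rewrite -/sg; lra.
have d0 : 0 <= 8 * sg by rewrite mulr_ge0.
apply: le_trans (nrm_root_diff p0 y0 d0 pd u1 kk0 nu nk) _.
pose Rem := binp p M ^+ p - (1 + 'X).
have eU : upol ^+ p = 2 ^+ r *: sh f + w1 ^+ p *: (Rem \Po gpol).
  have -> : upol ^+ p = w1 ^+ p *: ((Rem + (1 + 'X)) \Po gpol) by rewrite /Rem subrK exprZn rmorphXn.
  rewrite comp_polyD scalerDr addrC; congr (_ + _).
  rewrite comp_polyD comp_polyX comp1 w1p /gpol scalerBr.
  rewrite -[phi^-1 *: phi%:P]mul_polyC -polyCM mulVf ?gt_eqF // addrC subrK scalerA mulfK ?gt_eqF //.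
have eK : kpol ^+ p = th ^+ p *: (sh f + sh (Rem \Po (f - 1))).
  rewrite exprZn; congr (_ *: _); rewrite /sh -comp_polyD -rmorphXn; congr (_ \Po _).
  rewrite /hpol -rmorphXn /= -[binp p M ^+ p](subrK (1 + 'X)) comp_polyD -/Rem addrC; congr (_ + _).
  by rewrite comp_polyD comp_polyX comp1 addrC subrK.
have -> : upol ^+ p - kpol ^+ p = (2 ^+ r - th ^+ p) *: sh f + w1 ^+ p *: (Rem \Po gpol)
     - th ^+ p *: sh (Rem \Po (f - 1)).
  by rewrite eU eK scalerDr scalerBl; ring.
have M1 x : 0 <= x -> x <= 2 * sg -> nrm x Rem <= hf ^+ M.+1 * 2 ^+ p.
  move=> x0 xs; apply: le_trans (nrm_binpX_rem p0 M0 x0 (le_trans xs two_sg)) _.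
  rewrite ler_wpM2r ?exprn_ge0 // lerXn2r ?nnegrE ?mulr_ge0 ?invr_ge0 //.
  by have := sg_small p; rewrite -/sg; lra.
have n1 : nrm y (Rem \Po gpol) <= hf ^+ M.+1 * 2 ^+ p.
  by apply: le_trans (nrm_comp _ _ y0) _; apply: M1.
have n2 : nrm y (sh (Rem \Po (f - 1))) <= hf ^+ M.+1 * 2 ^+ p.
  apply: le_trans (nrm_sh _) _; apply: le_trans (nrm_comp _ _ (mulr_ge0 _ y0)) _ => //.
  by apply: M1 => //; apply: le_trans nf1y _; have := sg0; lra.
have n3 : nrm y (sh f) <= 2.
  apply: le_trans (nrm_sh _) _; rewrite -[f](subrK 1); apply: le_trans (nrmD _ _ (mulr_ge0 _ y0)) _ => //.
  by rewrite -[X in _ + nrm _ X]polyC1 nrmC normr1; have := nf1y; have := sg_small p; rewrite -/sg; lra.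
have wp : w1 ^+ p <= 2 * 2 ^+ r by rewrite w1p mulrC ler_wpM2r ?exprn_ge0.
have tp : th ^+ p <= 2 * 2 ^+ r.
  have := ler_normr (2 ^+ r - th ^+ p) (th ^+ p - 2 ^+ r).
  have : th ^+ p - 2 ^+ r <= eta by rewrite /eta distrC ler_norm.
  have : (1 : rat) <= 2 ^+ r by rewrite exprn_ege1.
  by have := eta1; lra.
have wp0 : 0 <= w1 ^+ p by rewrite exprn_ge0 // ltW.
have tp0 : 0 <= th ^+ p by rewrite exprn_ge0 // ltW.
apply: (@le_trans _ _ (2 * (eta * 2 + w1 ^+ p * (hf ^+ M.+1 * 2 ^+ p) + th ^+ p * (hf ^+ M.+1 * 2 ^+ p)))).
  rewrite ler_pM2l //; apply: le_trans (nrmB _ _ y0) _; apply: lerD; last first.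
    by rewrite nrmZ ger0_norm // ler_wpM2l.
  apply: le_trans (nrmD _ _ y0) _; apply: lerD; rewrite nrmZ; first by rewrite ler_wpM2l.
  by rewrite ger0_norm // ler_wpM2l.
have z0 : 0 <= hf ^+ M.+1 * 2 ^+ p by rewrite mulr_ge0 ?hf_ge0 ?exprn_ge0.
have -> : hf ^+ M.+1 * 2 ^+ (p + r + 3) = 8 * 2 ^+ r * (hf ^+ M.+1 * 2 ^+ p).
  by rewrite !exprD (_ : 2 ^+ 3 = 8) //; ring.
set Z := _ * 2 ^+ p in z0 *; set Rr := 2 ^+ r in wp tp *.
have := ler_wpM2r z0 wp; have := ler_wpM2r z0 tp; lra.
Qed.

End Roots.

(** * Auxiliary polynomials *)

Lemma count_mult N s t : (minn t (N * s) <= (\sum_(a < N) (a * s < t)%N) * s <= t + s)%N &&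
  (\sum_(a < N) (a * s < t)%N <= N)%N.
Proof.
elim: N => [|N IH]; first by rewrite big_ord0 !mul0n minn0.
rewrite big_ord_recr /=; set S := (\sum_(_ < N) _)%N in IH *.
case/andP: IH => /andP[h1 h2] h3; case: (ltnP (N * s) t) => h /=.
  move: h1; rewrite (minn_idPr (ltnW h)) => h1; rewrite addn1 ltnS h3 andbT mulSn mulSn.
  have h4 : (S * s <= N * s)%N by rewrite leq_mul2r h3 orbT.
  apply/andP; split; last by lia.
  by rewrite geq_min; apply/orP; right; lia.
move: h1; rewrite addn0 (minn_idPl h) => h1.
rewrite (minn_idPl (leq_trans h _)); last by rewrite leq_mul2r leqnSn orbT.
by rewrite h1 h2 /= ltnW // ltnS.
Qed.

Lemma card_prod_pred (I J : finType) (P : I -> pred J) :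
  #|[pred x : I * J | P x.1 x.2]| = (\sum_i \sum_j P i j)%N.
Proof.
rewrite -sum1_card (eq_bigr (fun i => \sum_(j | P i j) 1)%N) => [|i _]; last first.
  by rewrite [RHS]big_mkcond; apply: eq_bigr => j _; case: (P i j).
by rewrite pair_big_dep.
Qed.

Lemma absz_floor_le (x : rat) (n : nat) : x \is a Num.int -> `|x| <= n%:R ->
  (`|Num.floor x| <= n)%N.
Proof. by move=> /floorK ex; rewrite -{1}ex -intr_norm -(ler_nat rat) natr_absz. Qed.

(** Siegel's lemma for the coefficients of all [A i] and [B i]. With [Psi(T) = \sum_i (T - e i)]
    there are at least [2 Psi(T) / s] unknowns and at most [Psi(T') / s + l] equations. Since
    [Psi(T') <= 3/2 Psi(T)] and [10 l s <= T <= Psi(T)], the ratio is at most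
    [(3/2 + 1/10) / 2 = 4/5]. *)
Lemma auxiliary_pair (l p s T T' kap g x0 hF Dn : nat) (e : 'I_l -> nat) (ga : 'M[rat]_l)
    (h : {poly rat}) :
  (0 < p)%N -> (0 < s)%N -> (T <= T')%N -> (exists i, e i = 0%N) ->
  (forall b, (b <= T' %/ s)%N -> p%:R ^+ (2 * b) * h`_b \is a Num.int) ->
  (forall b, `|h`_b| <= 2 ^+ ((kap + 2) * b).+1) ->
  (0 < Dn)%N -> (forall i j, Dn%:R * ga i j \is a Num.int) ->
  (forall i j, `|ga i j| <= 2 ^+ g) ->
  (p ^ (2 * (T' %/ s)) * Dn * 2 ^ g <= 2 ^ x0)%N ->
  (p ^ (2 * (T' %/ s)) * Dn * 2 ^ ((kap + 2) * (T' %/ s)).+1 <= 2 ^ x0)%N ->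
  ((2 * (l * T.+1) * 2 ^ x0) ^ 4 <= 2 ^ hF)%N ->
  (2 * \sum_i (T' - e i) <= 3 * \sum_i (T - e i))%N ->
  (10 * (l * s) <= T)%N -> (0 < T)%N ->
  exists A B : 'I_l -> {poly rat}, [/\ (exists i, A i != 0 \/ B i != 0),
     forall i, pint (A i) /\ pint (B i),
     forall i a, (A i)`_a != 0 \/ (B i)`_a != 0 -> (a * s + e i <= T)%N,
     forall i a, `|(A i)`_a| <= 2 ^+ hF /\ `|(B i)`_a| <= 2 ^+ hF &
     forall j b, (b * s + e j < T')%N -> (\sum_i ga i j *: A i + B j * h)`_b = 0].
Proof.
move=> p0 s0 TT [i0 ei0] hint hbd Dn0 gaint gabd x0a x0b hFb grow lsT T0.
set B1 := (T' %/ s)%N in hint x0a x0b.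
pose I := (bool * 'I_l * 'I_T.+1)%type; pose J := ('I_l * 'I_T')%type.
pose P (x : I) := (x.2 * s < T.+1 - e x.1.2)%N.
pose Q (x : J) := (x.2 * s < T' - e x.1)%N.
pose ent (j : 'I_l) (b : nat) (be : bool) (i : 'I_l) (a : nat) : rat :=
  if be then (if (i == j) && (a <= b)%N then h`_(b - a) else 0)
  else (if a == b then ga i j else 0).
pose c0 : rat := p%:R ^+ (2 * B1) * Dn%:R.
have c00 : 0 <= c0 by rewrite mulr_ge0 ?exprn_ge0 ?ler0n.
have entint j b be i a : (b <= B1)%N -> c0 * ent j b be i a \is a Num.int.
  move=> le; rewrite /ent; case: be; case: ifP => // hh; rewrite ?mulr0 //.
    have le2 : (b - a <= B1)%N by rewrite (leq_trans (leq_subr _ _)).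
    have -> : c0 * h`_(b - a) = Dn%:R * p%:R ^+ (2 * (B1 - (b - a))) *
        (p%:R ^+ (2 * (b - a)) * h`_(b - a)).
      rewrite /c0; have -> : (2 * B1 = 2 * (B1 - (b - a)) + 2 * (b - a))%N by rewrite -mulnDr subnK.
      by rewrite exprD; ring.
    by apply: rpredM; [rewrite rpredM ?rpredX ?rpred_nat | exact: hint].
  by rewrite /c0 -mulrA; apply: rpredM; [rewrite rpredX ?rpred_nat | exact: gaint].
have entbd j b be i a : (b <= B1)%N -> `|c0 * ent j b be i a| <= (2 ^ x0)%:R.
  move=> le; rewrite normrM (ger0_norm c00) /ent; case: be; case: ifP => // hh;
    rewrite ?normr0 ?mulr0 ?ler0n //.
    apply: le_trans (_ : (p ^ (2 * B1) * Dn * 2 ^ ((kap + 2) * B1).+1)%:R <= _); last by rewrite ler_nat.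
    rewrite !natrM !natrX /c0; apply: ler_wpM2l => //; apply: le_trans (hbd _) _.
    rewrite ler_weXn2l ?ler1n // ltnS leq_mul2l; apply/orP; right.
    by rewrite (leq_trans (leq_subr _ _)).
  apply: le_trans (_ : (p ^ (2 * B1) * Dn * 2 ^ g)%:R <= _); last by rewrite ler_nat.
  by rewrite !natrM !natrX /c0; apply: ler_wpM2l.
have QB (x : J) : Q x -> (x.2 <= B1)%N.
  by rewrite /Q /B1 => hq; rewrite leq_divRL // ltnW // (leq_trans hq) // leq_subr.
pose am (x : J) (z : I) : int := if Q x then Num.floor (c0 * ent x.1 x.2 z.1.1 z.1.2 z.2) else 0.
have cardP : #|P| = (2 * \sum_(i < l) \sum_(a < T.+1) (a * s < T.+1 - e i)%N)%N.
  rewrite (card_prod_pred (fun bi : bool * 'I_l => fun a : 'I_T.+1 => (a * s < T.+1 - e bi.2)%N)).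
  rewrite -(pair_bigA _ (fun (b : bool) (i : 'I_l) => \sum_(a < T.+1) (a * s < T.+1 - e i)%N)%N) /=.
  by rewrite big_bool /= mul2n addnn.
have cardQ : #|Q| = (\sum_(j < l) \sum_(b < T') (b * s < T' - e j)%N)%N.
  exact: (card_prod_pred (fun j : 'I_l => fun b : 'I_T' => (b * s < T' - e j)%N)).
have loP : (2 * \sum_i (T - e i) <= #|P| * s)%N.
  rewrite cardP -mulnA leq_mul2l /= big_distrl /=; apply: leq_sum => i _.
  have /andP[/andP[h1 _] _] := count_mult T.+1 s (T.+1 - e i); apply: leq_trans h1.
  rewrite leq_min; apply/andP; split; first by apply: leq_sub2r.
  apply: leq_trans (leq_subr _ _) _; apply: leq_trans (leqnSn _) _.
  by rewrite leq_pmulr.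
have upQ : (#|Q| * s <= \sum_i (T' - e i) + l * s)%N.
  rewrite cardQ big_distrl /=.
  have -> : (l * s = \sum_(i < l) s)%N by rewrite sum_nat_const card_ord.
  rewrite -big_split /=; apply: leq_sum => i _.
  by have /andP[/andP[_ h1] _] := count_mult T' s (T' - e i).
have upP : (#|P| <= 2 * (l * T.+1))%N.
  by apply: leq_trans (max_card _) _; rewrite !card_prod card_bool !card_ord mulnA.
have PsiT : (T <= \sum_i (T - e i))%N by rewrite (bigD1 i0) //= ei0 subn0 leq_addr.
have P0 : (0 < #|P|)%N.
  by rewrite lt0n; apply: contraTneq loP => ->; rewrite mul0n -ltnNge muln_gt0 /= (leq_trans T0).
have QP : (5 * #|Q| <= 4 * #|P|)%N.
  rewrite -(leq_pmul2r s0); move: loP upQ grow lsT PsiT.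
  rewrite -!mulnA; set X := (\sum_i (T - _))%N; set X' := (\sum_i (T' - _))%N.
  set u := (#|P| * s)%N; set v := (#|Q| * s)%N; set w := (l * s)%N; clear; lia.
have ambd x z : (`|am x z| <= 2 ^ x0)%N.
  rewrite /am; case: ifP => // Qx; apply: absz_floor_le; [apply: entint | apply: entbd]; exact: QB.
have x00 : (0 < 2 ^ x0)%N by rewrite expn_gt0.
have [x [xn0 xsupp xbd xrel]] := siegel P0 x00 QP ambd.
pose pol be i : {poly rat} := \poly_(a < T.+1) (x (be, i, inord a))%:~R.
have coefpol be i a (lt : (a < T.+1)%N) : (pol be i)`_a = (x (be, i, Ordinal lt))%:~R.
  by rewrite coef_poly lt; congr ((x (_, _))%:~R); apply: val_inj; rewrite /= inordK.
have coefbig be i a : (T < a)%N -> (pol be i)`_a = 0.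
  by move=> h1; rewrite coef_poly ltnS leqNgt h1.
have pbd be i a : `|(pol be i)`_a| <= 2 ^+ hF.
  have [lt|lt] := ltnP a T.+1; last by rewrite coefbig // normr0 exprn_ge0.
  rewrite (coefpol _ _ _ lt) -intr_norm -natr_absz -natrX ler_nat.
  apply: leq_trans (xbd _) _; apply: leq_trans hFb; rewrite leq_exp2r // leq_mul2r upP orbT //.
have psupp be i a : (pol be i)`_a != 0 -> (a * s + e i <= T)%N.
  have [lt|lt] := ltnP a T.+1; last by rewrite coefbig // eqxx.
  rewrite (coefpol _ _ _ lt) intr_eq0; apply: contraNT => nle; apply/eqP/xsupp.
  by rewrite /P /= -leqNgt leq_subLR addnC; move: nle; rewrite -ltnNge.
have pint_pol be i : pint (pol be i).
  move=> a; have [lt|lt] := ltnP a T.+1; last by rewrite coefbig.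
  by rewrite (coefpol _ _ _ lt) intr_int.
exists (pol false), (pol true); split.
- have [[[be i] a] xa] := xn0; exists i.
  have nz : pol be i != 0.
    apply/eqP => /(congr1 (fun R : {poly rat} => R`_a)).
    rewrite coef0 (coefpol _ _ _ (ltn_ord a)) => /eqP; rewrite intr_eq0.
    by rewrite (_ : Ordinal _ = a) ?(negPf xa) //; apply: val_inj.
  by case: be nz {xa}; [right | left].
- by move=> i; split.
- by move=> i a [] /psupp.
- by move=> i a; split.
move=> j b lt; have b_lt : (b < T')%N.
  by apply: leq_ltn_trans lt; apply: leq_trans (leq_addr _ _); rewrite leq_pmulr.
have Qjb : Q (j, Ordinal b_lt) by rewrite /Q /= ltn_subRL addnC.
have := congr1 (fun z : int => z%:~R : rat) (xrel _ Qjb).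
rewrite rmorph_sum /= => rel.
have c0n : c0 != 0 by rewrite mulf_neq0 ?expf_neq0 // pnatr_eq0 -lt0n.
apply: (mulfI c0n); rewrite mulr0 -[RHS]rel.
have full : \sum_(i | P i) (am (j, Ordinal b_lt) i * x i)%:~R =
    \sum_be \sum_i \sum_(a < T.+1) c0 * ent j b be i a * (x (be, i, a))%:~R :> rat.
  rewrite (pair_bigA _ (fun be i => \sum_(a < T.+1) c0 * ent j b be i a * (x (be, i, a))%:~R)) /=.
  rewrite (pair_bigA _ (fun (bi : bool * 'I_l) (a : 'I_T.+1) => c0 * ent j b bi.1 bi.2 a * (x (bi.1, bi.2, a))%:~R)) /=.
  rewrite [RHS](bigID P) /= [X in _ = _ + X]big1 ?addr0; last first.
    by move=> [[be i] a] /= nP; rewrite xsupp ?mulr0.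
  apply: eq_bigr => [[[be i] a]] _ /=; rewrite /am Qjb /= rmorphM /= floorK //.
  by apply: entint; exact: (QB _ Qjb).
rewrite full big_bool /= addrC coefD coef_sum mulrDr; congr (_ + _).
  rewrite mulr_sumr; apply: eq_bigr => i _; rewrite coefZ /ent.
  have [lb|lb] := ltnP b T.+1.
    rewrite (bigD1 (Ordinal lb)) //= eqxx (coefpol _ _ _ lb) big1 ?addr0 ?mulrA // => a na.
    case: eqP => [ab|]; last by rewrite mulr0 mul0r.
    by case/eqP: na; apply: val_inj.
  rewrite coefbig // !mulr0 big1 // => a _; case: eqP => [ab|]; last by rewrite mulr0 mul0r.
  by have := ltn_ord a; rewrite ab ltnS leqNgt lb.
rewrite (bigD1 j) //= [X in _ = _ + X]big1 ?addr0 => [|i ni]; last first.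
  by rewrite big1 // => a _; rewrite /ent (negPf ni) /= mulr0 mul0r.
have wide : (pol true j * h)`_b = \sum_(a < T.+1) (if (a <= b)%N then (pol true j)`_a * h`_(b - a) else 0).
  rewrite coefM -big_mkcond /=.
  rewrite (bigID (fun a : 'I_b.+1 => (a < T.+1)%N)) /= [X in _ + X]big1 ?addr0; last first.
    by move=> a; rewrite -leqNgt => ha; rewrite coefbig ?mul0r.
  rewrite (big_ord_widen_cond (maxn b.+1 T.+1) (fun a => a < T.+1)%N (fun a => (pol true j)`_a * h`_(b - a))) ?leq_maxl //.
  rewrite (big_ord_widen_cond (maxn b.+1 T.+1) (fun a => a <= b)%N (fun a => (pol true j)`_a * h`_(b - a))) ?leq_maxr //.
  by apply: eq_bigl => a; rewrite andbC ltnS.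
rewrite wide mulr_sumr; apply: eq_bigr => a _; rewrite /ent eqxx /=.
rewrite (coefpol _ _ _ (ltn_ord a)) (_ : Ordinal _ = a); last exact: val_inj.
by case: ifP => _; [ring | rewrite !mulr0 mul0r].
Qed.

(** The nonzero term with the least exponent outweighs all the others together: coefficients below
    [2^hF] cannot cancel across gaps of length [hF + l + 1]. *)
Lemma gap_zero (l hF : nat) (e : 'I_l -> nat) (c : 'I_l -> rat) :
  (forall i j, e i = e j -> i = j) ->
  (forall i j, (e i < e j)%N -> (hF + l + 1 <= e j - e i)%N) ->
  (forall i, c i \is a Num.int) -> (forall i, `|c i| <= 2 ^+ hF) ->
  \sum_i hf ^+ e i * c i = 0 -> forall i, c i = 0.
Proof.
move=> einj gap cint cbd rel i0; apply/eqP/negPn/negP => ci0.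
case: (@arg_minnP _ i0 (fun i => c i != 0) e ci0) => i ci mini.
have h1 : hf ^+ e i <= `|hf ^+ e i * c i|.
  by rewrite normrM ger0_norm ?hf_ge0 // ler_peMr ?hf_ge0 // norm_intr_ge1.
have : `|hf ^+ e i * c i| <= \sum_(j < l) hf ^+ e i * hf ^+ l.+1.
  move: rel; rewrite (bigD1 i) //= => /eqP; rewrite addr_eq0 => /eqP->.
  rewrite normrN; apply: le_trans (ler_norm_sum _ _ _) _.
  rewrite [leRHS](bigD1 i) //= -[leLHS]add0r; apply: lerD; first by rewrite mulr_ge0 ?hf_ge0.
  apply: ler_sum => j ji; rewrite normrM ger0_norm ?hf_ge0 //.
  have [->|cj] := eqVneq (c j) 0; first by rewrite normr0 mulr0 mulr_ge0 ?hf_ge0.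
  have lt : (e i < e j)%N.
    by rewrite ltn_neqAle mini // andbT; apply: contra ji => /eqP/einj->.
  have h := gap _ _ lt; apply: (@le_trans _ _ (hf ^+ (e i + (hF + l.+1)) * 2 ^+ hF)).
    by apply: ler_pM; rewrite ?hf_ge0 ?normr_ge0 ?cbd // hf_mono //; lia.
  rewrite !exprD -!mulrA ler_wpM2l ?hf_ge0 // [_ * 2 ^+ hF]mulrC mulrA.
  by rewrite [hf ^+ hF * _]mulrC hf2 mul1r.
rewrite sumr_const card_ord -mulrnAr => h2; have := le_trans h1 h2; apply/negP; rewrite -ltNge.
rewrite -[ltRHS]mulr1 ltr_pM2l ?hf_gt0 // -[ltRHS](hf2 l.+1) -mulr_natl ltr_pM2r ?hf_gt0 //.
by rewrite -natrX ltr_nat; apply: ltn_trans (ltnSn l) (ltn_expl _ _).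
Qed.

Lemma fact_le_pow2 t : (t`! <= 2 ^ (t * t))%N.
Proof.
apply: (@leq_trans (t ^ t)).
  elim: t => // t IH; rewrite factS expnS leq_mul2l; apply/orP; right.
  apply: leq_trans IH _; case: t => // t; by rewrite leq_exp2r.
rewrite expnM; case: t => // t; rewrite leq_exp2r //; apply: ltnW; exact: ltn_expl.
Qed.

(* [w1] and [w2] are the [p]-th roots given by the two solutions, [X] approximates [w2] up to a factor [2^(r/p)],
   and [u] is the expansion at [y = 2^-s] of the [p]-th root of [2^r f].  The polynomial [S] below vanishes to
   a high order by the relations on [A] and [B], and the Wronskian gives a nonzero low coefficient of it,
   which is too small for its denominator. *)
Section Contradiction.
Variables (f : {poly rat}) (p a kap s r : nat) (w1 : rat) (q1 : nat).
Variables (l : nat) (e : 'I_l -> nat) (ga : 'M[rat]_l) (T T' g g3 hF xB xd V : nat).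
Variables (w2 X : rat) (q2 : nat) (A B : 'I_l -> {poly rat}).
Let th := w2 / X.
Let M := T'.
Let y := hf ^+ s.
Let phi := f.[y].
Let B1 := (T' %/ s)%N.
Let sh P := P \Po ('X + y%:P).
Let h := hpol f p M.
Let u := upol f p s M w1.
Let K := kpol f p s M th.
Hypothesis p0 : (0 < p)%N.
Hypothesis a0 : (0 < a)%N.
Hypothesis T'0 : (0 < T')%N.
Hypothesis TT' : (T < T')%N.
Hypothesis fint : pint f.
Hypothesis f0 : f`_0 = 1.
Hypothesis fk : forall c : nat, `|f`_c| <= 2 ^+ (kap * c).
Hypothesis sf : (size f <= a.+1)%N.
Hypothesis sk : (kap + p + 9 <= s)%N.
Hypothesis npow : forall z Q, f <> z *: Q ^+ p.
Hypothesis phi1 : 1 <= phi.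
Hypothesis w10 : 0 < w1.
Hypothesis w1p : w1 ^+ p = 2 ^+ r * phi.
Hypothesis w1q : 2 ^+ q1 * w1 \is a Num.int.
Hypothesis w20 : 0 < w2.
Hypothesis w2q : 2 ^+ q2 * w2 \is a Num.int.
Hypothesis X0 : 0 < X.
Hypothesis eta1 : `|2 ^+ r - th ^+ p| <= 1.
Hypothesis eta2 : `|2 ^+ r - th ^+ p| <= 2 ^+ g3 * hf ^+ T'.
Hypothesis einj : forall i j, e i = e j -> i = j.
Hypothesis gap : forall i j, (e i < e j)%N -> (hF + l + 1 <= e j - e i)%N.
Hypothesis gabd : forall i j, `|ga i j| <= 2 ^+ g.
Hypothesis err : forall i, (e i <= T)%N ->
  `|X * hf ^+ e i - \sum_(j | (e j < T')%N) ga i j * hf ^+ e j| <= 2 ^+ g3 * hf ^+ T'.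
Hypothesis ABnz : exists i, A i != 0 \/ B i != 0.
Hypothesis ABint : forall i, pint (A i) /\ pint (B i).
Hypothesis ABsupp : forall i b, (A i)`_b != 0 \/ (B i)`_b != 0 -> (b * s + e i <= T)%N.
Hypothesis ABbd : forall i b, `|(A i)`_b| <= 2 ^+ hF /\ `|(B i)`_b| <= 2 ^+ hF.
Hypothesis ABrel : forall j b, (b * s + e j < T')%N -> (\sum_i ga i j *: A i + B j * h)`_b = 0.
Hypothesis xBP : (B1.+1 <= 2 ^ xB)%N.
Hypothesis xdP : (p * (B1 + 2 * l * a) + a)%:R * nrm 1 f <= 2 ^+ xd.
Hypothesis VP : (2 * l * (2 * l + 2 * l * xd + hF + xB) < s * (V - 2 * l))%N.
Hypothesis VM : (V <= T')%N.

Let P0 := \sum_i hf ^+ e i *: A i.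
Let P1 := \sum_i hf ^+ e i *: B i.
Let S := sh P0 * w2%:P + sh P1 * u.

Let s0 : (0 < s)%N. Proof. by apply: leq_trans sk; rewrite addn_gt0 orbT. Qed.
Let y0 : 0 <= y. Proof. exact: hf_ge0. Qed.
Let th0 : 0 < th. Proof. by rewrite divr_gt0. Qed.

Let sizeAB i : (size (A i) <= B1.+1)%N /\ (size (B i) <= B1.+1)%N.
Proof.
have bound b : (b * s + e i <= T)%N -> (b < B1.+1)%N.
  move=> hb; rewrite ltnS /B1 leq_divRL //; apply: leq_trans (ltnW TT').
  by apply: leq_trans hb; rewrite leq_addr.
split; apply/leq_sizeP => b hb; apply/eqP/negPn/negP => nz.
  by have := bound b (ABsupp (or_introl nz)); rewrite ltnNge hb.
by have := bound b (ABsupp (or_intror nz)); rewrite ltnNge hb.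
Qed.

Let nrmAB i : nrm 1 (A i) <= 2 ^+ (hF + xB) /\ nrm 1 (B i) <= 2 ^+ (hF + xB).
Proof.
have key (P : {poly rat}) : (size P <= B1.+1)%N -> (forall b, `|P`_b| <= 2 ^+ hF) ->
    nrm 1 P <= 2 ^+ (hF + xB).
  move=> sP bP; rewrite (nrm_wide _ sP) exprD.
  apply: (@le_trans _ _ (\sum_(i < B1.+1) 2 ^+ hF)).
    by apply: ler_sum => b _; rewrite expr1n mulr1.
  rewrite sumr_const card_ord -(mulr_natr (2 ^+ hF)) ler_wpM2l ?exprn_ge0 //.
  by rewrite -natrX ler_nat.
by have [s1 s2] := sizeAB i; split; apply: key => // b; have [] := ABbd i b.
Qed.

Let P01nz : P0 != 0 \/ P1 != 0.
Proof.
have key (F : 'I_l -> {poly rat}) : (forall i, pint (F i)) -> (forall i b, `|(F i)`_b| <= 2 ^+ hF) ->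
    \sum_i hf ^+ e i *: F i = 0 -> forall i, F i = 0.
  move=> Fint Fbd rel i; apply/polyP => b; rewrite coef0.
  apply: (gap_zero einj gap (fun i => Fint i b) (fun i => Fbd i b)).
  have := congr1 (fun R : {poly rat} => R`_b) rel; rewrite coef0 coef_sum => h1.
  by rewrite -[RHS]h1; apply: eq_bigr => k _; rewrite coefZ.
have [z|] := eqVneq P0 0; last by left.
have [z1|] := eqVneq P1 0; last by right.
have [i [nz|nz]] := ABnz; exfalso; move/eqP: nz; apply.
  by apply: key z i => [k|k b]; [have [] := ABint k | have [] := ABbd k b].
by apply: key z1 i => [k|k b]; [have [] := ABint k | have [] := ABbd k b].
Qed.

Let hfs : (2 ^ s)%:R^-1 = y :> rat. Proof. by rewrite natrX /y exprVn. Qed.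

(** Otherwise the Wronskian of an independent subfamily of the [A i] and [B i] is a nonzero integral
    polynomial with a zero of order [V - t] at [2^-s], and by [VP] its height is too small for
    [vanish_height]. *)
Lemma some_coef : exists2 v, (v < V)%N & S`_v != 0.
Proof.
have [[v hv]|nv] := boolp.pselect (exists v : 'I_V, S`_v != 0); first by exists v.
exfalso; have vS : vanish V S.
  by move=> v hv; apply/eqP/negPn/negP => nz; apply: nv; exists (Ordinal hv).
pose G (k : bool * 'I_l) := if k.1 then B k.2 else A k.2.
have [t [gk [mu [lt indep eqs]]]] := independent_subfamily G fst (fun k => hf ^+ e k.2).
have Pb b : \sum_(k : bool * 'I_l | k.1 == b) hf ^+ e k.2 *: G k = if b then P1 else P0.
  rewrite (eq_bigl (fun k : bool * 'I_l => (k.1 == b) && true)); last by move=> k; rewrite andbT.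
  rewrite -(pair_big (fun be => be == b) xpredT (fun be i => hf ^+ e i *: G (be, i))) /=.
  by rewrite big_pred1_eq /G /=; case: b.
have tl : (t <= 2 * l)%N by rewrite card_prod card_bool card_ord in lt.
have mu0 : exists k, mu k != 0.
  have [//|nm] := boolp.pselect (exists k, mu k != 0); exfalso.
  have z b : (if b then P1 else P0) = 0.
    rewrite -Pb eqs big1 // => k _; have [->|nk] := eqVneq (mu k) 0; first by rewrite scale0r.
    by case: nm; exists k.
  by case: P01nz; rewrite ?(z true) ?(z false) ?eqxx.
pose j k := (gk k).1; pose Gk k := G (gk k).
have u0 : (u`_0) != 0 by rewrite upol0 // gt_eqF.
have ode : vanish M (p%:R *: (sh f * u^`()) - sh f^`() * u) by apply: upol_ode.
have eS : \sum_k mu k *: (sh (Gk k) * (if j k then u else w2%:P)) = S.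
  rewrite (bigID (fun k => j k)) /= addrC /S.
  have ef := eqs false; have et := eqs true; rewrite !Pb in ef et.
  rewrite ef et /sh !raddf_sum !mulr_suml /=; congr (_ + _).
    apply: eq_big => k; first by rewrite eqbF_neg.
    by move=> /negPf jk; rewrite jk comp_polyZ scalerAl.
  apply: eq_big => k; first by rewrite eqb_id.
  by move=> jk; rewrite jk comp_polyZ scalerAl.
have vW := @wronskian_vanish f p y w2 u t Gk j mu V M u0 (lt0r_neq0 w20) mu0 VM ode.
rewrite eS in vW; have {}vW := vW vS.
set W := \det _ in vW.
have W0 : W != 0 by apply: wronskian_neq0.
have Wint : pint W.
  apply: pint_det => k v; rewrite mxE; elim: (v : nat) => [|v' IH].
    by rewrite /= /Gk /G; case: ifP => _; have [] := ABint (gk k).2.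
  by rewrite iterS; apply: pint_delta.
have pw0 : (0 < 2 ^ s)%N by rewrite expn_gt0.
have := @vanish_height (2 ^ s) (V - t) W pw0 Wint W0; rewrite hfs => /(_ vW); apply/negP.
rewrite -ltNge.
have nf1 : 1 <= nrm 1 f.
  by have := nrm_coef f 0 ler01; rewrite f0 normr1 mul1r expr1n.
have base1 : 1 <= (p * (B1 + t * a) + a)%:R * nrm 1 f.
  by rewrite mulr_ege1 // ler1n addn_gt0 a0 orbT.
have := @nrm_wronskian f p a B1 t Gk j (2 ^+ (hF + xB)) sf _ _ base1.
have h1 k : (size (Gk k) <= B1.+1)%N by rewrite /Gk /G; case: ifP => _; have [] := sizeAB (gk k).2.
have h2 k : nrm 1 (Gk k) <= 2 ^+ (hF + xB) by rewrite /Gk /G; case: ifP => _; have [] := nrmAB (gk k).2.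
move=> /(_ h1 h2) nW; apply: le_lt_trans nW _.
have baseX : (p * (B1 + t * a) + a)%:R * nrm 1 f <= 2 ^+ xd.
  apply: le_trans xdP; apply: ler_wpM2r; first exact: nrm_ge0.
  by rewrite ler_nat leq_add2r leq_mul2l leq_add2l leq_mul2r tl !orbT.
apply: (@le_lt_trans _ _ (2 ^+ (t * t + (xd * t + (hF + xB)) * t))).
  rewrite (exprD _ (t * t)); apply: ler_pM; rewrite ?ler0n ?exprn_ge0 ?mulr_ge0 ?exprn_ge0 ?mulr_ge0 ?nrm_ge0 ?ler0n //.
    by rewrite -natrX ler_nat fact_le_pow2.
  rewrite exprM; apply: lerXn2r; rewrite ?nnegrE ?mulr_ge0 ?exprn_ge0 ?mulr_ge0 ?nrm_ge0 ?ler0n //.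
  rewrite (exprD _ (xd * t)) ler_wpM2r ?exprn_ge0 ?ler0n // exprM lerXn2r // ?nnegrE ?exprn_ge0 ?ler0n //.
  by rewrite mulr_ge0 ?nrm_ge0.
rewrite natrX -exprM ltr_eXn2l ?ltr1n //; apply: leq_ltn_trans (leq_trans VP _).
  have -> : (t * t + (xd * t + (hF + xB)) * t = t * (t + t * xd + hF + xB))%N by clear; lia.
  by rewrite leq_mul // !leq_add // leq_mul2r tl orbT.
by rewrite leq_mul2l leq_sub2l ?orbT.
Qed.

Let Rphi : 2 ^+ (s * a) * phi \is a Num.int.
Proof.
have := @shift_int s (s * a) f fint _ 0%N; rewrite coefZ -[(f \Po _)`_0]horner_coef0 horner_comp.
rewrite hornerD hornerX hornerC add0r; apply => i nz.
rewrite mulnC leq_mul2l; apply/orP; right.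
by rewrite -ltnS; apply: leq_trans sf; rewrite ltnNge; apply: contra nz => hh; rewrite nth_default.
Qed.

Let int_sh (F : 'I_l -> {poly rat}) v : (forall i, pint (F i)) ->
  (forall i b, (F i)`_b != 0 -> (b * s + e i <= T)%N) ->
  2 ^+ T * (sh (\sum_i hf ^+ e i *: F i))`_v \is a Num.int.
Proof.
move=> Fint Fs; rewrite /sh raddf_sum coef_sum mulr_sumr rpred_sum // => i _.
rewrite /= comp_polyZ coefZ mulrA.
have [->|nz] := eqVneq (F i) 0; first by rewrite comp_poly0 coef0 mulr0.
have le : (e i <= T)%N.
  have := Fs i (size (F i)).-1; rewrite -lead_coefE lead_coef_eq0 nz => /(_ isT).
  by apply: leq_trans; rewrite leq_addl.
have -> : 2 ^+ T * hf ^+ e i = 2 ^+ (T - e i).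
  by rewrite -{1}(subnK le) exprD -mulrA hf2 mulr1.
rewrite -coefZ.
by apply: shift_int => // b /Fs hb; rewrite leq_subRL // addnC.
Qed.

(** [2^T] clears the shifted [P0] and [P1], [2^q2] clears [w2], and the remaining factors are those
    of [upol_int]. *)
Lemma coef_lower v : (v <= T')%N ->
  2 ^+ (T + q1 + q2) * (p%:R ^+ (2 * v) * ((2 ^+ (s * a) * phi) ^+ v * S`_v)) \is a Num.int.
Proof.
move=> le; rewrite /S coefD coefMC mulrDr !mulrDr.
have RZ := Rphi; set R := 2 ^+ (s * a) * phi in RZ *; apply: rpredD.
  have -> : 2 ^+ (T + q1 + q2) * (p%:R ^+ (2 * v) * (R ^+ v * ((sh P0)`_v * w2))) =
    (2 ^+ T * (sh P0)`_v) * (2 ^+ q2 * w2) * (2 ^+ q1 * p%:R ^+ (2 * v) * R ^+ v).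
    by rewrite !exprD; ring.
  apply: rpredM; last by rewrite !rpredM ?rpredX ?rpred_nat.
  apply: rpredM; last exact: w2q.
  by apply: int_sh => [i|i b nz]; [have [] := ABint i | apply: ABsupp; left].
rewrite coefM !mulr_sumr; apply: rpred_sum => i _.
have lei : (v - i <= v)%N by apply: leq_subr.
have e1 : p%:R ^+ (2 * v) = p%:R ^+ (2 * i) * p%:R ^+ (2 * (v - i)) :> rat.
  by rewrite -exprD -mulnDr subnKC // -ltnS.
have e2 : R ^+ v = R ^+ i * R ^+ (v - i) by rewrite -exprD subnKC // -ltnS.
have -> : 2 ^+ (T + q1 + q2) * (p%:R ^+ (2 * v) * (R ^+ v * ((sh P1)`_i * u`_(v - i)))) =
   (2 ^+ T * (sh P1)`_i) * (2 ^+ q1 * (p%:R ^+ (2 * (v - i)) * (R ^+ (v - i) * u`_(v - i)))) *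
   (2 ^+ q2 * p%:R ^+ (2 * i) * R ^+ i).
  by rewrite e1 e2 !exprD; ring.
apply: rpredM; last by rewrite !rpredM ?rpredX ?rpred_nat.
apply: rpredM.
  by apply: int_sh => [k|k b nz]; [have [] := ABint k | apply: ABsupp; right].
apply: upol_int => //; exact: leq_trans lei le.
Qed.

Let th_le : th <= 2 ^+ r.+1.
Proof.
have h1 : (1 : rat) <= 2 ^+ r by apply: exprn_ege1; rewrite ler1n.
have [le|lt] := lerP th 1; first by apply: le_trans le _; apply: exprn_ege1; rewrite ler1n.
have h2 : th <= th ^+ p by rewrite -[leLHS]expr1 ler_weXn2l // ltW.
have h3 := ler_norm (th ^+ p - 2 ^+ r); rewrite distrC in h3.
by rewrite exprS; have := eta1; lra.
Qed.

Let rho := hf ^+ (kap + 2).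
Let E1 := 2 ^+ (hF + xB) : rat.
Let E10 : 0 <= E1. Proof. by rewrite exprn_ge0. Qed.
Let rho1 : rho <= 1. Proof. exact: hf_le1. Qed.
Let rho0 : 0 <= rho. Proof. exact: hf_ge0. Qed.
Let y2 : 0 <= 2 * y. Proof. by rewrite mulr_ge0. Qed.
Let y2rho : 2 * y <= rho. Proof. exact: (y2_rho sk). Qed.

Let nrm_sh Q : nrm y (sh Q) <= nrm (2 * y) Q.
Proof. by apply: le_trans (nrm_shift _ y0 y0) _; rewrite [2 * y]mulr_natl mulr2n. Qed.

Let Xi j := \sum_i ga i j *: A i + B j * h.

Let nrm_Xi j : nrm rho (Xi j) <= (l%:R * 2 ^+ g + 2) * E1.
Proof.
have [nA nB] : (forall i, nrm rho (A i) <= E1) /\ (forall i, nrm rho (B i) <= E1).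
  split=> i; have [n1 n2] := nrmAB i; apply: le_trans (nrm_mono _ rho0 rho1) _ => //.
apply: le_trans (nrmD _ _ rho0) _; rewrite mulrDl; apply: lerD.
  apply: le_trans (nrm_sum _ _ _ rho0) _.
  apply: (@le_trans _ _ (\sum_(i < l) 2 ^+ g * E1)).
    by apply: ler_sum => i _; rewrite nrmZ ler_pM // nrm_ge0.
  by rewrite sumr_const card_ord -mulrA -[leLHS]mulr_natl.
apply: le_trans (nrmM _ _ rho0) _; rewrite mulrC ler_pM ?nrm_ge0 //.
exact: nrm_hpol.
Qed.

(** The relations make [Xi j] vanish to order at least [(T' - e j) / s] at the origin. Shrinking the
    radius to [2 * y] turns this into the factor [2^-(T' - e j)], with a loss controlled by the
    number of coefficients, about [T' / s]. *)
Let nrm_Xi_y j : (e j < T')%N -> hf ^+ e j * nrm (2 * y) (Xi j) <=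
  hf ^+ T' * (2 ^+ ((kap + 3) * B1.+1) * ((l%:R * 2 ^+ g + 2) * E1)).
Proof.
move=> lt; pose b0 := ((T' - e j + s.-1) %/ s)%N.
have b0P : (T' - e j <= b0 * s)%N.
  by have := ltn_ceil (T' - e j + s.-1) s0; rewrite -/b0 mulSn; move: s0; clear; lia.
have b0B : (b0 <= B1.+1)%N.
  have -> : (B1.+1 = (1 * s + T') %/ s)%N by rewrite divnMDl.
  by apply: leq_div2r; move: s0; clear; lia.
have van : vanish b0 (Xi j).
  move=> b hb; apply: ABrel; have : (b.+1 * s <= b0 * s)%N by rewrite leq_mul2r hb orbT.
  rewrite mulSn; have : (b0 * s <= T' - e j + s.-1)%N by apply: leq_trunc_div.
  by move: s0; clear; lia.
apply: (@le_trans _ _ (hf ^+ e j * ((2 * y / rho) ^+ b0 * nrm rho (Xi j)))).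
  by rewrite ler_wpM2l ?hf_ge0 // nrm_shrink ?hf_gt0.
rewrite (y2E sk) exprMn -exprM -[y ^+ b0]exprM !mulrA.
have -> : hf ^+ e j * 2 ^+ ((kap + 3) * b0) * hf ^+ (s * b0) * nrm rho (Xi j) =
   (hf ^+ e j * hf ^+ (s * b0)) * (2 ^+ ((kap + 3) * b0) * nrm rho (Xi j)) by ring.
rewrite -!mulrA [hf ^+ e j * _]mulrA; apply: ler_pM; rewrite ?mulr_ge0 ?hf_ge0 ?exprn_ge0 ?nrm_ge0 //.
  by rewrite -exprD hf_mono //; move: lt b0P; rewrite mulnC; clear; lia.
apply: ler_pM; rewrite ?exprn_ge0 ?nrm_ge0 //.
by rewrite ler_weXn2l ?ler1n // leq_mul2l b0B orbT.
Qed.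

Let Phi := X *: P0 + P1 * h.

Let PhiE : Phi = \sum_(j | (e j < T')%N) hf ^+ e j *: Xi j +
  \sum_i (X * hf ^+ e i - \sum_(j | (e j < T')%N) ga i j * hf ^+ e j) *: A i.
Proof.
have e1 : \sum_(j | (e j < T')%N) hf ^+ e j *: Xi j =
    \sum_i (\sum_(j | (e j < T')%N) ga i j * hf ^+ e j) *: A i + P1 * h.
  rewrite (eq_bigr (fun j => \sum_i (ga i j * hf ^+ e j) *: A i + hf ^+ e j *: (B j * h))); last first.
    move=> j _; rewrite scalerDr scaler_sumr; congr (_ + _); apply: eq_bigr => i _.
    by rewrite scalerA mulrC.
  rewrite big_split exchange_big /=; congr (_ + _).
    by apply: eq_bigr => i _; rewrite scaler_suml.
  rewrite /P1 mulr_suml [RHS](bigID (fun j => (e j < T')%N)) /= [X in _ = _ + X]big1 ?addr0.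
    by apply: eq_bigr => j _; rewrite scalerAl.
  move=> j; rewrite -leqNgt => hj; have -> : B j = 0; last by rewrite scaler0 mul0r.
  apply/polyP => b; rewrite coef0; apply/eqP/negPn/negP => nz.
  by have := ABsupp (or_intror nz); move: hj TT'; clear; lia.
rewrite e1 addrAC -big_split /= /Phi /P0 scaler_sumr; congr (_ + _); apply: eq_bigr => i _.
by rewrite -scalerDl addrC subrK scalerA.
Qed.

Let E2 := 2 ^+ ((kap + 3) * B1.+1) * (l%:R * 2 ^+ g + 2) + 2 ^+ g3 : rat.

Let nrm_Phi : nrm (2 * y) Phi <= hf ^+ T' * (l%:R * E1 * E2).
Proof.
rewrite PhiE; apply: le_trans (nrmD _ _ y2) _.
have -> : hf ^+ T' * (l%:R * E1 * E2) =
   l%:R * (hf ^+ T' * (2 ^+ ((kap + 3) * B1.+1) * ((l%:R * 2 ^+ g + 2) * E1))) +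
   l%:R * (2 ^+ g3 * hf ^+ T' * E1) by rewrite /E2; ring.
apply: lerD; apply: le_trans (nrm_sum _ _ _ y2) _.
  rewrite big_mkcond /=.
  apply: (@le_trans _ _ (\sum_(j < l) (hf ^+ T' * (2 ^+ ((kap + 3) * B1.+1) * ((l%:R * 2 ^+ g + 2) * E1))))).
    apply: ler_sum => j _; case: ifP => lt.
      by rewrite nrmZ ger0_norm ?hf_ge0 // nrm_Xi_y.
    rewrite mulr_ge0 ?hf_ge0 // mulr_ge0 ?exprn_ge0 // mulr_ge0 // addr_ge0 //.
    by rewrite mulr_ge0 ?exprn_ge0.
  by rewrite sumr_const card_ord -[leLHS]mulr_natl.
apply: (@le_trans _ _ (\sum_(j < l) (2 ^+ g3 * hf ^+ T' * E1))).
  apply: ler_sum => i _; rewrite nrmZ.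
  have [->|nz] := eqVneq (A i) 0.
    by rewrite nrm0 mulr0 !mulr_ge0 ?exprn_ge0 ?hf_ge0.
  have le : (e i <= T)%N.
    have := @ABsupp i (size (A i)).-1; rewrite -lead_coefE lead_coef_eq0 nz => /(_ (or_introl isT)).
    by apply: leq_trans; rewrite leq_addl.
  apply: ler_pM; rewrite ?normr_ge0 ?nrm_ge0 ?err //.
  have [n1 _] := nrmAB i; apply: le_trans n1; apply: nrm_mono => //.
  exact: le_trans y2rho rho1.
by rewrite sumr_const card_ord -[leLHS]mulr_natl.
Qed.

(** Since [w2 = th * X], [S] equals [th] times the shifted [Phi] plus [sh P1 * (u - K)]. The first
    summand is small by the relations, the second by [root_close]. *)
Lemma nrm_S_le : nrm y S <= hf ^+ T' * 2 ^+ (hF + xB + 2 * l + (kap + 3) * B1.+1 + g + g3 + p + r + 6).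
Proof.
have eS : S = th *: sh Phi + sh P1 * (u - K).
  have Xn : X != 0 by rewrite gt_eqF.
  rewrite /S /Phi /K /kpol -/h /sh comp_polyD comp_polyZ comp_polyM scalerDr scalerA divfK //.
  by rewrite -!mul_polyC; ring.
have nP1 : nrm y (sh P1) <= l%:R * E1.
  apply: le_trans (nrm_sh P1) _.
  apply: le_trans (nrm_mono _ y2 (le_trans y2rho rho1)) _.
  apply: le_trans (nrm_sum _ _ _ ler01) _.
  apply: (@le_trans _ _ (\sum_(j < l) E1)); last by rewrite sumr_const card_ord -[leLHS]mulr_natl.
  apply: ler_sum => i _; rewrite nrmZ ger0_norm ?hf_ge0 // -[leRHS]mul1r.
  by apply: ler_pM; rewrite ?hf_ge0 ?nrm_ge0 ?hf_le1 //; have [] := nrmAB i.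
have nPhi : nrm y (sh Phi) <= hf ^+ T' * (l%:R * E1 * E2).
  exact: le_trans (nrm_sh Phi) nrm_Phi.
have close : nrm y (u - K) <= 4 * `|2 ^+ r - th ^+ p| + hf ^+ T'.+1 * 2 ^+ (p + r + 3).
  exact: (@root_close f p kap s T' r w1 th).
have close2 : nrm y (u - K) <= hf ^+ T' * (4 * 2 ^+ g3 + 2 ^+ (p + r + 3)).
  apply: le_trans close _; rewrite mulrDr; apply: lerD.
    by rewrite mulrCA ler_pM2l // mulrC.
  by rewrite ler_wpM2r ?exprn_ge0 // hf_mono.
rewrite eS; apply: le_trans (nrmD _ _ y0) _.
apply: (@le_trans _ _ (2 ^+ r.+1 * (hf ^+ T' * (l%:R * E1 * E2)) +
    (l%:R * E1) * (hf ^+ T' * (4 * 2 ^+ g3 + 2 ^+ (p + r + 3))))).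
  apply: lerD.
    by rewrite nrmZ gtr0_norm //; apply: ler_pM; rewrite ?nrm_ge0 ?(ltW th0).
  by apply: le_trans (nrmM _ _ y0) _; rewrite ler_pM ?nrm_ge0.
have -> : 2 ^+ r.+1 * (hf ^+ T' * (l%:R * E1 * E2)) +
    (l%:R * E1) * (hf ^+ T' * (4 * 2 ^+ g3 + 2 ^+ (p + r + 3))) =
   hf ^+ T' * (E1 * (l%:R * (2 ^+ r.+1 * E2 + (4 * 2 ^+ g3 + 2 ^+ (p + r + 3))))) by ring.
apply: ler_wpM2l; first exact: hf_ge0.
have -> : (hF + xB + 2 * l + (kap + 3) * B1.+1 + g + g3 + p + r + 6 =
   (hF + xB) + (l + ((kap + 3) * B1.+1 + l + g + g3 + p + r + 6)))%N by clear; lia.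
rewrite (exprD _ (hF + xB)); apply: ler_wpM2l => //.
rewrite (exprD _ l); apply: ler_pM; rewrite ?ler0n //.
- rewrite !addr_ge0 ?mulr_ge0 ?exprn_ge0 ?addr_ge0 ?mulr_ge0 ?exprn_ge0 ?ler0n //.
  by rewrite addr_ge0 ?mulr_ge0 ?exprn_ge0 ?ler0n.
- by rewrite -natrX ler_nat ltnW // ltn_expl.
have l2 : (l%:R : rat) <= 2 ^+ l by rewrite -natrX ler_nat ltnW // ltn_expl.
pose b := ((kap + 3) * B1.+1)%N; rewrite /E2 -/b.
have pw k : (1 : rat) <= 2 ^+ k by apply: exprn_ege1; rewrite ler1n.
rewrite !(exprD 2) exprS -/b (_ : 2 ^+ 3 = 8) // (_ : 2 ^+ 6 = 64) //.
have hb := pw b; have hl := pw l; have hg := pw g; have hg3 := pw g3; have hp := pw p; have hr := pw r.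
set xb := 2 ^+ b in hb *; set xl := 2 ^+ l in hl l2 *; set xg := 2 ^+ g in hg *.
set x3 := 2 ^+ g3 in hg3 *; set xp := 2 ^+ p in hp *; set xr := 2 ^+ r in hr *.
have t1 : l%:R * xg + 2 <= 3 * (xl * xg).
  have : l%:R * xg <= xl * xg by rewrite ler_wpM2r // (le_trans ler01).
  have : 1 <= xl * xg by rewrite mulr_ege1.
  lra.
have Z1 : 1 <= xb * xl * xg by rewrite !mulr_ege1.
have t2 : xb * (l%:R * xg + 2) <= 3 * (xb * xl * xg).
  have -> : 3 * (xb * xl * xg) = xb * (3 * (xl * xg)) by ring.
  by rewrite ler_wpM2l // (le_trans ler01).
set Z := xb * xl * xg in Z1 t2 *.
have t3 : xb * (l%:R * xg + 2) + x3 <= 4 * (Z * x3).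
  have : 3 * Z <= 3 * (Z * x3) by rewrite ler_pM2l // ler_peMr // (le_trans ler01).
  have : x3 <= Z * x3 by rewrite ler_peMl // (le_trans ler01).
  lra.
set Y := Z * x3 in t3.
have Y1 : 1 <= Y by rewrite mulr_ege1.
have Yp : 1 <= Y * xp by rewrite mulr_ege1.
have t4 : 2 * xr * (xb * (l%:R * xg + 2) + x3) <= 8 * (Y * xp * xr).
  have : 2 * xr * (xb * (l%:R * xg + 2) + x3) <= 2 * xr * (4 * Y).
    by rewrite ler_wpM2l // mulr_ge0 // (le_trans ler01).
  have : Y * xr <= Y * xp * xr by rewrite ler_wpM2r ?(le_trans ler01) // ler_peMr // (le_trans ler01).
  set q := Y * xp * xr; have -> : 2 * xr * (4 * Y) = 8 * (Y * xr) by ring.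
  lra.
have t5 : x3 <= Y * xp * xr.
  apply: (@le_trans _ _ Y); first by rewrite /Y ler_peMl // (le_trans ler01).
  by rewrite -mulrA ler_peMr ?(le_trans ler01 Y1) // mulr_ege1.
have t6 : xp * xr <= Y * xp * xr.
  by rewrite -mulrA ler_peMl // mulr_ge0 // (le_trans ler01).
have -> : xb * xl * xg * x3 * xp * xr * 64 = 64 * (Y * xp * xr) by rewrite /Y /Z; ring.
set q := Y * xp * xr in t4 t5 t6 *; have q1' : 1 <= q by rewrite mulr_ege1.
have -> : xp * xr * 8 = 8 * (xp * xr) by ring.
lra.
Qed.

(** A nonzero integer from [coef_lower] meets the upper bound [nrm_S_le]. In the application
    [T' - T = m] and [q2 <= m / 2], so the inequality fails as soon as the other terms are small
    against [m]. *)
Lemma thue_contradiction :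
  (T' <= s * V + 2 * p * V + (s * a + 1) * V + T + q1 + q2 +
    (hF + xB + 2 * l + (kap + 3) * B1.+1 + g + g3 + p + r + 6))%N.
Proof.
have [v vV Sv] := some_coef.
have vT : (v <= T')%N by apply: leq_trans (ltnW vV) VM.
rewrite leqNgt; apply/negP => lt.
have phi0 : 0 < phi by apply: lt_le_trans phi1.
have R0 : 0 < 2 ^+ (s * a) * phi by rewrite mulr_gt0 // exprn_gt0.
have nz : 2 ^+ (T + q1 + q2) * (p%:R ^+ (2 * v) * ((2 ^+ (s * a) * phi) ^+ v * S`_v)) != 0.
  by rewrite !mulf_neq0 // ?expf_neq0 ?mulf_neq0 ?expf_neq0 ?gt_eqF // ltr0n.
have := norm_intr_ge1 (coef_lower vT) nz; apply/negP; rewrite -ltNge.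
rewrite !normrM !normrX normrM normrX (gtr0_norm phi0) !(@ger0_norm _ _%:R) ?ler0n //.
have hS : `|S`_v| <= 2 ^+ (s * v) * nrm y S.
  have := nrm_coef S v y0; rewrite -exprM -(ler_pM2l (_ : 0 < 2 ^+ (s * v))) ?exprn_gt0 //.
  by rewrite mulrCA hf2 mulr1.
have pP : p%:R ^+ (2 * v) <= 2 ^+ (2 * p * V) :> rat.
  apply: (@le_trans _ _ ((2 ^+ p) ^+ (2 * v))).
    by rewrite lerXn2r ?nnegrE ?exprn_ge0 ?ler0n // -natrX ler_nat ltnW // ltn_expl.
  by rewrite -exprM ler_weXn2l ?ler1n // mulnCA -mulnA leq_mul2l leq_mul2l (ltnW vV) !orbT.
have phi2 : phi <= 2 by apply: (@phi_le2 f p kap s).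
have RP : (2 ^+ (s * a) * phi) ^+ v <= 2 ^+ ((s * a + 1) * V).
  apply: (@le_trans _ _ ((2 ^+ (s * a + 1)) ^+ v)).
    rewrite lerXn2r ?nnegrE ?(ltW R0) ?exprn_ge0 //.
    by rewrite exprD expr1 ler_wpM2l ?exprn_ge0.
  by rewrite -exprM ler_weXn2l ?ler1n // leq_mul2l (ltnW vV) orbT.
have SP : `|S`_v| <= 2 ^+ (s * V) * (hf ^+ T' * 2 ^+ (hF + xB + 2 * l + (kap + 3) * B1.+1 + g + g3 + p + r + 6)).
  apply: le_trans hS _; apply: ler_pM; rewrite ?exprn_ge0 ?nrm_ge0 ?nrm_S_le //.
  by rewrite ler_weXn2l ?ler1n // leq_mul2l (ltnW vV) orbT.
set G5 := (_ + 6)%N in lt SP.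
apply: (@le_lt_trans _ _ (2 ^+ (T + q1 + q2) * (2 ^+ (2 * p * V) * (2 ^+ ((s * a + 1) * V) * (2 ^+ (s * V) * (hf ^+ T' * 2 ^+ G5)))))).
  apply: ler_pM; rewrite ?exprn_ge0 ?mulr_ge0 ?exprn_ge0 ?ler0n ?(ltW R0) ?normr_ge0 //.
  apply: ler_pM; rewrite ?exprn_ge0 ?mulr_ge0 ?exprn_ge0 ?ler0n ?(ltW R0) ?normr_ge0 //.
  by apply: ler_pM; rewrite ?exprn_ge0 ?(ltW R0) ?normr_ge0.
have -> : 2 ^+ (T + q1 + q2) * (2 ^+ (2 * p * V) * (2 ^+ ((s * a + 1) * V) * (2 ^+ (s * V) * (hf ^+ T' * 2 ^+ G5)))) =
  2 ^+ (s * V + 2 * p * V + (s * a + 1) * V + T + q1 + q2 + G5) * hf ^+ T' by rewrite !exprD; ring.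
rewrite -[ltRHS](hf2 T') ltr_pM2r ?hf_gt0 // ltr_eXn2l ?ltr1n //.
Qed.

End Contradiction.

(** * Comparison of two solutions *)

(** Here [j] is of the order of [log m]: it bounds lengths of sums and degrees in bits, and any
    fixed multiple of it is negligible against [m]. *)
Lemma log_linear (c kk : nat) : exists M, forall m, (M <= m)%N ->
  exists j, (c * m <= 2 ^ j)%N /\ (kk * j.+1 <= m)%N.
Proof.
have [v hv] := exp_gt_linear kk (c + 2); exists (2 ^ v)%N => m hm.
have m0 : (0 < m)%N by apply: leq_trans hm; rewrite expn_gt0.
have /andP[t1 t2] := trunc_log_bounds (isT : (1 < 2)%N) m0.
set t := trunc_log 2 m in t1 t2; exists (c + t.+1)%N; split.
  by rewrite expnD; apply: leq_mul; [apply/ltnW/ltn_expl | apply: ltnW].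
apply: leq_trans t1.
have vt : (v <= t)%N by rewrite -ltnS -(ltn_exp2l _ _ (isT : (1 < 2)%N)); apply: leq_ltn_trans hm t2.
rewrite -(subnK vt); elim: (t - v)%N => [|d IH].
  by rewrite add0n; apply: leq_trans (ltnW hv); rewrite leq_mul2l; apply/orP; right; clear; lia.
rewrite addSn expnS; apply: (@leq_trans (2 * (kk * (c + (d + v).+1).+1))); last by rewrite leq_mul2l.
by rewrite mulnCA leq_mul2l; apply/orP; right; clear; lia.
Qed.

(** The irrational factor [2^(r/p)] is common to all solutions with the same residue [r]; the second
    solution approximates it by the rational [w / X], and this links it to the curve of the
    first. *)
Lemma theta_close (p A r : nat) (eps w : rat) : (0 < p)%N -> (0 < A)%N -> 0 <= eps -> eps <= 4^-1 ->
  0 < w -> w ^+ p = 2 ^+ r * (1 + eps) ->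
  2^-1 <= (binp p A).[eps] /\
  `|2 ^+ r - (w / (binp p A).[eps]) ^+ p| <= 2 ^+ (r + 2 * p) * (2 * eps) ^+ A.+1.
Proof.
move=> p0 A0 e0 e4 w0 wp; set X := _.[eps].
have e2 : eps <= 2^-1 by lra.
have hX : `|X - 1| <= 2 * eps.
  have -> : X - 1 = (binp p A - 1).[eps] by rewrite hornerD hornerN hornerC.
  by apply: le_trans (horner_nrm _ e0) _; apply: nrm_binpB1.
have X2 : 2^-1 <= X by move: hX; rewrite ler_norml => /andP[]; lra.
split=> //; have X0 : 0 < X by apply: lt_le_trans X2.
have Xp0 : 0 < X ^+ p by rewrite exprn_gt0.
have hd : `|X ^+ p - (1 + eps)| <= (2 * eps) ^+ A.+1 * 2 ^+ p.
  have -> : X ^+ p - (1 + eps) = (binp p A ^+ p - (1 + 'X)).[eps].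
    by rewrite hornerD hornerN horner_exp hornerD hornerC hornerX.
  by apply: le_trans (horner_nrm _ e0) _; apply: nrm_binpX_rem.
have -> : 2 ^+ r - (w / X) ^+ p = 2 ^+ r * ((X ^+ p - (1 + eps)) * (X ^- p)).
  by rewrite expr_div_n wp mulrBl divff ?gt_eqF //; ring.
rewrite exprD mul2n -addnn exprD -!mulrA normrM ger0_norm ?exprn_ge0 // ler_wpM2l ?exprn_ge0 //.
rewrite normrM mulrC; apply: ler_pM => //; last by rewrite [leRHS]mulrC.
rewrite ger0_norm ?invr_ge0 ?exprn_ge0 ?(ltW X0) // -exprVn; apply: lerXn2r; rewrite ?nnegrE ?invr_ge0 ?(ltW X0) //.
by rewrite -[leRHS]invrK lef_pV2 ?posrE // invr_gt0.
Qed.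

Section CurvePoly.
Variables (n : nat) (p C s kap : nat) (c sg : 'I_n -> nat).
Hypothesis c1 : forall i, (0 < c i <= C)%N.
Hypothesis cs : forall i, (sg i <= c i * s <= sg i + kap * c i)%N.

(** The powers of 2 in the coefficients are the rounding errors of the common exponent [s]: they
    make the value at [2^-s] exactly the ratio attached to the solution, at a height governed by
    [kap]. *)
Definition curve_poly : {poly rat} := 1 + \sum_i 2 ^+ (c i * s - sg i) *: 'X^(c i).
Let y := hf ^+ s.

Lemma curve_pint : pint curve_poly.
Proof.
apply: pintD; [exact: pint1 | apply: pint_sum => i _; apply: pintZ; [exact: rpredX | exact: pintXn]].
Qed.

Let coefE b : curve_poly`_b = (b == 0%N)%:R + \sum_i 2 ^+ (c i * s - sg i) * (b == c i)%:R.
Proof.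
by rewrite coefD coefC coef_sum; congr (_ + _); [case: ifP | apply: eq_bigr => i _; rewrite coefZ coefXn].
Qed.

Lemma curve_coef0 : curve_poly`_0 = 1.
Proof.
rewrite coefE big1 ?addr0 // => i _; have /andP[h _] := c1 i.
by rewrite eq_sym (gtn_eqF h) mulr0.
Qed.

Lemma curve_bound b : `|curve_poly`_b| <= 2 ^+ ((kap + n) * b).
Proof.
case: b => [|b]; first by rewrite curve_coef0 normr1 muln0 expr0.
rewrite coefE add0r; apply: le_trans (ler_norm_sum _ _ _) _.
apply: (@le_trans _ _ (\sum_(i < n) 2 ^+ (kap * b.+1))).
  apply: ler_sum => i _; rewrite normrM; case: eqP => [->|_]; last by rewrite normr0 mulr0 exprn_ge0.
  rewrite normr1 mulr1 ger0_norm ?exprn_ge0 // ler_weXn2l ?ler1n //.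
  by have /andP[h1 h2] := cs i; rewrite leq_subLR.
rewrite sumr_const card_ord -[leLHS]mulr_natl mulnDl addnC exprD; apply: ler_wpM2r; first by rewrite exprn_ge0.
rewrite -natrX ler_nat; apply: leq_trans (ltnW (ltn_expl n (isT : (1 < 2)%N))) _.
by rewrite leq_pexp2l // leq_pmulr.
Qed.

Lemma curve_size : (size curve_poly <= C.+1)%N.
Proof.
apply: leq_trans (size_polyD _ _) _; rewrite geq_max size_poly1 /=.
apply: leq_trans (size_sum _ _ _) _; apply/bigmax_leqP => i _.
apply: leq_trans (size_scale_leq _ _) _; rewrite size_polyXn ltnS.
by have /andP[] := c1 i.
Qed.

Let scaleE i : 2 ^+ (c i * s - sg i) * y ^+ c i = hf ^+ sg i.
Proof.
have /andP[h1 _] := cs i; rewrite -exprM [(s * _)%N]mulnC.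
have -> : hf ^+ (c i * s) = hf ^+ (c i * s - sg i) * hf ^+ sg i by rewrite -exprD subnK.
by rewrite mulrA hf2 mul1r.
Qed.

Lemma curve_horner : curve_poly.[y] = 1 + \sum_i hf ^+ sg i.
Proof.
rewrite hornerD hornerC horner_sum; congr (_ + _); apply: eq_bigr => i _.
by rewrite hornerZ hornerXn scaleE.
Qed.

(** After rescaling [Y], [1 + t] is the [p]-th power of a polynomial of degree at most [C] with
    constant coefficient 1. By [root_uniq] the binomial expansion agrees with that polynomial up to
    degree [k]. *)
Lemma curve_power_rel z (Q : {poly rat}) k : (0 < p)%N -> curve_poly = z *: Q ^+ p -> (C < k)%N ->
  (binp p k \Po (\sum_i hf ^+ sg i *: 'X^(c i)))`_k = 0.
Proof.
move=> p0 e lt; set t := \sum_i _.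
have k0 : (0 < k)%N by apply: leq_trans lt.
have tE : 1 + t = curve_poly \Po (y *: 'X).
  rewrite comp_polyD comp1; congr (_ + _); rewrite raddf_sum; apply: eq_bigr => i _ /=.
  by rewrite comp_polyZ comp_Xn_poly exprZn scalerA scaleE.
have zQ : z * Q`_0 ^+ p = 1 by rewrite -coef0X -coefZ -e curve_coef0.
have Q0 : Q`_0 != 0.
  by apply/eqP => Q0; move: zQ; rewrite Q0 expr0n (gtn_eqF p0) mulr0 => /esym/eqP; rewrite oner_eq0.
pose G := (Q`_0)^-1 *: (Q \Po (y *: 'X)).
have Gp : G ^+ p = 1 + t.
  rewrite tE e exprZn comp_polyZ -rmorphXn /= exprVn; congr (_ *: _).
  by apply: (mulIf (expf_neq0 p Q0)); rewrite zQ mulVf // expf_neq0.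
have G0 : G`_0 = 1.
  by rewrite coefZ -[X in _ * X]horner_coef0 horner_comp hornerZ hornerX mulr0 horner_coef0 mulVf.
have t0 : t`_0 = 0.
  rewrite coef_sum big1 // => i _; rewrite coefZ coefXn; have /andP[h _] := c1 i.
  by rewrite eq_sym (gtn_eqF h) mulr0.
have vt : vanish 1 t by move=> i; rewrite ltnS leqn0 => /eqP->.
set P := binp p k \Po t.
have P0 : P`_0 = 1 by rewrite -horner_coef0 horner_comp !horner_coef0 t0 horner_coef0 binp0.
have Pp i : (i <= k)%N -> (P ^+ p)`_i = (G ^+ p)`_i.
  move=> le; rewrite Gp; pose R := binp p k ^+ p - (1 + 'X).
  have vR : vanish k.+1 R by move=> b hb; rewrite coefB coef_binpX ?subrr.
  have -> : P ^+ p = (R \Po t) + (1 + t).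
    rewrite /P -rmorphXn /= -[binp p k ^+ p](subrK (1 + 'X)) comp_polyD; congr (_ + _).
    by rewrite comp_polyD comp1 comp_polyX.
  rewrite coefD (_ : (R \Po t)`_i = 0) ?add0r //.
  rewrite comp_polyE coef_sum big1 // => b _; rewrite coefZ.
  have [hb|hb] := ltnP b k.+1; first by rewrite vR ?mul0r.
  by rewrite (@vanishX 1 t b vt) ?mulr0 // muln1 (leq_ltn_trans le).
rewrite (root_uniq p0 P0 G0 Pp (leqnn k)) nth_default //.
have st : (size (1 + t)%R <= C.+1)%N.
  apply: leq_trans (size_polyD _ _) _; rewrite geq_max size_poly1 /=.
  apply: leq_trans (size_sum _ _ _) _; apply/bigmax_leqP => i _.
  apply: leq_trans (size_scale_leq _ _) _; rewrite size_polyXn ltnS.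
  by have /andP[] := c1 i.
have := size_exp G p; rewrite Gp => hs.
have : ((size G).-1 <= (size (1 + t)%R).-1)%N by rewrite hs leq_pmulr.
move: st lt; set x := size (1 + t)%R; set z' := size G; clear; lia.
Qed.

End CurvePoly.

(* [sg i] is the distance from the [i]-th exponent to the largest exponent [m]; the summand [1] is the one
   with [sg i = m]. *)
Definition is_solution (n p D r m q z : nat) (sg : 'I_n -> nat) :=
  [/\ m = (p * q + r)%N, forall i, (sg i <= m <= D * sg i)%N &
      (z ^ p = 2 ^ m + \sum_i 2 ^ (m - sg i))%N].

Lemma solution_ratio (n p D r m q z : nat) (sg : 'I_n -> nat) : (0 < p)%N -> is_solution p D r m q z sg ->
  let w : rat := z%:R * hf ^+ q in
  [/\ 0 < w, 2 ^+ q * w \is a Num.int & w ^+ p = 2 ^+ r * (1 + \sum_i hf ^+ sg i)].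
Proof.
move=> p0 [em hs ez] w; split.
- rewrite mulr_gt0 ?hf_gt0 // ltr0n lt0n; apply/eqP => z0; move: ez; rewrite z0 exp0n // => /esym/eqP.
  by rewrite addn_eq0 expn_eq0.
- by rewrite /w mulrCA hf2 mulr1 rpred_nat.
have hq : 2 ^+ m * hf ^+ (p * q) = 2 ^+ r :> rat.
  by rewrite em addnC exprD -mulrA hf2 mulr1.
have ez' : z%:R ^+ p = (2 ^ m + \sum_i 2 ^ (m - sg i))%:R :> rat by rewrite -natrX ez.
rewrite exprMn -exprM [(q * p)%N]mulnC ez' natrD natr_sum mulrDl natrX hq mulrDr mulr1.
congr (_ + _); rewrite mulr_suml mulr_sumr; apply: eq_bigr => i _.
have /andP[h1 _] := hs i; rewrite natrX -hq mulrAC; congr (_ * _).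
have -> : 2 ^+ m = 2 ^+ (m - sg i) * 2 ^+ sg i :> rat by rewrite -exprD subnK.
by rewrite -mulrA hf2 mulr1.
Qed.

(** [x0] and [hF] are the logarithmic heights of the linear system and of its solution, [Y] that of
    the Wronskian. The bound [Zt * x0 <= 2 m + Zt * c0] keeps all of them small fractions of [m],
    even after multiplication by [N1] or [C + 3]; [W * j.+1], at most [m / 64], collects what does
    not grow linearly with [m]. *)
Lemma parameter_estimates (C Lc l s p K cc kap' c0 F N1 N2 A m j k q q1 g g3 r x0 hF B1 V Y W u Zt : nat) :
  u = ((C + 5) * Lc)%N -> Zt = (256 * u * N1)%N ->
  (0 < N1)%N -> (0 < s)%N -> (0 < Lc)%N -> (l <= Lc)%N -> (k <= K)%N -> (2 * p + 1 <= 2 * s)%N ->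
  (kap' + 3 <= cc)%N -> (2 * q <= m)%N ->
  (cc * (K.+1 * Zt) <= s)%N -> (A * Zt <= N2)%N ->
  B1 = (k.+1 * m %/ s)%N -> x0 = (cc * B1 + A * (m %/ N2) + c0)%N -> hF = (4 * (x0 + (Lc + 1 + j)))%N ->
  Y = (2 * l * (2 * l + 2 * l * (F + j) + hF + j))%N -> V = (2 * l + (Y %/ s).+1)%N ->
  W = (Zt * c0 + N1 * (9 + 5 * Lc) + (C + 5) * (Lc + 1) * 3 * s + 2 * u * (8 * Lc + 9 + 2 * Lc * F)
     + q1 + (6 * Lc + 15 + cc + g + g3 + p + r))%N ->
  (64 * W * j.+1 <= m)%N ->
  [/\ (N1 * (hF + l + 1) <= m)%N, (V <= k.+1 * m)%N &
   (s * V + 2 * p * V + (s * C + 1) * V + k * m + q1 + q +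
     (hF + j + 2 * l + (kap' + 3) * B1.+1 + g + g3 + p + r + 6) < k.+1 * m)%N].
Proof.
move=> eu eZ N10 s0 L0 lL kK ps kc qm hcc hA eB ex eh eY eV eW hj.
have u0 : (0 < u)%N by rewrite eu muln_gt0 addn_gt0 orbT.
have x0m : (Zt * x0 <= 2 * m + Zt * c0)%N.
  rewrite ex !mulnDr leq_add2r mul2n -addnn; apply: leq_add.
    have h1 : (K.+1 * (Zt * (cc * B1)) <= K.+1 * m)%N.
      apply: (@leq_trans (B1 * s)).
        by have := leq_mul (leqnn B1) hcc; clear; lia.
      rewrite eB; apply: leq_trans (leq_trunc_div _ _) _; by rewrite leq_mul2r ltnS kK orbT.
    by rewrite leq_pmul2l // in h1.
  apply: (@leq_trans (m %/ N2 * N2)); last exact: leq_trunc_div.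
  by rewrite mulnA mulnC leq_mul2l [(Zt * A)%N]mulnC hA orbT.
have W1 a : (a <= W)%N -> (64 * (a * j.+1) <= m)%N.
  by move=> ha; apply: leq_trans hj; rewrite mulnA; apply: leq_mul => //; apply: leq_mul.
pose X := (8 * u * x0)%N.
have XN : (Zt * x0 = 32 * N1 * X)%N by rewrite eZ /X; clear; lia.
have wc0 := W1 (Zt * c0)%N; have wN := W1 (N1 * (9 + 5 * Lc))%N.
have ws := W1 ((C + 5) * (Lc + 1) * 3 * s)%N; have wu := W1 (2 * u * (8 * Lc + 9 + 2 * Lc * F))%N.
have wq := W1 q1; have wG := W1 (6 * Lc + 15 + cc + g + g3 + p + r)%N.
have {}wc0 := wc0 (_ : _ <= W)%N; have {}wN := wN (_ : _ <= W)%N; have {}ws := ws (_ : _ <= W)%N.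
have {}wu := wu (_ : _ <= W)%N; have {}wq := wq (_ : _ <= W)%N; have {}wG := wG (_ : _ <= W)%N.
have [b1 b2 b3 b4 b5] : [/\ (Zt * c0 <= W)%N, (N1 * (9 + 5 * Lc) <= W)%N,
   ((C + 5) * (Lc + 1) * 3 * s <= W)%N, (2 * u * (8 * Lc + 9 + 2 * Lc * F) <= W)%N &
   (q1 <= W /\ 6 * Lc + 15 + cc + g + g3 + p + r <= W)%N].
  by rewrite eW; split; [| | | |split]; clear; lia.
have {}wc0 := wc0 b1; have {}wN := wN b2; have {}ws := ws b3; have {}wu := wu b4.
have {}wq := wq (proj1 b5); have {}wG := wG (proj2 b5); clear W1 b1 b2 b3 b4 b5 hj eW.
have j0 : (0 < j.+1)%N by [].
have Zc : (64 * (Zt * c0) <= m)%N.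
  by apply: leq_trans wc0; rewrite leq_mul2l leq_pmulr.
have XN1 : (X <= N1 * X)%N by rewrite leq_pmull.
have X15 : (2048 * X <= 129 * m)%N.
  by move: x0m XN1 Zc; rewrite XN; clear; lia.
have N1x0 : (8 * (N1 * x0) <= N1 * X)%N.
  rewrite /X; have := leq_mul u0 (leqnn (8 * N1 * x0)); clear; lia.
have x0X : (8 * x0 <= X)%N.
  by rewrite /X; have := leq_mul u0 (leqnn (8 * x0)); clear; lia.
have I1 : (N1 * (hF + l + 1) <= m)%N.
  have : (N1 * (hF + l + 1) <= 4 * (N1 * x0) + N1 * (9 + 5 * Lc) * j.+1)%N.
    have -> : (4 * (N1 * x0) + N1 * (9 + 5 * Lc) * j.+1 = N1 * (4 * x0 + (9 + 5 * Lc) * j.+1))%N by clear; lia.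
    rewrite leq_mul2l; apply/orP; right; rewrite eh.
    have : ((9 + 5 * Lc) * j.+1 = 9 + 5 * Lc + 9 * j + 5 * (Lc * j))%N by clear; lia.
    by move: lL; clear; lia.
  by move: N1x0 wN x0m Zc; rewrite XN; clear; lia.
have Yb : ((C + 3) * Y <= X + 2 * u * (8 * Lc + 9 + 2 * Lc * F) * j.+1)%N.
  apply: (@leq_trans ((C + 5) * (2 * Lc * (2 * Lc + 2 * Lc * (F + j) + hF + j)))).
    apply: leq_mul; first by clear; lia.
    rewrite eY; apply: leq_mul; first by rewrite leq_mul2l lL.
    by rewrite !leq_add2r; apply: leq_add; [|apply: leq_mul => //]; rewrite leq_mul2l lL.
  have -> : ((C + 5) * (2 * Lc * (2 * Lc + 2 * Lc * (F + j) + hF + j)) =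
     2 * u * (2 * Lc + 2 * Lc * (F + j) + hF + j))%N by rewrite eu; clear; lia.
  have -> : (X + 2 * u * (8 * Lc + 9 + 2 * Lc * F) * j.+1 = 2 * u * (4 * x0 + (8 * Lc + 9 + 2 * Lc * F) * j.+1))%N.
    by rewrite /X; clear; lia.
  rewrite leq_mul2l; apply/orP; right; rewrite eh.
  have : ((8 * Lc + 9 + 2 * Lc * F) * j.+1 = 8 * Lc + 9 + 2 * Lc * F + 8 * (Lc * j) + 9 * j + 2 * (Lc * F) * j)%N by clear; lia.
  have : (2 * Lc * (F + j) = 2 * Lc * F + 2 * (Lc * j))%N by clear; lia.
  by clear; lia.
have sV : (s * V <= s * (2 * l + 1) + Y)%N.
  rewrite eV; have := leq_trunc_div Y s; rewrite [(_ * s)%N]mulnC.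
  have -> : (s * (2 * l + (Y %/ s).+1) = s * (2 * l + 1) + s * (Y %/ s))%N by rewrite -mulnDr; congr (_ * _)%N; clear; lia.
  by rewrite leq_add2l.
have CsV : ((C + 3) * (s * V) <= (C + 5) * (Lc + 1) * 3 * s + (C + 3) * Y)%N.
  apply: (@leq_trans ((C + 3) * (s * (2 * l + 1) + Y))); first by rewrite leq_mul2l sV orbT.
  rewrite mulnDr leq_add2r.
  have -> : ((C + 5) * (Lc + 1) * 3 * s = (C + 5) * (s * (3 * (Lc + 1))))%N by clear; lia.
  apply: leq_mul; first by clear; lia.
  by rewrite leq_mul2l; apply/orP; right; move: lL; clear; lia.
have VsV : (s * V + 2 * p * V + (s * C + 1) * V <= (C + 3) * (s * V))%N.
  have -> : (s * V + 2 * p * V + (s * C + 1) * V = (s + (2 * p + 1) + s * C) * V)%N by clear; lia.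
  have -> : ((C + 3) * (s * V) = (s + 2 * s + s * C) * V)%N by clear; lia.
  by rewrite leq_mul2r leq_add2r leq_add2l ps orbT.
have ws' : (64 * ((C + 5) * (Lc + 1) * 3 * s) <= m)%N.
  by apply: leq_trans ws; rewrite leq_mul2l leq_pmulr.
have wq' : (64 * q1 <= m)%N by apply: leq_trans wq; rewrite leq_mul2l leq_pmulr.
have G5 : (hF + j + 2 * l + (kap' + 3) * B1.+1 + g + g3 + p + r + 6 <=
   5 * x0 + (6 * Lc + 15 + cc + g + g3 + p + r) * j.+1)%N.
  have h1 : ((kap' + 3) * B1 <= x0)%N.
    by rewrite ex -addnA; apply: leq_trans (leq_addr _ _); rewrite leq_mul2r kc orbT.
  rewrite mulnS eh; set z := ((kap' + 3) * B1)%N in h1 *.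
  have : (6 * Lc + 15 + cc + g + g3 + p + r + 14 * j <= (6 * Lc + 15 + cc + g + g3 + p + r) * j.+1)%N.
    rewrite mulnS leq_add2l leq_mul2r; apply/orP; right; clear; lia.
  by move: h1 lL kc; clear; lia.
have Vm : (V <= m)%N.
  apply: (@leq_trans ((C + 3) * (s * V))).
    by rewrite mulnA leq_pmull // muln_gt0 s0 addn_gt0 orbT.
  by move: CsV Yb wu ws' X15; clear; lia.
split=> //; first by apply: leq_trans Vm _; rewrite leq_pmull.
have m0 : (0 < m)%N.
  by apply: leq_trans ws'; rewrite !muln_gt0 !addn_gt0 s0 !orbT.
rewrite (mulSn k m); move: VsV CsV Yb G5 wu wG ws' wq' X15 x0X qm I1 s0 N10.
move: m0; clear.
set t1 := (s * V)%N; set t2 := (2 * p * V)%N; set t3 := ((s * C + 1) * V)%N.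
set t4 := (hF + j + _ + _ + _ + _ + _ + _ + _)%N.
set t5 := ((C + 3) * t1)%N; set t6 := ((C + 3) * Y)%N; set t7 := (_ * 3 * s)%N.
set t8 := (_ * j.+1)%N; set t9 := (_ * j.+1)%N; set t10 := (k * m)%N.
lia.
Qed.

(** Every term of [eps] is at most [2^-(m / D)], rounded. The degree [2 D (K + 1)] is twice what the
    accuracy [2^-((K + 1) m)] asks for, and the surplus absorbs [2^b] and the factors [n]. *)
Lemma sum_hf_small (n D K b m : nat) (sg : 'I_n -> nat) :
  (0 < D)%N -> (forall i, m <= D * sg i)%N ->
  (D * (n + 2) <= m)%N -> (2 * D + b + 2 * n * (2 * D * K.+1).+1 <= m)%N ->
  let eps : rat := \sum_i hf ^+ sg i in
  [/\ 0 <= eps, eps <= 4^-1 & 2 ^+ b * (2 * eps) ^+ (2 * D * K.+1).+1 <= hf ^+ (K.+1 * m)].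
Proof.
move=> D0 hs m1 m2 eps; set A := (2 * D * K.+1)%N in m2 *; set v := (m %/ D)%N.
have e0 : 0 <= eps by apply: sumr_ge0 => i _; apply: hf_ge0.
have vn : (n + 2 <= v)%N by rewrite leq_divRL // mulnC.
have ev : eps <= n%:R * hf ^+ v.
  rewrite mulr_natl -[X in _ *+ X](card_ord n) -sumr_const; apply: ler_sum => i _.
  by apply: hf_mono; rewrite /v -[sg i](mulKn _ D0); apply: leq_div2r.
have n2 : n%:R <= 2 ^+ n :> rat by rewrite -natrX ler_nat ltnW // ltn_expl.
split=> //.
  apply: le_trans ev _; apply: le_trans (_ : 2 ^+ n * hf ^+ (n + 2) <= _).
    by apply: ler_pM; rewrite ?ler0n ?hf_ge0 // hf_mono.
  by rewrite exprD mulrA hf2 mul1r expr2; lra.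
have e2 : 2 * eps <= 2 ^+ (2 * n) * hf ^+ v.
  apply: le_trans (_ : 2 * (n%:R * hf ^+ v) <= _); first by rewrite ler_pM2l.
  rewrite mulrA ler_wpM2r ?hf_ge0 // -natrM -natrX ler_nat; clear.
  by case: n => [|n]; rewrite ?muln0 // ltnW // ltn_expl.
apply: le_trans (_ : 2 ^+ b * (2 ^+ (2 * n) * hf ^+ v) ^+ A.+1 <= _).
  by rewrite ler_wpM2l ?exprn_ge0 // lerXn2r ?nnegrE ?mulr_ge0 ?exprn_ge0 ?hf_ge0.
rewrite exprMn -!exprM mulrA -exprD.
have le : (b + 2 * n * A.+1 + K.+1 * m <= v * A.+1)%N.
  have h1 : (m <= v * D + D)%N by rewrite {1}(divn_eq m D) leq_add2l ltnW // ltn_mod.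
  have h2 : (v * A = 2 * K.+1 * (v * D))%N by rewrite /A; clear; lia.
  have h3 : (2 * K.+1 * m <= 2 * K.+1 * (v * D + D))%N by rewrite leq_mul2l h1 orbT.
  have h4 : (b + 2 * n * A.+1 + 2 * K.+1 * D <= K.+1 * m)%N.
    have := leq_mul (leqnn K.+1) m2; set w := (2 * n * A.+1)%N.
    by rewrite !mulnDr mulnCA mulnA; have := leq_pmull (b + w) (ltn0Sn K); rewrite mulnDr; clear; lia.
  by rewrite [(v * _.+1)%N]mulnS h2; move: h3 h4; rewrite mulnDr; clear; lia.
apply: le_trans (_ : 2 ^+ (b + 2 * n * A.+1) * hf ^+ (b + 2 * n * A.+1 + K.+1 * m) <= _).
  by rewrite ler_wpM2l ?exprn_ge0 // hf_mono.
by rewrite [hf ^+ (_ + _)]exprD mulrA hf2 mul1r.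
Qed.

Lemma nrm1_curve (n C s kap : nat) (c sg : 'I_n -> nat) :
  (forall i, 0 < c i <= C)%N -> (forall i, sg i <= c i * s <= sg i + kap * c i)%N ->
  nrm 1 (curve_poly s c sg) <= 2 ^+ (C.+1 + (kap + n) * C).
Proof.
move=> c1 cs; rewrite (nrm_wide _ (curve_size s sg c1)).
apply: le_trans (_ : \sum_(i < C.+1) 2 ^+ ((kap + n) * C) <= _).
  apply: ler_sum => i _; rewrite expr1n mulr1; apply: le_trans (curve_bound c1 cs i) _.
  by rewrite ler_weXn2l ?ler1n // leq_mul2l -ltnS ltn_ord orbT.
rewrite sumr_const card_ord -[leLHS]mulr_natl exprD ler_wpM2r ?exprn_ge0 //.
by rewrite -natrX ler_nat ltnW // ltn_expl.
Qed.

(** * A fixed first solution excludes every large second one *)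

Section Core.
Variables (n p D r K C kap s N1 N2 m1 q1 z1 : nat) (c sg1 : 'I_n -> nat).
Let Lc := ((K.+1 * D).+1 ^ n)%N.
Let A := (2 * D * K.+1)%N.
Let cc := (2 * p + (kap + n) + 3)%N.
Hypothesis p1 : (1 < p)%N.
Hypothesis D0 : (0 < D)%N.
Hypothesis hK : (2 ^ K * (K.+1 * Lc) < 3 ^ K)%N.
Hypothesis sol1 : is_solution p D r m1 q1 z1 sg1.
Hypothesis C0 : (0 < C)%N.
Hypothesis c1 : forall i, (0 < c i <= C)%N.
Hypothesis cs : forall i, (sg1 i <= c i * s <= sg1 i + kap * c i)%N.
Hypothesis npow : forall z Q, curve_poly s c sg1 <> z *: Q ^+ p.
Hypothesis N10 : (0 < N1)%N.
Hypothesis N12 : (2 * N1 <= N2)%N.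
Hypothesis N2A : (A * (256 * ((C + 5) * Lc) * N1) <= N2)%N.
Hypothesis s1 : (kap + n + p + 9 <= s)%N.
Hypothesis s2 : (cc * (K.+1 * (256 * ((C + 5) * Lc) * N1)) <= s)%N.

(** With the first solution fixed, [f], [s], [q1] and the constant [W] of [parameter_estimates] no
    longer change. For large [m] the last bound given there is the reverse of
    [thue_contradiction]. *)
Lemma no_second_solution : exists M2, forall (m q z l : nat) (sg : 'I_n -> nat) (e : 'I_l -> nat),
  (M2 <= m)%N -> is_solution p D r m q z sg -> (l <= Lc)%N -> (exists i, e i = 0%N) ->
  (forall i j, (e i < e j)%N -> (m < N1 * (e j - e i))%N) ->
  (forall i j, e i = e j -> i = j) ->
  (forall i a, (e i < K.+1 * m)%N -> exists j, (e j <= e i + sg a)%N /\ (N2 * (e i + sg a - e j) <= m)%N) ->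
  False.
Proof.
have p0 : (0 < p)%N by apply: ltnW.
have s0 : (0 < s)%N by apply: leq_trans s1; rewrite addn_gt0 orbT.
have L0 : (0 < Lc)%N by rewrite expn_gt0.
have A0 : (0 < A)%N by rewrite !muln_gt0 D0.
pose g := (A.+1 * n.+1 ^ A)%N; pose g3 := (A.+1 * (A * n.+1 ^ A))%N.
pose c0 := (2 * p * A + g + 1)%N.
pose F := (p * (2 * Lc * C + 1) + C + (C.+1 + (kap + n) * C))%N.
pose u := ((C + 5) * Lc)%N; pose Zt := (256 * u * N1)%N.
pose W := (Zt * c0 + N1 * (9 + 5 * Lc) + (C + 5) * (Lc + 1) * 3 * s + 2 * u * (8 * Lc + 9 + 2 * Lc * F)
     + q1 + (6 * Lc + 15 + cc + g + g3 + p + r))%N.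
have [M hM] := log_linear (K + 3) (64 * W).
exists (M + D * (n + 2) + (2 * D + (r + 2 * p) + 2 * n * A.+1) + 10 * (Lc * s) + 1)%N.
move=> m q z l sg e mM sol lL e0 gap einj clos.
have [m1' m2 m3 m4 m5] : [/\ (M <= m)%N, (D * (n + 2) <= m)%N,
    (2 * D + (r + 2 * p) + 2 * n * A.+1 <= m)%N, (10 * (Lc * s) <= m)%N & (0 < m)%N].
  by move: mM; clear; set x := (D * _)%N; set x' := (_ + _ + _)%N in x *; split; lia.
have [j [mj Wj]] := hM _ m1'.
have [k /andP[k0 kK] grow] := slow_growth_scale m5 lL e0 hK.
have [em hs _] := sol.
have [w20 w2q w2p] := solution_ratio p0 sol.
have [w10 w1q w1p] := solution_ratio p0 sol1.
pose eps : rat := \sum_i hf ^+ sg i.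
have [eps0 eps4 epsm] := @sum_hf_small n D K (r + 2 * p) m sg D0 (fun i => proj2 (andP (hs i))) m2 m3.
rewrite -/eps -/A in eps0 eps4 epsm.
have [X2 dX] := theta_close p0 A0 eps0 eps4 w20 w2p.
pose X := (binp p A).[eps]; rewrite -/X in X2 dX.
pose T := (k * m)%N; pose T' := (k.+1 * m)%N.
have T0 : (0 < T)%N by rewrite muln_gt0 k0.
have TT' : (T < T')%N by rewrite ltn_mul2r m5 ltnSn.
have N20 : (0 < N2)%N by apply: leq_trans N12; rewrite muln_gt0.
(* Two representatives close to the same [x] would differ by at most [m / N2], hence by at most
   [m / N1], against [gap]. *)
have uniq_close (i i' : 'I_l) (x : nat) : (e i <= x)%N && (N2 * (x - e i) <= m)%N ->
    (e i' <= x)%N && (N2 * (x - e i') <= m)%N -> i = i'.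
  have wl a b : (e a < e b)%N -> (e b <= x)%N -> (N2 * (x - e a) <= m)%N -> False.
    move=> lt le h; have := gap _ _ lt; rewrite ltnNge => /negP; apply.
    apply: leq_trans h; apply: leq_mul; last exact: leq_sub2r.
    by apply: leq_trans N12; rewrite leq_pmull.
  move=> /andP[h1 h2] /andP[h3 h4]; case: (ltngtP (e i) (e i')) => [lt|lt|]; last exact: einj.
    by case: (wl _ _ lt h3 h2).
  by case: (wl _ _ lt h1 h4).
have clos' (i : 'I_l) a : (e i < T')%N -> exists j, (e j <= e i + sg a)%N && (N2 * (e i + sg a - e j) <= m)%N.
  move=> lt; have [|b [h1 h2]] := clos i a; last by exists b; rewrite h1 h2.
  by apply: leq_trans lt _; rewrite leq_mul2r ltnS kK orbT.
have [ga [gaint gabd gaerr]] := @cluster_matrix n l p A m N2 T' sg e p0 N20 uniq_close clos'.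
rewrite -/eps -/X in gaerr.
pose B1 := (T' %/ s)%N; pose x0 := (cc * B1 + A * (m %/ N2) + c0)%N.
pose hF := (4 * (x0 + (Lc + 1 + j)))%N.
pose Y := (2 * l * (2 * l + 2 * l * (F + j) + hF + j))%N; pose V := (2 * l + (Y %/ s).+1)%N.
have q2m : (2 * q <= m)%N by rewrite em; apply: leq_trans (leq_addr _ _); rewrite leq_mul2r p1 orbT.
have p2s : (2 * p + 1 <= 2 * s)%N by move: s1; clear; lia.
have kcc : (kap + n + 3 <= cc)%N by rewrite /cc; clear; lia.
have [I1 I2 I3] := @parameter_estimates C Lc l s p K cc (kap + n) c0 F N1 N2 A m j k q q1 g g3 r x0 hF B1 V Y W u Zt
  erefl erefl N10 s0 L0 lL kK p2s kcc q2m s2 N2A erefl erefl erefl erefl erefl erefl Wj.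
pose f := curve_poly s c sg1.
have f0 : f`_0 = 1 := curve_coef0 s sg1 c1.
have fint : pint f := curve_pint s c sg1.
have fk := curve_bound c1 cs.
pose h := hpol f p T'.
have gabd' i i' : `|ga i i'| <= 2 ^+ g.
  by apply: le_trans (gabd i i') _; rewrite -natrX ler_nat ltnW // ltn_expl.
have T'j : (T'.+1 <= 2 ^ j)%N.
  by apply: leq_trans mj; rewrite /T'; have := leq_mul kK (leqnn m); rewrite mulSn mulnDl; clear -m5; lia.
have B1T : (B1 <= T')%N := leq_div _ _.
have p2 a : (p ^ a <= 2 ^ (p * a))%N by rewrite expnM; case: a => // a; rewrite leq_exp2r // ltnW // ltn_expl.
pose Dn := (p ^ (2 * A) * 2 ^ (A * (m %/ N2)))%N.
have DnE b : (2 * p * B1 + 2 * p * A + A * (m %/ N2) + b <= x0)%N ->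
    (p ^ (2 * B1) * Dn * 2 ^ b <= 2 ^ x0)%N.
  move=> le; apply: leq_trans (leq_pexp2l _ le) => //.
  have h0 a : (p ^ (2 * a) <= 2 ^ (2 * p * a))%N by apply: leq_trans (p2 _) _; rewrite mulnA [(2 * p)%N]mulnC.
  rewrite [(2 ^ (_ + b))%N]expnD leq_mul2r; apply/orP; right.
  rewrite /Dn [(2 ^ (_ + A * _))%N]expnD mulnA leq_mul2r; apply/orP; right.
  by rewrite expnD; apply: leq_mul.
have ccB : (2 * p * B1 + (kap + n + 2) * B1 <= cc * B1)%N.
  by rewrite -mulnDl leq_mul2r /cc; apply/orP; right; clear; lia.
have Dn0 : (0 < Dn)%N by rewrite muln_gt0 !expn_gt0 p0.
have gaint' i i' : Dn%:R * ga i i' \is a Num.int by rewrite natrM !natrX.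
have x0a : (p ^ (2 * B1) * Dn * 2 ^ g <= 2 ^ x0)%N.
  by apply: DnE; move: ccB; rewrite /x0 /c0; clear; lia.
have x0b : (p ^ (2 * B1) * Dn * 2 ^ ((kap + n + 2) * B1).+1 <= 2 ^ x0)%N.
  by apply: DnE; move: ccB; rewrite /x0 /c0; clear; lia.
have hFb : ((2 * (l * T.+1) * 2 ^ x0) ^ 4 <= 2 ^ hF)%N.
  rewrite /hF [(4 * _)%N]mulnC expnM leq_exp2r // addnC [(2 ^ (_ + x0))%N]expnD leq_mul2r; apply/orP; right.
  rewrite expnD addn1 expnS -mulnA leq_mul2l /=; apply: leq_mul.
    by apply: leq_trans lL _; rewrite ltnW // ltn_expl.
  by apply: leq_trans T'j; rewrite ltnS ltnW.
have lsT : (10 * (l * s) <= T)%N.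
  apply: leq_trans (_ : m <= _)%N; last by rewrite /T leq_pmull.
  by apply: leq_trans m4; rewrite leq_mul2l leq_mul2r lL !orbT.
have hint b (hb : (b <= B1)%N) := hpol_int p0 fint f0 (leq_trans hb B1T).
have [AA [BB [ABnz ABint ABsupp ABbd ABrel]]] := @auxiliary_pair l p s T T' (kap + n) g x0 hF Dn e ga h
  p0 s0 (ltnW TT') e0 hint (hpol_bound T' p0 f0 fk) Dn0 gaint' gabd' x0a x0b hFb grow lsT T0.
have X0 : 0 < X by apply: lt_le_trans X2.
have hfT' : hf ^+ (K.+1 * m) <= hf ^+ T' by rewrite hf_mono // leq_mul2r ltnS kK orbT.
have eta0 : `|2 ^+ r - (z%:R * hf ^+ q / X) ^+ p| <= hf ^+ T'.
  by apply: le_trans dX _; apply: le_trans hfT'.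
have eta1 : `|2 ^+ r - (z%:R * hf ^+ q / X) ^+ p| <= 1.
  by apply: le_trans eta0 (hf_le1 _).
have eta2 : `|2 ^+ r - (z%:R * hf ^+ q / X) ^+ p| <= 2 ^+ g3 * hf ^+ T'.
  by apply: le_trans eta0 _; rewrite ler_peMl ?hf_ge0 // exprn_ege1 // ler1n.
have egap i i' : (e i < e i')%N -> (hF + l + 1 <= e i' - e i)%N.
  by move=> lt; have := gap _ _ lt; move/(leq_ltn_trans I1); rewrite ltn_pmul2l // => /ltnW.
have err i : (e i <= T)%N ->
    `|X * hf ^+ e i - \sum_(j | (e j < T')%N) ga i j * hf ^+ e j| <= 2 ^+ g3 * hf ^+ T'.
  move=> le; apply: le_trans (gaerr i (leq_ltn_trans le TT')) _.
  by rewrite ler_wpM2r ?hf_ge0 // -natrX ler_nat ltnW // ltn_expl.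
have f1 : 1 <= f.[hf ^+ s].
  by rewrite (curve_horner cs) lerDl; apply: sumr_ge0 => i _; apply: hf_ge0.
have w1p' : (z1%:R * hf ^+ q1) ^+ p = 2 ^+ r * f.[hf ^+ s] by rewrite (curve_horner cs).
have B1j : (B1.+1 <= 2 ^ j)%N by apply: leq_trans T'j; rewrite ltnS.
have xdP : (p * (B1 + 2 * l * C) + C)%:R * nrm 1 f <= 2 ^+ (F + j).
  have -> : (F + j = (p * (2 * Lc * C + 1) + C + j) + (C.+1 + (kap + n) * C))%N by rewrite /F; clear; lia.
  rewrite exprD; apply: ler_pM; rewrite ?ler0n ?nrm_ge0 ?(nrm1_curve c1 cs) //.
  rewrite -natrX ler_nat expnD; apply: (@leq_trans ((p * (2 * Lc * C + 1) + C) * B1.+1)).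
    have h1 : (2 * l * C <= 2 * Lc * C)%N by rewrite leq_mul2r leq_mul2l lL !orbT.
    have h2 : (p * (2 * l * C) <= p * (2 * Lc * C))%N by rewrite leq_mul2l h1 orbT.
    move: h2; rewrite !mulnDr muln1 mulnS; set x := (p * (2 * l * C))%N; set x' := (p * (2 * Lc * C))%N.
    by rewrite !mulnDl; clear; lia.
  by apply: leq_mul => //; rewrite ltnW // ltn_expl.
have VP : (2 * l * (2 * l + 2 * l * (F + j) + hF + j) < s * (V - 2 * l))%N.
  by rewrite -/Y /V addKn mulnC; apply: ltn_ceil.
have := @thue_contradiction f p C (kap + n) s r (z1%:R * hf ^+ q1) q1 l e ga T T' g g3 hF j (F + j) V
  (z%:R * hf ^+ q) X q AA BB p0 C0 (leq_trans T0 (ltnW TT')) TT' fint f0 fk (curve_size s sg1 c1) s1 npow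
  f1 w10 w1p' w1q w20 w2q X0 eta1 eta2 einj egap gabd' err ABnz ABint ABsupp ABbd ABrel B1j xdP VP I2.
by rewrite leqNgt => /negP; apply.
Qed.

End Core.

(** Only the exponents [c] determine the shape of the relation; the bound [Cm], independent of the
    solution, leaves finitely many shapes. *)
Definition power_relation (n p Cm : nat) (sg : 'I_n -> nat) :=
  exists C (c : 'I_n -> nat), [/\ (C <= Cm)%N, forall i, (0 < c i <= C)%N &
    forall k, (C < k)%N -> (binp p k \Po (\sum_i hf ^+ sg i *: 'X^(c i)))`_k = 0].

(** For each scale, either all solutions beyond [M1 k] satisfy the relation, or an exception serves
    as first solution and [no_second_solution] bounds all others of that scale. The maximum over the
    finitely many scales is the threshold. *)
Lemma thue_power_relation (n p D r : nat) : (1 < p)%N -> (0 < D)%N ->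
  exists Cm M, forall (m q z : nat) (sg : 'I_n -> nat), (M <= m)%N ->
    is_solution p D r m q z sg -> power_relation p Cm sg.
Proof.
move=> p1 D0; have [K hK] := exp_gt_poly n D.
pose Lc := ((K.+1 * D).+1 ^ n)%N; rewrite -/Lc in hK.
have L0 : (0 < Lc)%N by rewrite expn_gt0.
pose Z x := (512 * K.+1 * Lc * x.+1)%N.
have Z0 x : (0 < Z x)%N by rewrite !muln_gt0 L0.
have [CF hCF] := boolp.choice (fun x => @common_exponent_scale n D (Z x) D0 (Z0 x)).
pose A := (2 * D * K.+1)%N.
(* The finer scale must exceed a multiple of the coarser one that involves [C]. The bound [CF] on
   [C] depends on [N k] alone, not on the first solution, so all scales are fixed in advance. The
   predecessor compensates for the [x.+1] in [Z]. *)
pose stp x := (2 * x + A * (256 * ((CF x.-1 + 5) * Lc) * x))%N.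
pose N k := iter k stp 1%N.
have N0 k : (0 < N k)%N.
  by elim: k => // k IH; rewrite /N iterS -/(N k) addn_gt0 muln_gt0 IH.
pose X k := (K.+1 * (256 * ((CF (N k).-1 + 5) * Lc) * N k))%N.
pose S0 k := (2 * ((2 * p + n + 3) * X k + (n + p + 9)))%N.
have [M1 hM1] := boolp.choice (fun k => hCF (N k).-1 (S0 k)).
pose Q := (Lc ^ 2)%N.
pose Cm := (\max_(k < Q.+1) CF (N k).-1)%N.
have CFm k : (k <= Q)%N -> (CF (N k).-1 <= Cm)%N.
  move=> le; have lt : (k < Q.+1)%N by [].
  exact: (leq_bigmax (F := fun k : 'I_Q.+1 => CF (N k).-1) (Ordinal lt)).
have step k : exists M2, forall (m q z l : nat) (sg : 'I_n -> nat) (e : 'I_l -> nat),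
    (k <= Q)%N -> (M2 <= m)%N -> is_solution p D r m q z sg -> (l <= Lc)%N -> (exists i, e i = 0%N) ->
    (forall i j, (e i < e j)%N -> (m < N k * (e j - e i))%N) ->
    (forall i j, e i = e j -> i = j) ->
    (forall i a, (e i < K.+1 * m)%N -> exists j, (e j <= e i + sg a)%N /\ (N k.+1 * (e i + sg a - e j) <= m)%N) ->
    power_relation p Cm sg.
  have [[m1 [q1 [z1 [sg1 [m1M sol1 nrel]]]]]|none] := boolp.pselect
    (exists (m1 q1 z1 : nat) (sg1 : 'I_n -> nat), [/\ (M1 k <= m1)%N, is_solution p D r m1 q1 z1 sg1 & ~ power_relation p Cm sg1]);
    last first.
    exists (M1 k) => m q z l sg e _ mM sol _ _ _ _ _; apply: boolp.contrapT => nrel.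
    by apply: none; exists m, q, z, sg.
  have [_ hs1 _] := sol1.
  have [C [c [s [kap [/andP[C0 CC] c1 cs hZ [hS _]]]]]] := hM1 k m1 sg1 m1M hs1.
  have [kQ|kQ] := leqP k Q; last first.
    by exists 0%N.
  have npow z' P : curve_poly s c sg1 <> z' *: P ^+ p.
    move=> eP; apply: nrel; exists C, c; split=> //; first exact: leq_trans CC (CFm k kQ).
    by move=> k' lt; apply: (curve_power_rel c1 cs (ltnW p1) eP lt).
  pose X' := (K.+1 * (256 * ((C + 5) * Lc) * N k))%N.
  have XX : (X' <= X k)%N by rewrite leq_mul2l leq_mul2r leq_mul2l leq_mul2r leq_add2r CC !orbT.
  have Zk : (2 * (kap * X') <= s)%N.
    apply: leq_trans hZ; rewrite /X' /Z prednK //; apply/eq_leq; clear; lia.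
  have X0 : (0 < X')%N by rewrite !muln_gt0 addn_gt0 L0 N0 orbT.
  have s2 : ((2 * p + (kap + n) + 3) * X' <= s)%N.
    have h1 : (2 * ((2 * p + n + 3) * X') <= s)%N.
      apply: leq_trans hS; rewrite /S0 leq_mul2l /=; apply: leq_trans (leq_addr _ _).
      by rewrite leq_mul2l XX orbT.
    by move: h1 Zk; rewrite !mulnDl; clear; lia.
  have s1 : (kap + n + p + 9 <= s)%N.
    have h1 : (kap <= kap * X')%N by rewrite leq_pmulr.
    by move: h1 Zk hS; rewrite /S0; set w := ((_ + 3) * X k)%N; clear; lia.
  have NA : (A * (256 * ((C + 5) * Lc) * N k) <= N k.+1)%N.
    rewrite /N iterS -/(N k) /stp; apply: leq_trans (leq_addl _ _).
    by rewrite leq_mul2l leq_mul2r leq_mul2l leq_mul2r leq_add2r CC !orbT.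
  have N2 : (2 * N k <= N k.+1)%N by rewrite /N iterS leq_addr.
  have [M2 hM2] := no_second_solution p1 D0 hK sol1 C0 c1 cs npow (N0 k) N2 NA s1 s2.
  exists M2 => m q z l sg e _ mM sol lL e0 gap einj clos.
  by case: (hM2 m q z l sg e mM sol lL e0 gap einj clos).
have [M2 hM2] := boolp.choice step.
exists Cm, (\max_(k < Q.+1) M2 k).+1 => m q z sg mM sol.
have [_ hs _] := sol.
have m0 : (0 < m)%N by apply: leq_trans mM.
have N2 k : (2 * N k <= N k.+1)%N by rewrite /N iterS leq_addr.
have [k kQ [l [e [lL e0 gap einj clos]]]] := @separated_representatives n D K m sg N m0 (fun i => proj2 (andP (hs i))) (N0 0%N) N2.
have kQ' : (k < Q.+1)%N by rewrite ltnS.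
apply: (hM2 k m q z l sg e) => //; apply: leq_trans (ltnW mM).
exact: (leq_bigmax (F := fun k : 'I_Q.+1 => M2 k) (Ordinal kQ')).
Qed.

(** * The 2-adic case *)

(** Among [#|I| + 1] windows of length [dl] above [N], one contains no exponent. The difference of
    [v] and the partial sum below it is divisible by the power of 2 at the upper end of the window,
    but too small to be nonzero. *)
Lemma dvdz_gap_sum (I : finType) (C : I -> int) (ex : I -> nat) (v : int) (N L W dl : nat) :
  (`|v| <= W * 2 ^ N)%N -> (W + \sum_i `|C i| < 2 ^ dl)%N -> (N + #|I|.+1 * dl <= L)%N ->
  (2 ^+ L %| v - \sum_i C i * 2 ^+ ex i)%Z ->
  exists J : {set I}, v = \sum_(i in J) C i * 2 ^+ ex i.
Proof.
move=> hv hC hL dv.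
have [k hk] : exists k : 'I_#|I|.+1, forall i, ~~ (N + k * dl <= ex i < N + k.+1 * dl)%N.
  apply: boolp.contrapT => none.
  have h (k : 'I_#|I|.+1) : exists i, (N + k * dl <= ex i < N + k.+1 * dl)%N.
    apply: boolp.contrapT => nk; apply: none; exists k => i; apply/negP => hi; apply: nk; by exists i.
  have [F hF] := boolp.choice h.
  suff /leq_card : injective F by rewrite card_ord ltnn.
  move=> a b e; apply: val_inj => /=; have := hF a; rewrite e; have := hF b.
  move=> /andP[h1 h2] /andP[h3 h4].
  have := leq_ltn_trans h1 h4; have := leq_ltn_trans h3 h2; rewrite !ltn_add2l !ltn_mul2r.
  by move=> /andP[_ ?] /andP[_ ?]; apply/eqP; rewrite eqn_leq -ltnS andbC -ltnS; apply/andP.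
set t := (N + k * dl)%N in hk.
have tL : (t + dl <= L)%N.
  by apply: leq_trans hL; rewrite /t -addnA leq_add2l addnC -mulSn leq_mul2r ltn_ord orbT.
pose J := [set i | (ex i < t)%N]; exists J; apply: subr0_eq.
set y := v - _.
have dy : (2 ^+ (t + dl) %| y)%Z.
  have -> : y = (v - \sum_i C i * 2 ^+ ex i) + \sum_(i | i \notin J) C i * 2 ^+ ex i.
    by rewrite [X in v - X](bigID (mem J)) /= /y; ring.
  apply: rpredD; first by apply: dvdz_trans dv; rewrite -(subnK tL) exprD dvdz_mull.
  apply: rpred_sum => i; rewrite inE -leqNgt => ti; apply: dvdz_mull.
  have {}ti : (t + dl <= ex i)%N.
    by have := hk i; rewrite /t mulSn [(dl + _)%N]addnC addnA -/t ti /= -leqNgt.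
  by rewrite -(subnK ti) exprD dvdz_mull.
have by_ : (`|y| < 2 ^ (t + dl))%N.
  rewrite expnD mulnC.
  apply: leq_ltn_trans (_ : (W + \sum_i `|C i|) * 2 ^ t < _)%N; last by rewrite ltn_pmul2r ?expn_gt0.
  rewrite -lez_nat abszE mulnDl PoszD; apply: le_trans (ler_normB _ _) _; apply: lerD.
    rewrite -abszE lez_nat; apply: leq_trans hv _; rewrite leq_mul2l; apply/orP; right.
    by rewrite leq_pexp2l // leq_addr.
  apply: le_trans (ler_norm_sum _ _ _) _.
  rewrite big_distrl /= (big_morph Posz PoszD erefl) [leRHS](bigID (mem J)) /=.
  apply: ler_wpDr; first by apply: sumr_ge0.
  apply: ler_sum => i; rewrite inE => lt; rewrite -abszE lez_nat abszM abszX leq_mul2l; apply/orP; right.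
  by rewrite leq_pexp2l // ltnW.
move: dy by_; rewrite dvdzE abszX /= => /dvdn_leq.
have [->//|y0] := eqVneq y 0; rewrite absz_gt0 y0 => /(_ isT) h1 h2.
by have := leq_ltn_trans h1 h2; rewrite ltnn.
Qed.

(** The cofactor of [a - b] is a sum of [p] odd products, hence odd. *)
Lemma odd_pow_congr (p L : nat) (a b : int) : odd p -> (2 %| a - 1)%Z -> (2 %| b - 1)%Z ->
  (2 ^+ L %| a ^+ p - b ^+ p)%Z -> (2 ^+ L %| a - b)%Z.
Proof.
move=> po a1 b1; rewrite subrXX; set S := \sum_i _.
have oM x x' : (2 %| x - 1)%Z -> (2 %| x' - 1)%Z -> (2 %| x * x' - 1)%Z.
  move=> hx hy; have -> : x * x' - 1 = (x - 1) * x' + (x' - 1) by ring.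
  by apply: rpredD; rewrite // dvdz_mulr.
have oX x k : (2 %| x - 1)%Z -> (2 %| x ^+ k - 1)%Z.
  by move=> hx; elim: k => [|k IH]; rewrite ?subrr ?dvdz0 // exprS oM.
have S1 : (2 %| S - 1)%Z.
  have -> : S - 1 = \sum_(i < p) (a ^+ (p.-1 - i) * b ^+ i - 1) + (p%:Z - 1).
    by rewrite sumrB sumr_const card_ord -natz; ring.
  apply: rpredD; first by apply: rpred_sum => i _; apply: oM; apply: oX.
  by case: p po {S} => [//|p'] /=; rewrite -addn1 PoszD addrK dvdzE /= dvdn2.
have [t et] := dvdzP S1.
rewrite Gauss_dvdzl // coprimezXl //; apply/coprimezP; exists (- t, 1) => /=.
by rewrite mul1r; lia.
Qed.

(** [a - b] and [a + b] have the sum [2 a], so they are not both divisible by [2^(t + 2)]; one of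
    them takes all but [t + 1] of the [L] factors 2. *)
Lemma square_congr (t L : nat) (a b : int) : ~~ (2 ^+ t.+1 %| a)%Z ->
  (2 ^+ L %| a ^+ 2 - b ^+ 2)%Z ->
  exists eps : bool, (2 ^+ (L - t.+1) %| a - (-1) ^+ eps * b)%Z.
Proof.
rewrite subr_sqr => na dv; set u := a - b in dv; set v := a + b in dv.
have uv : ~~ (2 ^+ t.+2 %| u + v)%Z.
  have -> : u + v = 2 * a by rewrite /u /v; ring.
  by rewrite exprS dvdz_mul2l.
have hv (x : int) k : x != 0 -> (2 ^+ k %| x)%Z = (k <= logn 2 `|x|)%N.
  by move=> x0; rewrite dvdzE abszX /= pfactor_dvdn // absz_gt0.
suff [h|h] : (2 ^+ (L - t.+1) %| u)%Z \/ (2 ^+ (L - t.+1) %| v)%Z.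
- by exists false; rewrite expr0 mul1r.
- by exists true; rewrite expr1 mulN1r opprK.
have [->|u0] := eqVneq u 0; first by left; rewrite dvdz0.
have [->|v0] := eqVneq v 0; first by right; rewrite dvdz0.
move: dv uv; rewrite hv ?mulf_neq0 // abszM lognM ?absz_gt0 // => dv uv.
rewrite !hv //; have [h1|h1] := ltnP (logn 2 `|u|) t.+2; first by right; move: h1 dv; clear; lia.
left; have [h2|h2] := ltnP (logn 2 `|v|) t.+2; first by move: h2 dv; clear; lia.
by case/negP: uv; apply: rpredD; rewrite hv.
Qed.

Lemma dvdz_horner_drop (P : {poly int}) (s K : nat) (x : int) :
  (forall i, (i < K)%N -> P`_i = 0) -> (2 ^+ s %| x)%Z -> (2 ^+ (s * K) %| P.[x])%Z.
Proof.
move=> hP hx; rewrite horner_coef; apply: rpred_sum => i _.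
have [lt|le] := ltnP i K; first by rewrite hP // mul0r dvdz0.
by apply: dvdz_mull; rewrite exprM; apply: dvdz_trans (dvdz_exp2r K hx) _; apply: dvdz_exp2l.
Qed.

(* [p ^ (2K)] clears the denominators of the [K]-th truncation of [(1 + X)^(1/p)]. *)
Definition ibinp p K : {poly int} := \poly_(k < K.+1) Num.floor (p%:R ^+ (2 * K) * bcoef p k).

Lemma map_ibinp p K : (0 < p)%N -> map_poly intr (ibinp p K) = p%:R ^+ (2 * K) *: binp p K :> {poly rat}.
Proof.
move=> p0; apply/polyP => k; rewrite coef_map coefZ coef_poly coef_binp ltnS /=.
case: leqP => lt; rewrite ?rmorph0 ?mulr0 //.
have -> : (2 * K = 2 * (K - k) + 2 * k)%N by rewrite -mulnDr subnK.
by rewrite floorK // exprD -mulrA rpredM ?rpredX ?rpred_nat // bcoef_int.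
Qed.

Lemma ibinp_root p K i : (0 < p)%N -> (0 < K)%N -> (i < K.+1)%N ->
  (ibinp p K ^+ p - (p ^ (2 * K * p))%:R * (1 + 'X))`_i = 0.
Proof.
move=> p0 K0 lt; apply/eqP; rewrite -(intr_eq0 rat) -coef_map.
rewrite rmorphB rmorphM rmorphXn rmorphD rmorph1 /= map_polyX map_ibinp // rmorph_nat.
have -> : (p ^ (2 * K * p))%:R = ((p%:R ^+ (2 * K)) ^+ p)%:P :> {poly rat}.
  by rewrite -exprM -natrX polyC_natr.
rewrite exprZn mul_polyC -scalerBr coefZ coefB coef_binpX //.
by rewrite subrr mulr0.
Qed.

(** Words index the terms of the expanded powers before equal ones are collected, so the index set,
    and with it the number of possible [J], does not depend on the exponents. *)
Definition word n K : finType := {k : 'I_K.+1 & {ffun 'I_k -> 'I_n}}.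

Lemma horner_word n K (P : {poly int}) (x : 'I_n -> int) : (size P <= K.+1)%N ->
  P.[\sum_i x i] = \sum_(w : word n K) P`_(tag w) * \prod_j x (tagged w j).
Proof.
move=> sP; rewrite (horner_coef_wide _ sP).
rewrite -(sig_big_dep predT (fun _ => predT) (fun (k : 'I_K.+1) (f : {ffun 'I_k -> 'I_n}) => P`_k * \prod_j x (f j))) /=.
apply: eq_bigr => k _; rewrite -mulr_sumr; congr (_ * _).
have -> : (\sum_i x i) ^+ k = \prod_(j < k) \sum_i x i by rewrite prodr_const card_ord.
by rewrite bigA_distr_bigA.
Qed.

Lemma ibinp_coef0 p K : (0 < p)%N -> (ibinp p K)`_0 = p%:Z ^+ (2 * K).
Proof.
move=> p0; apply: (intr_inj (R := rat)); rewrite -coef_map map_ibinp // coefZ binp0 mulr1.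
by rewrite rmorphXn.
Qed.

Lemma odd_dvdz m : odd m -> (2 %| m%:Z - 1)%Z.
Proof. by case: m => [//|m] /=; rewrite -addn1 PoszD addrK dvdzE /= dvdn2. Qed.

Lemma two_adic n p K : (1 < p)%N -> (p == 2) || odd p -> (0 < K)%N ->
  exists M, forall (mm : 'I_n -> nat) (s N z : nat), (0 < s)%N -> (M <= N)%N ->
    (forall i, s <= mm i <= N)%N -> (2 * N <= s * K.+1)%N -> (z ^ p = 1 + \sum_i 2 ^ mm i)%N ->
    exists J : {set word n K},
      (p ^ (2 * K * p))%:R * (1 + \sum_i 2 ^+ mm i) =
      (\sum_(w in J) (ibinp p K)`_(tag w) * \prod_j 2 ^+ mm (tagged w j)) ^+ p :> int.
Proof.
move=> p1 hp K0; have p0 := ltnW p1.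
pose W := (p ^ (2 * K) * n.+1)%N; pose C (w : word n K) := (ibinp p K)`_(tag w).
pose dl := (W + \sum_w `|C w|)%N.
(* The modulus is at least [2^(2 N)], so [N] bits remain above the size of [z]. They must hold the
   windows of [dvdz_gap_sum] and the loss [2 K + 1] of [square_congr], where [a = 2^(2K) z] with [z]
   odd. *)
exists (#|word n K|.+1 * dl + (2 * K).+1)%N => mm s N z s0 hN hmm h2 ez.
pose x : int := \sum_i 2 ^+ mm i.
pose a : int := p%:Z ^+ (2 * K) * z%:Z; pose b := (ibinp p K).[x].
have ez' : z%:Z ^+ p = 1 + x.
  rewrite -[z%:Z]natz -natrX ez natrD natr_sum; congr (_ + _); apply: eq_bigr => i _.
  by rewrite natrX.
have xs : (2 ^+ s %| x)%Z.
  by apply: rpred_sum => i _; apply: dvdz_exp2l; case/andP: (hmm i).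
have x2 : (2 %| x)%Z by apply: dvdz_trans xs; apply: (@dvdz_exp2l 2 1 s).
have ab : (2 ^+ (s * K.+1) %| a ^+ p - b ^+ p)%Z.
  have -> : a ^+ p - b ^+ p = - (ibinp p K ^+ p - (p ^ (2 * K * p))%:R * (1 + 'X)).[x].
    rewrite !hornerE -/b exprMn ez' -exprM -natz -natrX.
    by rewrite -(polyC_natr _ (p ^ _)) hornerC; ring.
  rewrite rpredN; apply: dvdz_horner_drop xs => i lt; exact: ibinp_root.
have zo : odd z.
  have : odd (z ^ p).
    rewrite ez oddD /= (_ : odd _ = false) //; apply: negbTE; rewrite -dvdn2; apply: dvdn_sum => i _.
    by rewrite dvdn2 oddX /= orbF; have /andP[h _] := hmm i; rewrite -lt0n (leq_trans s0).
  by rewrite oddX => /orP[/eqP p00|//]; rewrite p00 in p0.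
have [eps epsp epsd] : exists2 eps : bool, ((-1 : int) ^+ eps) ^+ p = 1 &
    (2 ^+ (s * K.+1 - (2 * K).+1) %| a - (-1) ^+ eps * b)%Z.
  have [po|pe] := boolP (odd p).
    exists false; first by rewrite expr0 expr1n.
    rewrite expr0 mul1r; apply: dvdz_trans (dvdz_exp2l _ (leq_subr _ _)) _.
    apply: (odd_pow_congr po _ _ ab).
      rewrite /a -[p%:Z]natz -natrX natz -PoszM; apply: odd_dvdz.
      by rewrite oddM oddX po orbT.
    have -> : b - 1 = (ibinp p K - ((ibinp p K)`_0)%:P).[x] + ((ibinp p K)`_0 - 1).
      by rewrite hornerD hornerN hornerC addrA subrK.
    apply: rpredD.
      have := @dvdz_horner_drop (ibinp p K - ((ibinp p K)`_0)%:P) 1 1 x; rewrite expr1; apply=> //.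
      by move=> i; rewrite ltnS leqn0 => /eqP->; rewrite coefB coefC eqxx subrr.
    rewrite ibinp_coef0 // -[p%:Z]natz -natrX natz; apply: odd_dvdz.
    by rewrite oddX po orbT.
  have p2 : p = 2%N by move: hp; rewrite (negPf pe) orbF => /eqP.
  rewrite p2 in ab; have [|eps he] := @square_congr (2 * K) _ a b _ ab; last first.
    by exists eps => //; rewrite p2 sqrr_sign.
  rewrite /a p2 exprSr dvdz_mul2l; last by rewrite expf_neq0.
  by rewrite dvdzE /= dvdn2 zo.
have [] := @dvdz_gap_sum (word n K) C (fun w => \sum_j mm (tagged w j))%N ((-1) ^+ eps * a) N
  (s * K.+1 - (2 * K).+1) W dl.
- rewrite abszMsign abszM abszX /= /W -mulnA leq_mul2l; apply/orP; right.
  (* The crude bound [z <= z ^ p <= (n + 1) 2^N] is enough, thanks to the modulus [2^(2 N)]. *)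
  apply: (@leq_trans (z ^ p)); first by case: z {ez ez' a ab zo epsd} => // z; rewrite -[z.+1 in X in (X <= _)%N]expn1 leq_pexp2l.
  rewrite ez mulSn; apply: leq_add; first by rewrite expn_gt0.
  apply: (@leq_trans (\sum_(i < n) 2 ^ N)); last by rewrite sum_nat_const card_ord.
  by apply: leq_sum => i _; rewrite leq_pexp2l //; case/andP: (hmm i).
- by rewrite ltn_expl.
- by rewrite leq_subRL; move: hN h2; clear; lia.
- have -> : \sum_w C w * 2 ^+ (\sum_j mm (tagged w j))%N = b.
    rewrite /b /x (@horner_word n K) ?size_poly //; apply: eq_bigr => w _; by rewrite expr_sum.
  have -> : (-1) ^+ eps * a - b = (-1) ^+ eps * (a - (-1) ^+ eps * b).
    by rewrite mulrBr signrMK.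
  by rewrite dvdz_mull.
move=> J eJ; exists J.
have -> : \sum_(w in J) (ibinp p K)`_(tag w) * \prod_j 2 ^+ mm (tagged w j) = (-1) ^+ eps * a.
  by rewrite eJ; apply: eq_bigr => w _; rewrite -expr_sum.
rewrite exprMn epsp mul1r exprMn -ez' -exprM.
by rewrite natrX natz.
Qed.

From mathcomp Require Import mpoly.

(** * Polynomial relations *)

Lemma linear_not_power (a : rat) p (Q : {poly rat}) : a != 0 -> (1 < p)%N -> a *: (1 + 'X) <> Q ^+ p.
Proof.
move=> a0 p1 e; have := size_exp Q p; rewrite -e size_scale // addrC size_XaddC /=.
by move=> /esym/eqP; rewrite muln_eq1 => /andP[_ /eqP p11]; rewrite p11 in p1.
Qed.

Definition adic_poly n p K (J : {set word n K}) : {mpoly rat[n]} :=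
  (p ^ (2 * K * p))%:R *: (1 + \sum_i 'X_i) -
    (\sum_(w in J) ((ibinp p K)`_(tag w))%:~R *: \prod_j 'X_(tagged w j)) ^+ p.

(** With all variables but the last set to 0, vanishing would make a polynomial of degree 1 a [p]-th
    power. *)
Lemma adic_poly_neq0 n p K (J : {set word n.+1 K}) : (1 < p)%N -> adic_poly p J != 0.
Proof.
move=> p1; apply/eqP => e0.
pose h (i : 'I_n.+1) : {poly rat} := if i == ord_max then 'X else 0.
have := congr1 (mmap (@polyC rat) h : {mpoly rat[n.+1]} -> {poly rat}) e0.
rewrite rmorph0 rmorphB [X in _ - X]rmorphXn /= mmapZ rmorphD rmorph1 rmorph_sum /=.
rewrite (bigD1 ord_max) //= big1 => [|i /negPf hi]; last by rewrite mmapX mmap1U /h hi.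
rewrite mmapX mmap1U /h eqxx addr0 mul_polyC => /subr0_eq; apply: linear_not_power => //.
by rewrite pnatr_eq0 -lt0n expn_gt0 (ltnW p1).
Qed.

Lemma adic_poly_eval n p K (J : {set word n K}) (x : 'I_n -> int) :
  (p ^ (2 * K * p))%:R * (1 + \sum_i x i) =
    (\sum_(w in J) (ibinp p K)`_(tag w) * \prod_j x (tagged w j)) ^+ p ->
  (adic_poly p J).@[fun i => (x i)%:~R] = 0.
Proof.
move=> /(congr1 (fun u : int => u%:~R : rat)); rewrite rmorphM rmorph_nat [X in _ = X]rmorphXn rmorphD rmorph1 !rmorph_sum /= => e.
rewrite /adic_poly mevalB mevalZ mevalD meval1 rmorph_sum /= (eq_bigr (fun i => (x i)%:~R)) => [|i _]; last by rewrite mevalXU.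
rewrite e [X in _ - X]rmorphXn rmorph_sum /=; apply/eqP; rewrite subr_eq0; apply/eqP; congr (_ ^+ _).
apply: eq_bigr => w _; rewrite mevalZ rmorphM rmorph_prod rmorph_prod /=; congr (_ * _).
by apply: eq_bigr => j _; rewrite mevalXU.
Qed.

Section RelPoly.
Variables (n p k : nat) (c : 'I_n.+1 -> nat).

(* The [k]-th coefficient of [binp p k] at [\sum_i t_i Y^(c i)], where [t_i = x_i / x_n] for [i < n] and
   [t_n = 1 / x_n], multiplied by [x_n ^ k]. *)
Definition rel_poly : {mpoly rat[n.+1]} :=
  let P : {poly {mpoly rat[n.+1]}} := \sum_i (if i == ord_max then 1 else 'X_i) *: 'X^(c i) in
  \sum_(j < k.+1) bcoef p j *: ('X_ord_max ^+ (k - j) * (P ^+ j)`_k).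

Lemma rel_poly_eval (v : 'I_n.+1 -> rat) : v ord_max != 0 ->
  rel_poly.@[v] = v ord_max ^+ k *
    (binp p k \Po (\sum_i ((if i == ord_max then 1 else v i) / v ord_max) *: 'X^(c i)))`_k.
Proof.
move=> v0; pose Pv : {poly rat} := \sum_i (if i == ord_max then 1 else v i) *: 'X^(c i).
have -> : \sum_i ((if i == ord_max then 1 else v i) / v ord_max) *: 'X^(c i) = (v ord_max)^-1 *: Pv.
  by rewrite scaler_sumr; apply: eq_bigr => i _; rewrite scalerA mulrC.
have eP : map_poly (meval v) (\sum_i (if i == ord_max then 1 else 'X_i) *: 'X^(c i)) = Pv.
  rewrite rmorph_sum /=; apply: eq_bigr => i _; rewrite -mul_polyC rmorphM /= map_polyXn map_polyC /= mul_polyC.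
  by congr (_ *: _); case: ifP => _; rewrite ?meval1 ?mevalXU.
rewrite /binp poly_def (raddf_sum (comp_poly _)) /= coef_sum mulr_sumr /rel_poly rmorph_sum /=; apply: eq_bigr => j _.
rewrite comp_polyZ comp_Xn_poly exprZn !coefZ mevalZ mevalM [X in _ * (X * _) = _]rmorphXn /= mevalXU -coef_map rmorphXn /= eP.
rewrite [in RHS]mulrCA; congr (_ * _); rewrite [in RHS]mulrA exprVn -expfB_cond //.
by rewrite (negPf v0) add0n -ltnS ltn_ord.
Qed.

(** At the point with last coordinate 1 and all others 0 the inner sum is a single monomial, and the
    value is [bcoef p b.+1]. This is why [k] is taken to be a multiple of [c ord_max]. *)
Lemma rel_poly_neq0 b : (1 < p)%N -> (0 < c ord_max)%N -> k = (c ord_max * b.+1)%N -> rel_poly != 0.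
Proof.
move=> p1 c0 ek; apply/eqP => e0; pose v (i : 'I_n.+1) : rat := (i == ord_max)%:R.
have := rel_poly_eval (v := v); rewrite e0 meval0 {1 2}/v eqxx oner_eq0 expr1n mul1r => /(_ isT).
rewrite (bigD1 ord_max) //= eqxx big1 ?addr0 => [|i /negPf hi]; last by rewrite hi /v hi mul0r scale0r.
rewrite /v eqxx divr1 scale1r coef_comp_poly_Xn // ek dvdn_mulr // mulKn // coef_binp leq_pmull //.
by move/esym/eqP; apply/negP; exact: bcoef_neq0.
Qed.

End RelPoly.

Lemma thue_case n p D : (1 < p)%N -> (0 < D)%N ->
  exists2 G : {mpoly rat[n.+1]}, G != 0 & exists M, forall (mm : 'I_n.+1 -> nat) (z : nat),
    (M <= mm ord_max)%N ->
    (forall i, i != ord_max -> mm ord_max <= D * (mm ord_max - mm i))%N ->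
    (z ^ p = 1 + \sum_i 2 ^ mm i)%N -> G.@[fun i => ((2 : int) ^+ mm i)%:~R] = 0.
Proof.
move=> p1 D0.
have [Cm hCm] := boolp.choice (fun r : nat => @thue_power_relation n.+1 p D r p1 D0).
have [M hM] := boolp.choice hCm.
(* The degree [c ord_max * (Cm r).+1] exceeds every admissible [C], so that the relation of
   [power_relation] applies to it. *)
pose R (r : nat) (c : {ffun 'I_n.+1 -> 'I_(Cm r).+1}) : {mpoly rat[n.+1]} :=
  rel_poly p (c ord_max * (Cm r).+1) (fun i => c i : nat).
exists (\prod_(r : 'I_p) \prod_(c : {ffun 'I_n.+1 -> 'I_(Cm r).+1} | (0 < c ord_max)%N) R r c).
  by apply/prodf_neq0 => r _; apply/prodf_neq0 => c c0; apply: rel_poly_neq0.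
exists (\max_(r < p) M r).+1 => mm z; set N := mm ord_max => MN hD ez.
have rp : (N %% p < p)%N by rewrite ltn_mod ltnW.
pose r := Ordinal rp; pose sg i := if i == ord_max then N else (N - mm i)%N.
have lt i : i != ord_max -> (mm i <= N)%N.
  move=> hi; have := hD i hi; case: (leqP (mm i) N) => // /ltnW; rewrite -subn_eq0 => /eqP->.
  by rewrite muln0 leqNgt (leq_trans _ MN).
have sol : is_solution p D (N %% p) N (N %/ p) z sg.
  split; first by rewrite mulnC -divn_eq.
    move=> i; rewrite /sg; case: eqVneq => [_|hi]; first by rewrite leqnn leq_pmull.
    by rewrite leq_subr hD.
  rewrite ez (bigD1 ord_max) //= [in RHS](bigD1 ord_max) //= /sg eqxx subnn addnCA; congr (_ + (_ + _))%N.
  by apply: eq_bigr => i hi; rewrite (negPf hi) subKn ?lt.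
have MN' : (M (N %% p) <= N)%N.
  by apply: leq_trans (ltnW MN); exact: (leq_bigmax (F := fun r : 'I_p => M r) r).
have [C [c [CC c1 rel]]] := hM _ N _ z sg MN' sol.
have cC i : (c i < (Cm r).+1)%N by rewrite ltnS; apply: leq_trans CC; case/andP: (c1 i).
pose c' : {ffun 'I_n.+1 -> 'I_(Cm r).+1} := [ffun i => Ordinal (cC i)].
have c'0 : (0 < c' ord_max)%N by rewrite ffunE /=; case/andP: (c1 ord_max).
rewrite (bigD1 r) //= (bigD1 c') //= !mevalM.
set v := fun i => _; suff -> : (R r c').@[v] = 0 by rewrite !mul0r.
have v0 i : v i = 2 ^+ mm i by rewrite /v rmorphXn.
rewrite rel_poly_eval; last by rewrite v0 expf_neq0.
apply/eqP; rewrite mulf_eq0 orbC; apply/orP; left; apply/eqP.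
rewrite -[RHS](rel (c' ord_max * (Cm r).+1)%N); last first.
  by apply: leq_trans (_ : (Cm r).+1 <= _)%N; rewrite ?ltnS // leq_pmull.
congr ((_ \Po _)`_ _); apply: eq_bigr => i _; rewrite ffunE /= !v0; congr (_ *: _).
rewrite /sg; case: eqVneq => [_|hi]; first by rewrite exprVn mul1r.
have -> : 2 ^+ mm ord_max = 2 ^+ (N - mm i) * 2 ^+ mm i :> rat by rewrite -exprD subnK // lt.
by rewrite invfM mulrCA divff ?expf_neq0 // mulr1 exprVn.
Qed.

Lemma adic_case n p K : (1 < p)%N -> (p == 2)%N || odd p -> (0 < K)%N ->
  exists2 G : {mpoly rat[n.+1]}, G != 0 & exists M, forall (mm : 'I_n.+1 -> nat) (s N z : nat),
    (0 < s)%N -> (M <= N)%N -> (forall i, s <= mm i <= N)%N -> (2 * N <= s * K.+1)%N ->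
    (z ^ p = 1 + \sum_i 2 ^ mm i)%N -> G.@[fun i => ((2 : int) ^+ mm i)%:~R] = 0.
Proof.
move=> p1 hp K0; have [M hM] := two_adic n.+1 p1 hp K0.
exists (\prod_(J : {set word n.+1 K}) adic_poly p J).
  by apply/prodf_neq0 => J _; apply: adic_poly_neq0.
exists M => mm s N z s0 MN hmm h2 ez; have [J eJ] := hM mm s N z s0 MN hmm h2 ez.
by rewrite (bigD1 J) //= mevalM (adic_poly_eval (x := fun i => 2 ^+ mm i) eJ) mul0r.
Qed.

(* From the two cases to the set of points *)
From mathcomp Require Import classical_sets cardinality reals.
Local Open Scope classical_set_scope.
Local Open Scope ring_scope.

Lemma sorted_exponents n (m : n.+1.-tuple int) : path <%R 0 m ->
  (forall i, 0 < tnth m i) /\ {mono (fun i => tnth m i) : i j / (i <= j)%N >-> i <= j}.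
Proof.
move=> hm; split.
  move=> i; have := order_path_min lt_trans hm => /allP; apply; exact: mem_tnth.
move=> i j; rewrite !(tnth_nth 0); have hs := path_sorted hm.
by rewrite (lt_sorted_leq_nth 0 hs) ?inE ?size_tuple ?ltn_ord.
Qed.

Lemma finite_small_points n (M : nat) :
  finite_set [set x : n.-tuple int | exists2 m : 'I_n -> nat, (forall i, m i < M)%N &
    x = [tuple (2 : int) ^+ m i | i < n]].
Proof.
apply: (@sub_finite_set _ _ ((fun f : {ffun 'I_n -> 'I_M} => [tuple (2 : int) ^+ f i | i < n]) @` setT)).
  move=> x [m hm ->]; exists [ffun i => Ordinal (hm i)] => //.
  by apply: eq_from_tnth => i; rewrite !tnth_mktuple ffunE.
apply: finite_image; exact: finite_finset.
Qed.

Theorem theorem4p4 (n d : nat) (hn : (2 <= n)%N) (hd : (2 <= d)%N)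
    (R : realType) (alpha gamma : R)
    (halpha : 0 < alpha < 1) (hgamma : 0 < gamma < 1) :
  exists2 G : {mpoly rat[n]}, G != 0 &
    finite_set [set x | perfect_power_points n d alpha gamma x /\
                        G.@[fun i : 'I_n => (tnth x i)%:~R] <> 0].
Proof.
case: n hn => [//|n] n0.
(* The 2-adic case extracts roots by [odd_pow_congr] or by [square_congr], hence an odd exponent or
   2 is wanted. *)
pose p := if odd d then d else 2%N.
have p1 : (1 < p)%N by rewrite /p; case: ifP.
have hp : (p == 2)%N || odd p by rewrite /p; case: ifP => // ->; rewrite orbT.
have pd : (p %| d)%N by rewrite /p; case: ifP => [//|/negbT]; rewrite dvdn2.
case/andP: halpha => a0 a1; case/andP: hgamma => g0 g1.
have b0 : 0 < 1 - alpha by rewrite subr_gt0.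
(* [D] turns [m_(n-1) <= alpha m_n] into [m_n <= D (m_n - m_i)], and [K] turns [m_1 >= gamma m_n]
   into [2 m_n <= (K + 1) m_1]. *)
pose D := Num.bound (1 - alpha)^-1; pose K := Num.bound (2 / gamma).
have hD : 1 <= D%:R * (1 - alpha).
  rewrite -ler_pdivrMr // div1r ltW //; apply: archi_boundP; rewrite invr_ge0 ltW //.
have hK : 2 <= gamma * K.+1%:R.
  rewrite -ler_pdivrMl // mulrC; apply: le_trans (_ : K%:R <= _); last by rewrite ler_nat.
  by rewrite ltW //; apply: archi_boundP; rewrite divr_ge0 // ltW.
have D0 : (0 < D)%N by rewrite lt0n; apply: contraTneq hD => ->; rewrite mul0r -ltNge.
have K0 : (0 < K)%N by rewrite lt0n; apply: contraTneq hK => ->; rewrite mulr1 -ltNge (lt_trans g1) // ltr1n.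
have [G1 G1n [M1 hG1]] := @thue_case n p D p1 D0.
have [G2 G2n [M2 hG2]] := @adic_case n p K p1 hp K0.
exists (G1 * G2); first by rewrite mulf_neq0.
(* Points with [m_n >= M1 + M2] are zeros of one of the two factors; the others have all exponents
   below this bound. *)
apply: sub_finite_set (@finite_small_points n.+1 (M1 + M2)) => x [[m [ex hm ha [z ez]]] nz].
have [mpos mmono] := sorted_exponents hm.
pose mm i := `|tnth m i|%N.
have mE i : tnth m i = mm i by rewrite /mm gtz0_abs.
have xE i : tnth x i = 2 ^+ mm i by rewrite ex tnth_mktuple mE.
exists mm; last by apply: eq_from_tnth => i; rewrite tnth_mktuple.
have mle i : (mm i <= mm ord_max)%N by rewrite -lez_nat -!mE mmono -ltnS.
move=> i; apply: leq_ltn_trans (mle i) _; rewrite ltnNge; apply/negP => big; apply: nz.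
have [M1N M2N] : (M1 <= mm ord_max)%N /\ (M2 <= mm ord_max)%N.
  by split; apply: leq_trans big; rewrite ?leq_addr ?leq_addl.
(* For even [d] the root [z] may be negative; since [z ^ d] is positive, its absolute value
   serves. *)
have ez' : ((`|z| ^ (d %/ p)) ^ p = 1 + \sum_i 2 ^ mm i)%N.
  rewrite -expnM divnK // -abszX -ez; apply/eqP; rewrite -eqz_nat abszE ger0_norm.
    rewrite PoszD (big_morph Posz PoszD erefl); apply/eqP; congr (_ + _).
    by apply: eq_bigr => j _; rewrite mE -[RHS]natz natrX.
  by apply: addr_ge0 => //; apply: sumr_ge0 => j _; rewrite mE exprn_ge0.
have xv : (fun i : 'I_n.+1 => (tnth x i)%:~R : rat) = fun i => ((2 : int) ^+ mm i)%:~R.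
  by apply: boolp.funext => j; rewrite xE.
rewrite xv mevalM.
have mN : m`_n = mm ord_max by rewrite -mE (tnth_nth 0).
case: ha => /= [ha|ha].
  rewrite (hG1 mm _ M1N _ ez') ?mul0r // => j jn.
  have jlt : (j <= n.-1)%N.
    have := ltn_ord j; rewrite ltnS leq_eqVlt => /orP[/eqP e|h]; last by rewrite -ltnS prednK.
    by case/eqP: jn; apply: val_inj.
  have lt : (n.-1 < n.+1)%N by rewrite (leq_ltn_trans (leq_pred _)).
  have e2 : m`_n.-1 = mm (Ordinal lt) by rewrite -mE (tnth_nth 0).
  have jm : (mm j <= mm (Ordinal lt))%N by rewrite -lez_nat -!mE mmono.
  have jm' : (mm j)%:R <= alpha * (mm ord_max)%:R.
    by apply: le_trans (_ : (mm (Ordinal lt))%:R <= _); rewrite ?ler_nat //; move: ha; rewrite e2 mN.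
  rewrite -(ler_nat R) natrM natrB ?mle //.
  apply: le_trans (_ : D%:R * ((1 - alpha) * (mm ord_max)%:R) <= _).
    by rewrite mulrA ler_peMl // ler0n.
  by rewrite ler_wpM2l ?ler0n // mulrBl mul1r lerD2l lerN2.
rewrite (hG2 mm (mm ord0) (mm ord_max) _ _ M2N _ _ ez') ?mulr0 //.
- by rewrite -ltz_nat -mE.
- by move=> j; rewrite mle andbT -lez_nat -!mE mmono.
have e0 : m`_0 = mm ord0 by rewrite -mE (tnth_nth 0).
rewrite -(ler_nat R) !natrM; apply: le_trans (_ : gamma * (mm ord_max)%:R * K.+1%:R <= _).
  by rewrite mulrAC ler_wpM2r // ler0n.
by rewrite ler_wpM2r ?ler0n //; move: ha; rewrite mN e0.
Qed.
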